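(* Let $\Phi_0$ be a strictly plurisubharmonic quadratic form on $\mathbb{C}^n$ and let $q$ be an inhomogeneous complex valued quadratic polynomial on $\mathbb{C}^n$ (a polynomial of degree at most $2$ in $x,\overline{x}$ with complex coefficients), with principal part $q_2$ (its homogeneous part of degree $2$ in $x,\overline{x}$). Assume that $$\operatorname{Re} q_2(x) < \Phi_{\mathrm{herm}}(x) := \tfrac12\big(\Phi_0(x)+\Phi_0(ix)\big),\qquad 0\neq x\in\mathbb{C}^n,$$ and that $$\det \partial_x\partial_{\overline{x}}(2\Phi_0-q_2)\neq 0.$$ Then the Toeplitz operator $\mathrm{Top}(e^q):H_{\Phi_0}(\mathbb{C}^n)\to H_{\Phi_0}(\mathbb{C}^n)$ is bounded if and only if its Weyl symbol $a\in C^\infty(\Lambda_{\Phi_0})$ satisfies $a\in L^\infty(\Lambda_{\Phi_0})$.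
   Context: A quadratic form $\Phi_0$ on $\mathbb{C}^n\cong\mathbb{R}^{2n}$ is real-valued and real quadratic; it is strictly plurisubharmonic if the Hermitian matrix $\big(\partial^2\Phi_0/\partial \overline{x}_j\partial x_k\big)_{j,k}$ is positive definite. $\partial_x\partial_{\overline{x}} g$ denotes the $n\times n$ matrix $(\partial^2 g/\partial x_j\partial\overline{x}_k)_{j,k}$. $L(dx)$ is Lebesgue measure on $\mathbb{C}^n$. The Bargmann space is $H_{\Phi_0}(\mathbb{C}^n)=L^2(\mathbb{C}^n,e^{-2\Phi_0}L(dx))\cap \mathrm{Hol}(\mathbb{C}^n)$, where $\mathrm{Hol}(\mathbb{C}^n)$ is the space of entire functions, and $\Pi_{\Phi_0}:L^2(\mathbb{C}^n,e^{-2\Phi_0}L(dx))\to H_{\Phi_0}(\mathbb{C}^n)$ is the orthogonal projection. The Toeplitz operator is $\mathrm{Top}(e^q)=\Pi_{\Phi_0}\circ e^q\circ\Pi_{\Phi_0}$, i.e. $u\mapsto \Pi_{\Phi_0}(e^q u)$, with maximal domain $\mathcal{D}(\mathrm{Top}(e^q))=\{u\in H_{\Phi_0}(\mathbb{C}^n): e^q u\in L^2(\mathbb{C}^n,e^{-2\Phi_0}L(dx))\}$, which is dense in $H_{\Phi_0}(\mathbb{C}^n)$ under the assumptions made. Bounded means that there is $C$ with $\|\mathrm{Top}(e^q)u\|\le C\|u\|$ in $H_{\Phi_0}(\mathbb{C}^n)$ for all $u$ in this domain, i.e. it extends to a bounded operator on $H_{\Phi_0}(\mathbb{C}^n)$.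 $\Lambda_{\Phi_0}=\{(x,\frac{2}{i}\frac{\partial\Phi_0}{\partial x}(x)):x\in\mathbb{C}^n\}\subset\mathbb{C}^{2n}$. The Weyl symbol $a\in C^\infty(\Lambda_{\Phi_0})$ of $\mathrm{Top}(e^q)$ is $$a\Big(x,\tfrac{2}{i}\tfrac{\partial\Phi_0}{\partial x}(x)\Big)=\Big(\exp\big(\tfrac14(\Phi_{0,x\overline{x}}'')^{-1}\partial_x\cdot\partial_{\overline{x}}\big)e^q\Big)(x),\quad x\in\mathbb{C}^n,$$ that is, the Gaussian convolution $$a\Big(x,\tfrac{2}{i}\tfrac{\partial\Phi_0}{\partial x}(x)\Big)=C_{\Phi_0}\int_{\mathbb{C}^n}e^{-4\Phi_{\mathrm{herm}}(x-y)+q(y)}\,L(dy),\qquad C_{\Phi_0}^{-1}=\int_{\mathbb{C}^n}e^{-4\Phi_{\mathrm{herm}}(y)}\,L(dy),$$ which converges under the assumption $\operatorname{Re} q_2<\Phi_{\mathrm{herm}}$ away from $0$. *)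

(* Defs.v *)
From HB Require Import structures.
From mathcomp Require Import all_boot all_order all_algebra.
From mathcomp Require Import complex spectral sesquilinear.
From mathcomp Require Import all_classical all_reals all_analysis.

Set Implicit Arguments.
Unset Strict Implicit.
Unset Printing Implicit Defensive.

Import Order.TTheory GRing.Theory Num.Theory.
Import numFieldNormedType.Exports.
Import ComplexField.Normc.

Local Open Scope classical_set_scope.
Local Open Scope ring_scope.
Local Open Scope complex_scope.
Local Open Scope sesquilinear_scope.

Notation ReC := complex.Re.
Notation ImC := complex.Im.

Section lebesgue.
Variable R : realType.

Definition tcons m (p : m.-tuple R * R) : m.+1.-tuple R :=
  [tuple of p.2 :: p.1].

Lemma measurable_tcons m : measurable_fun [set: m.-tuple R * R] (@tcons m).
Proof. exact: (measurable_cons measurable_snd measurable_fst). Qed.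

(* The product of m copies of the Lebesgue measure of R. The explicit instance
   is the library's measure structure on [pushforward], which takes the
   measurability proof as an argument. *)
Fixpoint lebesgueRm (m : nat) : {measure set (m.-tuple R) -> \bar R} :=
  if m isn't k.+1 then dirac [tuple]
  else measure_function_pushforward__canonical__measure_function_Measure
         (lebesgueRm k \x (@lebesgue_measure R))%E (@measurable_tcons k).

(* R^2n identified with C^n by (a, b) |-> a + i b; all measure theory on C^n is
   carried by R^2n through this bijection. *)
Definition cvec n (t : (n + n).-tuple R) : 'cV[R[i]]_n :=
  \col_j (tnth t (lshift n j) +i* tnth t (rshift n j)).

Definition measurable_cplx n (f : 'cV[R[i]]_n -> R[i]) : Prop :=
  measurable_fun [set: (n + n).-tuple R] (fun t => ReC (f (cvec t))) /\
  measurable_fun [set: (n + n).-tuple R] (fun t => ImC (f (cvec t))).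

Definition integralR n (f : 'cV[R[i]]_n -> R) : R :=
  Rintegral (lebesgueRm (n + n)) setT (fun t => f (cvec t)).

Definition integralC n (f : 'cV[R[i]]_n -> R[i]) : R[i] :=
  integralR (fun x => ReC (f x)) +i* integralR (fun x => ImC (f x)).

End lebesgue.

Section wirtinger.
Variables (R : realType) (n : nat).
Local Notation C := R[i].
Implicit Types (f g : 'cV[C]_n -> C) (x v : 'cV[C]_n) (j k : 'I_n).

(* derivative of f at x along v, with respect to a real parameter *)
Definition Dreal v f x : C :=
  derive1 (fun t : R => ReC (f (x + t%:C *: v))) 0
  +i* derive1 (fun t : R => ImC (f (x + t%:C *: v))) 0.

Definition evec j : 'cV[C]_n := delta_mx j 0.

Definition dz j f x : C :=
  (Dreal (evec j) f x - 'i%C * Dreal ('i%C *: evec j) f x) / 2.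

Definition dzbar j f x : C :=
  (Dreal (evec j) f x + 'i%C * Dreal ('i%C *: evec j) f x) / 2.

Definition dz_dzbar g x : 'M[C]_n := \matrix_(j, k) dz j (dzbar k g) x.

(* Frechet differentiability over the field C *)
Definition entire (u : 'cV[C]_n -> C) : Prop :=
  forall x : ('cV[C]_n : normedModType C), differentiable (u : _ -> C^o) x.

End wirtinger.

Section quadratic.
Variables (R : realType) (n : nat).
Local Notation C := R[i].
Implicit Types (Phi : 'cV[C]_n -> R) (x : 'cV[C]_n).

Definition reim x : 'cV[R]_(n + n) :=
  col_mx (map_mx (fun z => ReC z) x) (map_mx (fun z => ImC z) x).

Definition real_quadratic_form Phi : Prop :=
  exists S : 'M[R]_(n + n), forall x, Phi x = ((reim x)^T *m S *m reim x) 0 0.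

Definition liftC Phi : 'cV[C]_n -> C := fun x => (Phi x)%:C.

Definition posdefmx (A : 'M[C]_n) : Prop :=
  A = A ^t* /\ forall v : 'cV[C]_n, v != 0 -> 0 < (v ^t* *m A *m v) 0 0.

Definition strictly_psh Phi : Prop :=
  forall x, posdefmx (\matrix_(j, k) dzbar j (dz k (liftC Phi)) x).

Definition Phi_herm Phi x : R := (Phi x + Phi ('i%C *: x)) / 2.

(* A polynomial of degree at most 2 in (x, conj x), by its coefficients; the
   quadratic ones need not be symmetric. *)
Record quad_poly := QuadPoly {
  coef2 : 'M[C]_(n + n);
  coef1 : 'rV[C]_(n + n);
  coef0 : C }.

Definition xxbar x : 'cV[C]_(n + n) := col_mx x (map_mx conjc x).

Definition principal (q : quad_poly) x : C :=
  ((xxbar x)^T *m coef2 q *m xxbar x) 0 0.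

Definition qeval (q : quad_poly) x : C :=
  principal q x + (coef1 q *m xxbar x) 0 0 + coef0 q.

End quadratic.

Definition expC (R : realType) (z : R[i]) : R[i] :=
  (expR (ReC z))%:C * (cos (ImC z) +i* sin (ImC z)).

Section bargmann.
Variables (R : realType) (n : nat).
Local Notation C := R[i].
Variable Phi : 'cV[C]_n -> R.
Implicit Types u v : 'cV[C]_n -> C.

Definition weight (x : 'cV[C]_n) : R := expR (- 2 * Phi x).

Definition L2Phi : set ('cV[C]_n -> C) := [set u | measurable_cplx u /\
  (\int[lebesgueRm R (n + n)]_t
     (normc (u (cvec t)) ^+ 2 * weight (cvec t))%:E < +oo)%E].

Definition dotPhi u v : C :=
  integralC (fun x => u x * (v x)^* * (weight x)%:C).

Definition normPhi u : R :=
  Num.sqrt (integralR (fun x => normc (u x) ^+ 2 * weight x)).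

Definition HPhi : set ('cV[C]_n -> C) := [set u | L2Phi u /\ entire u].

(* Orthogonal projection of L2Phi onto HPhi. Functions stand for their classes
   modulo null sets; an entire representative is unique by continuity. *)
Definition PiPhi (f : 'cV[C]_n -> C) : 'cV[C]_n -> C :=
  xget (fun=> 0)
    [set g | HPhi g /\ forall h, HPhi h -> dotPhi (fun x => f x - g x) h = 0].

Variable q : quad_poly R n.

Definition expq_mul u : 'cV[C]_n -> C := fun x => expC (qeval q x) * u x.

Definition Top_dom : set ('cV[C]_n -> C) :=
  [set u | HPhi u /\ L2Phi (expq_mul u)].

Definition Top u : 'cV[C]_n -> C := PiPhi (expq_mul u).

Definition Top_bounded : Prop :=
  exists M : R, forall u, Top_dom u -> normPhi (Top u) <= M * normPhi u.

Definition Lambda_pt (x : 'cV[C]_n) : 'cV[C]_n * 'cV[C]_n :=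
  (x, (2 / 'i%C) *: \col_j dz j (liftC Phi) x).

Definition Lambda : set ('cV[C]_n * 'cV[C]_n) := range Lambda_pt.

Definition Lambda_param (x : 'cV[C]_n) : Lambda :=
  SigSub (mem_set (imageT Lambda_pt x)).

Definition weyl_symbol (p : Lambda) : C :=
  let x := (val p).1 in
  (integralR (fun y => expR (- 4 * Phi_herm Phi y)))^-1%:C *
  integralC (fun y => expC ((- 4 * Phi_herm Phi (x - y))%:C + qeval q y)).

(* Lambda carries the Lebesgue measure of C^n through Lambda_param. *)
Definition Linfty_Lambda (a : Lambda -> C) : Prop :=
  measurable_cplx (a \o Lambda_param) /\
  finite_norm (lebesgueRm R (n + n)) +oo%E
    (fun t => normc (a (Lambda_param (cvec t)))).

End bargmann.

(* Main.v *)
Require Import Defs.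
From HB Require Import structures.
From mathcomp Require Import all_boot all_order all_algebra.
From mathcomp Require Import complex.
From mathcomp Require Import all_classical all_reals all_analysis.
From mathcomp Require Import measurable_realfun ess_sup_inf.
From mathcomp Require Import ring lra.
Set Implicit Arguments.
Unset Strict Implicit.
Unset Printing Implicit Defensive.
Import Order.TTheory GRing.Theory Num.Theory.
Import numFieldNormedType.Exports.
Import ComplexField.Normc.
Local Open Scope classical_set_scope.
Local Open Scope ring_scope.
Local Open Scope complex_scope.

                                 

(** Write $\Phi_0(x)=h(x)+\operatorname{Re}G(x,x)$ with $h=\Phi_{herm}$ the form of a positive
    Hermitian matrix $H$ and $G$ complex bilinear ([hermitian_part]). Multiplication by
    $e^{-G(x,x)}$ ([twist]) is an isometry of the weighted spaces, preserves holomorphy and commutes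
    with $e^q$, so $\Phi_0$ may be replaced by $h$. In the space with weight $e^{-2h}$ the functions
    $k_z(y)=e^{2\langle z,y\rangle}$ ([kz]) reproduce entire functions: $\langle
    f,k_z\rangle=c\,f(z)$ with $c=\int e^{-2h}$ ([reproducing_l2]). Put $K(w,z)=\langle
    e^qk_z,k_w\rangle$ ([Kc]). Both sides of the theorem are shown equivalent to the bound
    $|K(w,z)|\le D\,e^{h(w)+h(z)}$ ([kernel_bounded]).

    Operator and kernel. The projection of $e^qk_z$ is $K(\cdot,z)/c$ ([galt]), and
    $\|k_z\|^2=c\,e^{2h(z)}$, so a bounded operator gives the kernel bound by Cauchy-Schwarz
    ([kernel_of_Top_bounded]). Conversely $c^2(\mathrm{Top}f)(w)=\int f(z)K(w,z)e^{-2h(z)}$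
    ([projection_formula]). Here $K$ is a constant times the exponential of a quadratic polynomial,
    and the kernel bound says that $\log|K(w,z)|-h(w)-h(z)$ is bounded above, hence concave. The
    determinant condition makes it strictly concave in $w$ for fixed $z$ and in $z$ for fixed $w$.
    The weighted kernel is thus dominated by Gaussians of a fixed shape ([schur_bound]), and Schur's
    test applies ([schur_test], [Top_bounded_of_kernel]).

    Kernel and symbol. View $\mathbb C^n$ as $\mathbb R^{2n}$ and let $B$ be the real form $2h$. The
    pair $(w,\bar z)$ becomes a point $p$ of the complexification $\mathbb C^{2n}$, real when $w=z$;
    then $K$ becomes the Gaussian integral [Kf] and the symbol $a$ a multiple of [af]. The identity
    $2B(t-s)+2B(s-p)=4B(s-\frac{t+p}2)+B(t-p)$ exhibits $K$ as an integral transform of $a$ whose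
    kernel has modulus $e^{-2B(s-\operatorname{Re}p)}e^{h(w)+h(z)}$, so a bounded symbol gives the
    kernel bound ([weyl_transform], [kernel_bound_of_weyl]). Conversely, let $\xi(x)$ be the
    critical point of the exponent integrated in $a(x)$. At $p=2x-\xi(x)$ the exponent integrated in
    $K$ has the same critical point. Inserting this $p$ into the kernel bound and its polarised form
    shows that the real part of the exponent of $a$ has nonpositive quadratic part, and linear part
    zero on the null directions of the latter; hence $a$ is bounded ([weyl_bounded_of_kernel]).

    Two tools rest on Cauchy's theorem for rectangles, proved by Goursat's bisection: the mean value
    property, which yields the reproducing formula, and the invariance of Gaussian integrals under
    complex shifts ([gauss_shift]), which yields every explicit formula for [Kf] and [af]. *)

(** * Complex numbers through real and imaginary parts *)

Section complex_facts.
Variable R : realType.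
Local Notation C := R[i].
Implicit Types z w : C.

Lemma normcE z : normc z = Num.sqrt (ReC z ^+ 2 + ImC z ^+ 2).
Proof. by case: z. Qed.

Lemma sqr_normc z : normc z ^+ 2 = ReC z ^+ 2 + ImC z ^+ 2.
Proof. by rewrite normcE sqr_sqrtr // addr_ge0 ?sqr_ge0. Qed.

Lemma normc_ge0 z : 0 <= normc z.
Proof. by rewrite normcE sqrtr_ge0. Qed.

Lemma ReD z w : ReC (z + w) = ReC z + ReC w.
Proof. by case: z; case: w. Qed.

Lemma ImD z w : ImC (z + w) = ImC z + ImC w.
Proof. by case: z; case: w. Qed.

Lemma ReN z : ReC (- z) = - ReC z.
Proof. by case: z. Qed.

Lemma ImN z : ImC (- z) = - ImC z.
Proof. by case: z. Qed.

Lemma ReB z w : ReC (z - w) = ReC z - ReC w.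
Proof. by rewrite ReD ReN. Qed.

Lemma ImB z w : ImC (z - w) = ImC z - ImC w.
Proof. by rewrite ImD ImN. Qed.

Lemma ReM z w : ReC (z * w) = ReC z * ReC w - ImC z * ImC w.
Proof. by case: z => a b; case: w. Qed.

Lemma ImM z w : ImC (z * w) = ReC z * ImC w + ImC z * ReC w.
Proof. by case: z => a b; case: w => c d. Qed.

Lemma ReJ z : ReC (z^*)%C = ReC z. Proof. by case: z. Qed.

Lemma ImJ z : ImC (z^*)%C = - ImC z. Proof. by case: z. Qed.

Lemma complexP z w : ReC z = ReC w -> ImC z = ImC w -> z = w.
Proof. by case: z => a b; case: w => c d /= -> ->. Qed.

Lemma normcJ z : normc (z^*)%C = normc z.
Proof. by rewrite !normcE ReJ ImJ sqrrN. Qed.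

Lemma normcR (x : R) : normc x%:C = `|x|.
Proof. by rewrite normcE /= expr0n /= addr0 sqrtr_sqr. Qed.

Lemma normc_Re z : `|ReC z| <= normc z.
Proof. by rewrite normcE -sqrtr_sqr ler_wsqrtr // lerDl sqr_ge0. Qed.

Lemma normc_Im z : `|ImC z| <= normc z.
Proof. by rewrite normcE -sqrtr_sqr ler_wsqrtr // lerDr sqr_ge0. Qed.

Lemma normc_ReIm z : normc z <= `|ReC z| + `|ImC z|.
Proof.
rewrite -(@ler_pXn2r _ 2) ?nnegrE ?normc_ge0 ?addr_ge0 //.
rewrite sqr_normc sqrrD !real_normK ?num_real //.
by rewrite addrAC lerDl mulrn_wge0 // mulr_ge0.
Qed.

Lemma mulcJ z : z * (z^*)%C = (normc z ^+ 2)%:C.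
Proof.
rewrite sqr_normc; case: z => a b; apply: complexP => /=; first by ring.
by ring.
Qed.

Lemma ReMR (a : R) z : ReC (a%:C * z) = a * ReC z.
Proof. by rewrite ReM /= mul0r subr0. Qed.

Lemma ImMR (a : R) z : ImC (a%:C * z) = a * ImC z.
Proof. by rewrite ImM /= mul0r addr0. Qed.

Lemma ReMC (a : R) z : ReC (z * a%:C) = ReC z * a.
Proof. by rewrite mulrC ReMR mulrC. Qed.

Lemma expCD z w : expC (z + w) = expC z * expC w.
Proof.
rewrite /expC ReD ImD expRD cosD sinD.
by apply: complexP; rewrite !(ReMR,ImMR,ReM,ImM) /=; ring.
Qed.

Lemma expC0 : expC (0 : C) = 1.
Proof. by rewrite /expC /= expR0 cos0 sin0 mul1r. Qed.

Lemma normc_expC z : normc (expC z) = expR (ReC z).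
Proof.
rewrite /expC normcM normcR ger0_norm ?expR_ge0 //.
by rewrite normcE /= cos2Dsin2 sqrtr1 mulr1.
Qed.

Lemma expC_neq0 z : expC z != 0.
Proof.
apply/eqP => h; have := normc_expC z; rewrite h normc0 => /esym/eqP.
by rewrite gt_eqF ?expR_gt0.
Qed.

Lemma expCJ z : (expC z)^*%C = expC z^*%C.
Proof.
by apply: complexP; rewrite /expC ?ReJ ?ImJ !(ReMR,ImMR) /= ?ReJ ?ImJ ?cosN ?sinN ?mulrN.
Qed.

Lemma expC_real (x : R) : expC x%:C = (expR x)%:C.
Proof. by rewrite /expC /= cos0 sin0 mulr1. Qed.

End complex_facts.

(** * Measurability, integration and Fubini's theorem for complex-valued functions *)

Section complex_integral.
Context d (T : measurableType d) (R : realType).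
Local Notation C := R[i].
Implicit Types (f g : T -> C) (h : T -> R).

Definition cmeas f := measurable_fun setT (fun x => ReC (f x)) /\
  measurable_fun setT (fun x => ImC (f x)).

Lemma cmeas_cst (c : C) : cmeas (fun=> c).
Proof. by split; exact: measurable_cst. Qed.

Lemma cmeasR h : measurable_fun setT h -> cmeas (fun x => (h x)%:C).
Proof. by move=> mh; split => //=; exact: measurable_cst. Qed.

Lemma cmeasD f g : cmeas f -> cmeas g -> cmeas (fun x => f x + g x).
Proof.
move=> [f1 f2] [g1 g2]; split.
  by under eq_fun do rewrite ReD; exact: measurable_funD.
by under eq_fun do rewrite ImD; exact: measurable_funD.
Qed.

Lemma cmeasM f g : cmeas f -> cmeas g -> cmeas (fun x => f x * g x).
Proof.
move=> [f1 f2] [g1 g2]; split.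
  by under eq_fun do rewrite ReM; apply: measurable_funB; exact: measurable_funM.
by under eq_fun do rewrite ImM; apply: measurable_funD; exact: measurable_funM.
Qed.

Lemma cmeasN f : cmeas f -> cmeas (fun x => - f x).
Proof.
move=> mf; have -> : (fun x => - f x) = (fun x => -1 * f x).
  by apply/funext => x; rewrite mulN1r.
by apply: cmeasM => //; exact: cmeas_cst.
Qed.

Lemma cmeasB f g : cmeas f -> cmeas g -> cmeas (fun x => f x - g x).
Proof. by move=> mf mg; apply: cmeasD => //; exact: cmeasN. Qed.

Lemma cmeasJ f : cmeas f -> cmeas (fun x => (f x)^*%C).
Proof.
move=> [f1 f2]; split; first by under eq_fun do rewrite ReJ.
by under eq_fun do rewrite ImJ; exact: measurable_funN.
Qed.

Lemma cmeas_sum I (s : seq I) (F : I -> T -> C) :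
  (forall i, cmeas (F i)) -> cmeas (fun x => \sum_(i <- s) F i x).
Proof.
move=> mF; elim: s => [|i s IH].
  by under eq_fun do rewrite big_nil; exact: cmeas_cst.
by under eq_fun do rewrite big_cons; apply: cmeasD.
Qed.

Lemma measurable_normc f : cmeas f -> measurable_fun setT (fun x => normc (f x)).
Proof.
move=> [f1 f2].
have -> : (fun x => normc (f x)) =
   (fun x => (fun y : R => y `^ 2^-1) (ReC (f x) ^+ 2 + ImC (f x) ^+ 2)).
  by apply/funext => x; rewrite normcE powR12_sqrt // addr_ge0 ?sqr_ge0.
apply: (measurableT_comp (measurable_powR _)).
by apply: measurable_funD; exact: measurable_funX.
Qed.

Lemma cmeas_expC f : cmeas f -> cmeas (fun x => expC (f x)).
Proof.
move=> [f1 f2]; apply: cmeasM.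
  by apply: cmeasR; exact: (measurableT_comp (@measurable_expR R)).
split => /=.
  apply: (measurableT_comp _ f2); apply: continuous_measurable_fun.
  exact: continuous_cos.
apply: (measurableT_comp _ f2); apply: continuous_measurable_fun.
exact: continuous_sin.
Qed.

End complex_integral.

Lemma cmeas_comp d1 d2 (T1 : measurableType d1) (T2 : measurableType d2)
    (R : realType) (f : T2 -> R[i]) (g : T1 -> T2) :
  cmeas f -> measurable_fun setT g -> cmeas (fun x => f (g x)).
Proof.
by move=> [f1 f2] mg; split;
  [exact: (measurableT_comp f1 mg)|exact: (measurableT_comp f2 mg)].
Qed.

Section complex_integral_theory.
Context d (T : measurableType d) (R : realType) (mu : {measure set T -> \bar R}).
Local Notation C := R[i].
Implicit Types (f g : T -> C) (h : T -> R).

Definition cintg f := cmeas f /\ (\int[mu]_x (normc (f x))%:E < +oo)%E.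

Definition cint f : C := \int[mu]_x ReC (f x) +i* \int[mu]_x ImC (f x).

Lemma ge0_integrableP h : (forall x, 0 <= h x) ->
  mu.-integrable setT (fun x => (h x)%:E) <->
  measurable_fun setT h /\ (\int[mu]_x (h x)%:E < +oo)%E.
Proof.
move=> h0; split.
  move=> /integrableP[/measurable_EFinP mh]; split => //.
  suff <- : (\int[mu]_x `|(h x)%:E| = \int[mu]_x (h x)%:E)%E by [].
  by apply: eq_integral => x _; rewrite gee0_abs ?lee_fin.
move=> [mh hh]; apply/integrableP; split; first exact/measurable_EFinP.
suff -> : (\int[mu]_x `|(h x)%:E| = \int[mu]_x (h x)%:E)%E by [].
by apply: eq_integral => x _; rewrite gee0_abs ?lee_fin.
Qed.

Lemma cintg_norm f : cintg f -> mu.-integrable setT (fun x => (normc (f x))%:E).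
Proof.
move=> [mf ff]; apply/ge0_integrableP; first by move=> x; exact: normc_ge0.
by split => //; exact: measurable_normc.
Qed.

Lemma cintg_le f h : cmeas f -> (forall x, normc (f x) <= h x) ->
  mu.-integrable setT (fun x => (h x)%:E) -> cintg f.
Proof.
move=> mf fh ih; split => //.
have h0 x : 0 <= h x by exact: le_trans (normc_ge0 _) (fh x).
have [mh hh] := (ge0_integrableP h0).1 ih.
apply: le_lt_trans hh; apply: ge0_le_integral => //.
- by move=> x _; rewrite lee_fin normc_ge0.
- by apply/measurable_EFinP; exact: measurable_normc.
- exact/measurable_EFinP.
- by move=> x _; rewrite lee_fin.
Qed.

Lemma cintg_Re f : cintg f -> mu.-integrable setT (EFin \o (fun x => ReC (f x))).
Proof.
move=> ff; have [[f1 f2] _] := ff.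
apply: le_integrable (cintg_norm ff) => //; first exact/measurable_EFinP.
by move=> x _ /=; rewrite lee_fin [leRHS]ger0_norm ?normc_ge0 // normc_Re.
Qed.

Lemma cintg_Im f : cintg f -> mu.-integrable setT (EFin \o (fun x => ImC (f x))).
Proof.
move=> ff; have [[f1 f2] _] := ff.
apply: le_integrable (cintg_norm ff) => //; first exact/measurable_EFinP.
by move=> x _ /=; rewrite lee_fin [leRHS]ger0_norm ?normc_ge0 // normc_Im.
Qed.

Lemma cintgM (c : C) f : cintg f -> cintg (fun x => c * f x).
Proof.
move=> ff; apply: (@cintg_le _ (fun x => normc c * normc (f x))).
- by apply: cmeasM; [exact: cmeas_cst|exact: ff.1].
- by move=> x; rewrite normcM.
- have := integrableZl measurableT (normc c) (cintg_norm ff).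
  by apply: eq_integrable.
Qed.

Lemma cintgMr (c : C) f : cintg f -> cintg (fun x => f x * c).
Proof. by move=> /(cintgM c); under eq_fun do rewrite mulrC. Qed.

Lemma cintgD f g : cintg f -> cintg g -> cintg (fun x => f x + g x).
Proof.
move=> ff gg; apply: (@cintg_le _ (fun x => normc (f x) + normc (g x))).
- by apply: cmeasD; [exact: ff.1|exact: gg.1].
- by move=> x; exact: le_normcD.
- have := integrableD measurableT (cintg_norm ff) (cintg_norm gg).
  by apply: eq_integrable.
Qed.

Lemma cintgN f : cintg f -> cintg (fun x => - f x).
Proof. by move=> /(cintgM (-1)); under eq_fun do rewrite mulN1r. Qed.

Lemma cintgB f g : cintg f -> cintg g -> cintg (fun x => f x - g x).
Proof. by move=> ff gg; apply: cintgD => //; exact: cintgN. Qed.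

Lemma cintgJ f : cintg f -> cintg (fun x => (f x)^*%C).
Proof.
move=> ff; split; first exact: (cmeasJ ff.1).
by under eq_integral do rewrite normcJ; exact: ff.2.
Qed.

Lemma cintD f g : cintg f -> cintg g ->
  cint (fun x => f x + g x) = cint f + cint g.
Proof.
move=> ff gg; apply: complexP; rewrite ?ReD ?ImD /cint /=.
  under eq_Rintegral do rewrite ReD.
  by rewrite RintegralD //; exact: cintg_Re.
under eq_Rintegral do rewrite ImD.
by rewrite RintegralD //; exact: cintg_Im.
Qed.

Lemma cintZ (c : C) f : cintg f -> cint (fun x => c * f x) = c * cint f.
Proof.
move=> ff; have iR := cintg_Re ff; have iI := cintg_Im ff.
apply: complexP; rewrite ?ReM ?ImM /cint /=.
  under eq_Rintegral do rewrite ReM.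
  rewrite RintegralB //; first by rewrite !RintegralZl.
    by have := integrableZl measurableT (ReC c) iR; apply: eq_integrable.
  by have := integrableZl measurableT (ImC c) iI; apply: eq_integrable.
under eq_Rintegral do rewrite ImM.
rewrite RintegralD //; first by rewrite !RintegralZl.
  by have := integrableZl measurableT (ReC c) iI; apply: eq_integrable.
by have := integrableZl measurableT (ImC c) iR; apply: eq_integrable.
Qed.

Lemma cintZr (c : C) f : cintg f -> cint (fun x => f x * c) = cint f * c.
Proof.
move=> ff; rewrite mulrC -cintZ //; congr cint.
by apply/funext => x; rewrite mulrC.
Qed.

Lemma cintB f g : cintg f -> cintg g ->
  cint (fun x => f x - g x) = cint f - cint g.
Proof.
move=> ff gg; rewrite cintD //; last exact: cintgN.
congr (_ + _); rewrite -mulN1r -cintZ //; congr cint.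
by apply/funext => x; rewrite mulN1r.
Qed.

Lemma cintJ f : cintg f -> cint (fun x => (f x)^*%C) = (cint f)^*%C.
Proof.
move=> ff; apply: complexP; rewrite ?ReJ ?ImJ /cint /=.
  by apply: eq_Rintegral => x _; rewrite ReJ.
rewrite -[RHS]mulN1r -RintegralZl //; last exact: cintg_Im.
by apply: eq_Rintegral => x _; rewrite ImJ mulN1r.
Qed.

Lemma cintR h : cint (fun x => (h x)%:C) = (\int[mu]_x h x)%:C.
Proof.
apply: complexP => //=; rewrite /Rintegral.
by under eq_integral do rewrite /=; rewrite integral0.
Qed.

(** Rotate by the phase of the integral: with $w=\int f$, $|w|^2=\int\operatorname{Re}(\bar w
    f)\le|w|\int|f|$. *)
Lemma le_normc_cint f : cintg f -> normc (cint f) <= \int[mu]_x normc (f x).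
Proof.
move=> ff; have h0 : 0 <= \int[mu]_x normc (f x).
  by apply: Rintegral_ge0 => x _; exact: normc_ge0.
have [w0|w0] := eqVneq (normc (cint f)) 0; first by rewrite w0.
have wp : 0 < normc (cint f) by rewrite lt_def w0 normc_ge0.
rewrite -(ler_pM2l wp) -expr2.
have -> : normc (cint f) ^+ 2 = \int[mu]_x ReC ((cint f)^*%C * f x).
  have := cintZ ((cint f)^*%C) ff.
  by rewrite [X in _ = X]mulrC mulcJ => /(congr1 (@ReC R)) /= <-.
rewrite -RintegralZl //; last exact: cintg_norm.
apply: le_Rintegral => //.
- exact: cintg_Re (cintgM _ ff).
- have := integrableZl measurableT (normc (cint f)) (cintg_norm ff).
  by apply: eq_integrable.
- move=> x _; apply: le_trans (ler_norm _) _; apply: le_trans (normc_Re _) _.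
  by rewrite normcM normcJ.
Qed.

Lemma EFin_Rintegral h : (forall x, 0 <= h x) -> (\int[mu]_x (h x)%:E < +oo)%E ->
  (\int[mu]_x h x)%:E = (\int[mu]_x (h x)%:E)%E.
Proof.
move=> h0 hh; rewrite /Rintegral fineK // ge0_fin_numE //.
by apply: integral_ge0 => x _; rewrite lee_fin.
Qed.

Lemma le_normc_cintE f : cintg f ->
  ((normc (cint f))%:E <= \int[mu]_x (normc (f x))%:E)%E.
Proof.
move=> ff; rewrite -EFin_Rintegral ?lee_fin ?le_normc_cint //.
  by move=> x; exact: normc_ge0.
exact: ff.2.
Qed.

End complex_integral_theory.

Section fubini_complex.
Context d1 d2 (T1 : measurableType d1) (T2 : measurableType d2) (R : realType).
Variables (m1 : {sigma_finite_measure set T1 -> \bar R})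
          (m2 : {sigma_finite_measure set T2 -> \bar R}).

(** The real-valued inner integral passes through [fine], so it matches the extended-valued section
    integral only where the latter is finite; integrability of the double integral makes this almost
    everywhere. *)
Lemma Rintegral_iterated (f : T1 * T2 -> R) :
  (m1 \x m2)%E.-integrable setT (EFin \o f) ->
  m1.-integrable setT (fun x => (\int[m2]_y f (x, y))%:E) /\
  \int[m1]_x (\int[m2]_y f (x, y)) = fine (\int[m1]_x \int[m2]_y (f (x, y))%:E)%E.
Proof.
move=> fi; have iF := integrable_fubini_F fi.
have ae : ae_eq m1 setT (fun x => (\int[m2]_y f (x, y))%:E)
    (fubini_F m2 (EFin \o f)).
  have := integrable_ae measurableT iF; apply: filterS => x /(_ I) Fx _.
  by rewrite /Rintegral fineK.
have mF : measurable_fun setT (fun x => (\int[m2]_y f (x, y))%:E).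
  apply/measurable_EFinP; apply: (measurableT_comp _ (measurable_int _ iF)).
  exact: fine_measurable.
split; last first.
  rewrite [LHS]/Rintegral; congr fine.
  by apply: ae_eq_integral => //; exact: measurable_int iF.
apply/integrableP; split => //.
have /integrableP[mF' /le_lt_trans] := iF; apply.
rewrite le_eqVlt; apply/orP; left; apply/eqP.
apply: ae_eq_integral => //; [exact: measurableT_comp|exact: measurableT_comp|].
by move: ae; apply: filterS => x h hx; rewrite h.
Qed.

End fubini_complex.

Section fubini_complex.
Context d1 d2 (T1 : measurableType d1) (T2 : measurableType d2) (R : realType).
Variables (m1 : {sigma_finite_measure set T1 -> \bar R})
          (m2 : {sigma_finite_measure set T2 -> \bar R}).

Lemma Rintegral_fubini (f : T1 * T2 -> R) :
  (m1 \x m2)%E.-integrable setT (EFin \o f) ->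
  \int[m1]_x (\int[m2]_y f (x, y)) = \int[m2]_y (\int[m1]_x f (x, y)).
Proof.
move=> fi; rewrite (Rintegral_iterated fi).2 (Fubini fi).
have mf : measurable_fun setT (EFin \o f) by exact: measurable_int fi.
have fi' : (m2 \x m1)%E.-integrable setT (EFin \o (f \o unstable.swap)).
  have ms := @measurable_swap _ _ T2 T1.
  apply/integrable12ltyP; first exact: (measurableT_comp mf ms).
  exact: (integrable21ltyP m1 m2 mf).1.
by rewrite (Rintegral_iterated fi').2.
Qed.

Lemma cintg_prod (f : T1 * T2 -> R[i]) : cmeas f ->
  (\int[m1]_x \int[m2]_y (normc (f (x, y)))%:E < +oo)%E ->
  cintg (m1 \x m2)%E f.
Proof.
move=> mf fi; split => //; rewrite fubini_tonelli1 //.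
  by apply/measurable_EFinP; exact: measurable_normc.
by move=> x; rewrite lee_fin normc_ge0.
Qed.

Lemma cfubini (f : T1 * T2 -> R[i]) : cmeas f ->
  (\int[m1]_x \int[m2]_y (normc (f (x, y)))%:E < +oo)%E ->
  cint m1 (fun x => cint m2 (fun y => f (x, y))) =
  cint m2 (fun y => cint m1 (fun x => f (x, y))).
Proof.
move=> mf fi; have cf := cintg_prod mf fi.
apply: complexP; rewrite /cint /=.
  exact: Rintegral_fubini (cintg_Re cf).
exact: Rintegral_fubini (cintg_Im cf).
Qed.

Lemma cintg_iterated (f : T1 * T2 -> R[i]) : cmeas f ->
  (\int[m1]_x \int[m2]_y (normc (f (x, y)))%:E < +oo)%E ->
  cintg m1 (fun x => cint m2 (fun y => f (x, y))).
Proof.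
move=> mf fi; have cf := cintg_prod mf fi.
have iR := (Rintegral_iterated (cintg_Re cf)).1.
have iI := (Rintegral_iterated (cintg_Im cf)).1.
apply: (@cintg_le _ _ _ _ _ (fun x => `|\int[m2]_y ReC (f (x, y))| +
   `|\int[m2]_y ImC (f (x, y))|)).
- split; [apply/measurable_EFinP; exact: measurable_int iR|].
  by apply/measurable_EFinP; exact: measurable_int iI.
- by move=> x; exact: normc_ReIm.
- have := integrableD measurableT (integrable_abse iR) (integrable_abse iI).
  by apply: eq_integrable.
Qed.

End fubini_complex.

                                                       

(** * Translations, shears and rotations preserve Lebesgue measure on tuples *)

Section measure_preserving.
Context d (T : measurableType d) (R : realType) (mu : {measure set T -> \bar R}).

(** Invariance is tested on nonnegative extended-valued functions, where integrability is not at
    stake; the signed and complex cases follow by positive and negative parts. *)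
Definition preserves (phi : T -> T) := measurable_fun setT phi /\
  forall f : T -> \bar R, measurable_fun setT f -> (forall x, 0 <= f x)%E ->
    (\int[mu]_x f (phi x) = \int[mu]_x f x)%E.

Lemma preserves_comp phi psi : preserves phi -> preserves psi ->
  preserves (fun x => phi (psi x)).
Proof.
move=> [mp ip] [mq iq]; split; first exact: (measurableT_comp mp mq).
move=> f mf f0; rewrite (iq (fun x => f (phi x))) ?ip //.
exact: (measurableT_comp mf mp).
Qed.

Lemma preserves_Rintegral phi (f : T -> R) : preserves phi ->
  measurable_fun setT f -> \int[mu]_x f (phi x) = \int[mu]_x f x.
Proof.
move=> [mp ip] mf; rewrite /Rintegral; congr fine.
rewrite [LHS]integralE [RHS]integralE.
have mf' : measurable_fun setT (EFin \o f) by exact/measurable_EFinP.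
congr (_ - _)%E.
  rewrite -[RHS](ip _ (measurable_funepos mf') (fun x => funepos_ge0 _ x)).
  by apply: eq_integral => x _; rewrite !funeposE.
rewrite -[RHS](ip _ (measurable_funeneg mf') (fun x => funeneg_ge0 _ x)).
by apply: eq_integral => x _; rewrite !funenegE.
Qed.

Lemma preserves_cint phi (f : T -> R[i]) : preserves phi -> cmeas f ->
  cint mu (fun x => f (phi x)) = cint mu f.
Proof.
move=> pp [f1 f2]; apply: complexP; rewrite /cint /=.
  exact: (preserves_Rintegral pp f1).
exact: (preserves_Rintegral pp f2).
Qed.

Lemma preserves_cintg phi (f : T -> R[i]) : preserves phi -> cintg mu f ->
  cintg mu (fun x => f (phi x)).
Proof.
move=> [mp ip] [mf fi]; split; first exact: cmeas_comp.
rewrite (ip (fun x => (normc (f x))%:E)) //.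
  by apply/measurable_EFinP; exact: measurable_normc.
by move=> x; rewrite lee_fin normc_ge0.
Qed.

End measure_preserving.

Section lebesgue_translation.
Variable R : realType.

(** The pushforward by the translation agrees with Lebesgue measure on half-open intervals, and
    uniqueness of that measure concludes. *)
Lemma lebesgue_shift (a : R) (f : R -> \bar R) : measurable_fun setT f ->
  (forall x, 0 <= f x)%E ->
  (\int[@lebesgue_measure R]_x f (x + a)%R = \int[@lebesgue_measure R]_x f x)%E.
Proof.
move=> mf f0.
have ms : measurable_fun [set: measurableTypeR R]
    (fun x => x + a : measurableTypeR R).
  by apply: measurable_funD => //; exact: measurable_cst.
transitivity (\int[pushforward (@lebesgue_measure R) (fun x => (x + a)%R : measurableTypeR R)]_x f x)%E.
  by rewrite ge0_integral_pushforward.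
apply: eq_measure_integral => A mA _; apply/esym.
pose nu := measure_function_pushforward__canonical__measure_function_Measure
  (@lebesgue_measure R) ms.
apply: (@lebesgue_measure_unique R nu) => // _ [[x y] _ <-] /=.
rewrite /pushforward.
have -> : (fun x0 : R => x0 + a) @^-1` `]x, y]%classic = `]x - a, y - a]%classic.
  by apply/seteqP; split => z /=; rewrite !in_itv /= ltrBlDr lerBrDr.
rewrite !lebesgue_measure_itv /= !lte_fin ltrD2r; case: ifP => // _.
by rewrite -!EFinB; congr EFin; ring.
Qed.

End lebesgue_translation.

Section tuple_lebesgue.
Variable R : realType.
Implicit Types m : nat.

(** A separate name for [lebesgueRm], carrying the sigma-finite structure that Fubini's theorem asks
    for. *)
Definition leb m : set (m.-tuple R) -> \bar R := lebesgueRm R m.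

HB.instance Definition _ m := Measure.on (@leb m).

(** Cubes: those of growing side exhaust the space, and the unit cube has mass $1$, so that its
    indicator can serve as a probability density. *)
Definition tbox m (A : set R) : set (m.-tuple R) :=
  [set t | forall i, A (tnth t i)].

Lemma measurable_tbox m A : measurable A -> measurable (@tbox m A).
Proof.
move=> mA.
have -> : @tbox m A = \bigcap_(i in [set: 'I_m]) ((fun t => tnth t i) @^-1` A).
  by apply/seteqP; split => t /= h i; [move=> _; exact: h|exact: h].
apply: fin_bigcap_measurable; first exact: finite_finset.
move=> i _; rewrite -[X in measurable X]setTI.
exact: measurable_tnth.
Qed.

Lemma leb_tbox0 A : leb (@tbox 0 A) = 1%E.
Proof.
rewrite /leb /= /dirac indicE mem_set //; by case.
Qed.

Lemma leb_tboxS m A : measurable A ->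
  leb (@tbox m.+1 A) = (leb (@tbox m A) * @lebesgue_measure R A)%E.
Proof.
move=> mA; rewrite -product_measure1E //; last exact: measurable_tbox.
rewrite /leb /= /pushforward; congr ((_ \x _)%E _).
apply/seteqP; split => -[t x] /=.
  move=> h; split; last by have := h ord0; rewrite (tnth_nth 0).
  by move=> i; have := h (lift ord0 i); rewrite !(tnth_nth 0) /= /bump /=.
move=> [h hx] i; rewrite (tnth_nth 0) /=; case: i => -[|i] im //=.
by have := h (Ordinal (im : (i < m)%N)); rewrite (tnth_nth 0).
Qed.

Lemma leb_tbox_unit m : leb (@tbox m `[0, 1]%classic) = 1%E.
Proof.
elim: m => [|m IH]; first exact: leb_tbox0.
by rewrite leb_tboxS // IH mul1e lebesgue_measure_itv /= lte_fin ltr01 oppr0 adde0.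
Qed.

Lemma leb_tbox_fin m (k : nat) : (leb (@tbox m `[(- k%:R)%R, k%:R%R]%classic) < +oo)%E.
Proof.
elim: m => [|m IH]; first by rewrite leb_tbox0 ltry.
rewrite leb_tboxS // lte_mul_pinfty //.
  by rewrite ge0_fin_numE.
rewrite lebesgue_measure_itv /=; case: ifP => // _.
by rewrite -EFinB ltry.
Qed.

Lemma sigma_finite_leb m : sigma_finite setT (@leb m).
Proof.
exists (fun k : nat => @tbox m `[- k%:R, k%:R]%classic); last first.
  by move=> k; split; [exact: measurable_tbox|exact: leb_tbox_fin].
apply/esym/seteqP; split => // t _.
have [k hk] : exists k : nat, forall i, `|tnth t i| <= k%:R.
  exists (Num.truncn (\sum_(i < m) `|tnth t i|)).+1 => i.
  apply: (@le_trans _ _ (\sum_(i < m) `|tnth t i|)).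
    by rewrite (bigD1 i) //= lerDl sumr_ge0.
  by apply/ltW/truncnS_gt.
by exists k => // i /=; rewrite in_itv /= -ler_norml.
Qed.

HB.instance Definition _ m :=
  Measure_isSigmaFinite.Build _ _ _ (@leb m) (@sigma_finite_leb m).

Lemma leb0_integral (f : 0.-tuple R -> \bar R) : measurable_fun setT f ->
  (\int[@leb 0]_t f t = f [tuple])%E.
Proof. by move=> mf; rewrite [LHS]integral_dirac // diracT mul1e. Qed.

Lemma lebS_integral m (f : m.+1.-tuple R -> \bar R) : measurable_fun setT f ->
  (forall t, 0 <= f t)%E ->
  (\int[@leb m.+1]_t f t =
   \int[@leb m]_t \int[@lebesgue_measure R]_x f (tcons (t, x)))%E.
Proof.
move=> mf f0.
have mft : measurable_fun setT (f \o @tcons R m).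
  exact: (measurableT_comp mf (@measurable_tcons R m)).
pose mu : {measure set (m.-tuple R * measurableTypeR R)%type -> \bar R} :=
  (lebesgueRm R m \x (@lebesgue_measure R))%E.
have mtc : measurable_fun [set: (m.-tuple R * measurableTypeR R)%type]
    (fun p => @tcons R m p) := @measurable_tcons R m.
have := ge0_integral_pushforward mtc mu measurableT mf (fun t _ => f0 t).
rewrite preimage_setT => E; transitivity (\int[mu]_x (f \o @tcons R m) x)%E.
  exact: E.
exact: (@fubini_tonelli1 _ _ _ _ _ (@leb m) (@lebesgue_measure R)
  (f \o @tcons R m) mft (fun p => f0 _)).
Qed.

Definition tshift m (a : 'I_m -> R) (t : m.-tuple R) : m.-tuple R :=
  [tuple tnth t i + a i | i < m].

Lemma measurable_tshift m (a : 'I_m -> R) : measurable_fun setT (tshift a).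
Proof.
apply/measurable_fun_tnthP => i; rewrite /comp.
under eq_fun do rewrite tnth_mktuple.
by apply: measurable_funD; [exact: measurable_tnth|exact: measurable_cst].
Qed.

(** Induction on the dimension: one coordinate is peeled off by [lebS_integral] and translated on
    the line. *)
Lemma preserves_tshift m (a : 'I_m -> R) : preserves (@leb m) (tshift a).
Proof.
split; first exact: measurable_tshift.
elim: m a => [|m IH] a f mf f0.
  rewrite !leb0_integral //; first by rewrite [tshift _ _]tuple0.
  exact: (measurableT_comp mf (measurable_tshift _)).
rewrite (lebS_integral mf f0) (lebS_integral (measurableT_comp mf (measurable_tshift a)) (fun t => f0 _)).
pose F t := (\int[@lebesgue_measure R]_x f (tcons (t, x)))%E.
have mft : measurable_fun setT (fun p => f (@tcons R m p)).
  exact: (measurableT_comp mf (@measurable_tcons R m)).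
have mF : measurable_fun setT F.
  exact: (@measurable_fun_fubini_tonelli_F _ _ _ _ _ (@lebesgue_measure R)
    (fun p => f (@tcons R m p)) mft).
have F0 t : (0 <= F t)%E by apply: integral_ge0.
transitivity (\int[@leb m]_t F (tshift (fun i => a (lift ord0 i)) t))%E;
  last exact: IH.
apply: eq_integral => t _; rewrite /F.
rewrite -[RHS](@lebesgue_shift R (a ord0)) //; last first.
  exact: measurable_fun_pair2 mft.
apply: eq_integral => x _; congr f.
apply: eq_from_tnth => i; rewrite tnth_mktuple.
case: (unliftP ord0 i) => [j|] ->; rewrite !(tnth_nth 0) //=.
by rewrite -[nth _ (map _ _) _](tnth_nth 0 (tshift (fun i => a (lift ord0 i)) t) j) tnth_mktuple (tnth_nth 0).
Qed.

End tuple_lebesgue.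

Section shear.
Variable R : realType.
(** Data of a shear $t\mapsto t+E(s(t))$: $E$ is additive in its parameter, and $s$ is constant
    along the directions in which $E$ moves points. *)
Variables (m k : nat) (E : k.-tuple R -> 'I_m -> R) (s : m.-tuple R -> k.-tuple R).
Hypothesis mE : forall i, measurable_fun setT (fun r => E r i).
Hypothesis ms : measurable_fun setT s.
Hypothesis ED : forall r r' i, E (tshift (fun j => tnth r' j) r) i = E r i + E r' i.
Hypothesis sE : forall t r, s (tshift (E r) t) = s t.

Let measurable_shift2 (d : measure_display) (T : measurableType d)
  (f : T -> m.-tuple R) (g : T -> 'I_m -> R) : measurable_fun setT f ->
  (forall i, measurable_fun setT (fun x => g x i)) ->
  measurable_fun setT (fun x => tshift (g x) (f x)).
Proof.
move=> mf mg; apply/measurable_fun_tnthP => i; rewrite /comp.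
under eq_fun do rewrite tnth_mktuple.
apply: measurable_funD => //.
exact: (measurableT_comp (measurable_tnth i) mf).
Qed.

Let measurable_shiftk (d : measure_display) (T : measurableType d)
  (f : T -> k.-tuple R) (g : T -> 'I_k -> R) : measurable_fun setT f ->
  (forall i, measurable_fun setT (fun x => g x i)) ->
  measurable_fun setT (fun x => tshift (g x) (f x)).
Proof.
move=> mf mg; apply/measurable_fun_tnthP => i; rewrite /comp.
under eq_fun do rewrite tnth_mktuple.
apply: measurable_funD => //.
exact: (measurableT_comp (measurable_tnth i) mf).
Qed.

                                                                            
                                                                     
(** Everything is reduced to translations by an auxiliary parameter $r$ with a probability density
    $\rho$. Translating $t$ by $E(r)$ gives $\int\int\rho(r)f(t+E(r)+E(s(t)))$; replacing $r$ by
    $r-s(t)$ gives $\int\int\rho(r-s(t))f(t+E(r))$; translating $t$ back gives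
    $\int\int\rho(r-s(t))f(t)$; and $\rho$ integrates to $1$. *)
Lemma preserves_shear : preserves (@leb R m) (fun t => tshift (E (s t)) t).
Proof.
split.
  apply: measurable_shift2 => // i; exact: (measurableT_comp (mE i) ms).
move=> f mf f0.
pose rho (r : k.-tuple R) : \bar R := (\1_(@tbox R k `[0, 1]%classic) r)%:E.
have mbox : measurable (@tbox R k `[0, 1]%classic) by exact: measurable_tbox.
have mrho : measurable_fun setT rho.
  by apply/measurable_EFinP; exact: measurable_indic.
have rho0 r : (0 <= rho r)%E by rewrite lee_fin indicE.
have rho1 : (\int[@leb R k]_r rho r = 1)%E.
  by rewrite integral_indic // setIT; exact: leb_tbox_unit.
have avg (c : \bar R) : (0 <= c)%E -> (c = \int[@leb R k]_r (rho r * c))%E.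
  by move=> c0; rewrite ge0_integralZr // rho1 mul1e.
pose N t (r : k.-tuple R) := tshift (fun j => - tnth (s t) j) r.
have mfE : measurable_fun setT
    (fun p : m.-tuple R * k.-tuple R => f (tshift (E p.2) p.1)).
  apply: (measurableT_comp mf); apply: measurable_shift2 => // i.
  exact: (measurableT_comp (mE i) measurable_snd).
have mfES : measurable_fun setT
    (fun p : m.-tuple R * k.-tuple R => f (tshift (E (s p.1)) (tshift (E p.2) p.1))).
  apply: (measurableT_comp mf); apply: measurable_shift2 => [|i].
    apply: measurable_shift2 => // i.
    exact: (measurableT_comp (mE i) measurable_snd).
  exact: (measurableT_comp (mE i) (measurableT_comp ms measurable_fst)).
have mrhoN : measurable_fun setT
    (fun p : m.-tuple R * k.-tuple R => rho (N p.1 p.2)).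
  apply: (measurableT_comp mrho); apply: measurable_shiftk => // i.
  apply: measurable_funN; apply: (measurableT_comp (measurable_tnth i)).
  exact: (measurableT_comp ms measurable_fst).
have mrho2 : measurable_fun setT
    (fun p : m.-tuple R * k.-tuple R => rho p.2).
  exact: (measurableT_comp mrho measurable_snd).
have tr (r : k.-tuple R) g : measurable_fun setT g -> (forall x, 0 <= g x)%E ->
    (\int[@leb R m]_t g (tshift (E r) t) = \int[@leb R m]_t g t)%E.
  by move=> mg g0; exact: (preserves_tshift (E r)).2.
transitivity (\int[@leb R k]_r \int[@leb R m]_t
    (rho r * f (tshift (E (s t)) (tshift (E r) t))))%E.
  rewrite {1}(avg (\int[_]_x f _)%E); last exact: integral_ge0.
  apply: eq_integral => r _; rewrite ge0_integralZl //; last first.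
    exact: measurable_fun_pair1 mfES.
  congr (_ * _)%E.
  rewrite -(tr r (fun t => f (tshift (E (s t)) t))) //.
    by apply: eq_integral => t _; rewrite sE.
  apply: (measurableT_comp mf); apply: measurable_shift2 => // i.
  exact: (measurableT_comp (mE i) ms).
rewrite -(@fubini_tonelli _ _ _ _ _ (@leb R m) (@leb R k)
  (fun p => rho p.2 * f (tshift (E (s p.1)) (tshift (E p.2) p.1)))%E); last first.
- by move=> p; rewrite mule_ge0.
- exact: emeasurable_funM.
(* For fixed [t], translate [r] by [s t]; additivity of [E] merges the two shifts of [t] into
   one. *)
transitivity (\int[@leb R m]_t \int[@leb R k]_r
    (rho (N t r) * f (tshift (E r) t)))%E.
  apply: eq_integral => t _ /=.
  have := (preserves_tshift (fun j => tnth (s t) j)).2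
    (fun r => rho (N t r) * f (tshift (E r) t))%E.
  move=> <-; last 2 first.
  - apply: emeasurable_funM; first exact: measurable_fun_pair2 mrhoN.
    exact: measurable_fun_pair2 mfE.
  - by move=> r; rewrite mule_ge0.
  apply: eq_integral => r _; congr (rho _ * f _)%E.
    by apply: eq_from_tnth => i; rewrite !tnth_mktuple addrK.
  by apply: eq_from_tnth => i; rewrite !tnth_mktuple ED addrA.
rewrite (@fubini_tonelli _ _ _ _ _ (@leb R m) (@leb R k)
  (fun p => rho (N p.1 p.2) * f (tshift (E p.2) p.1))%E); last first.
- by move=> p; rewrite mule_ge0.
- exact: emeasurable_funM.
(* For fixed [r], translate [t] by [E r]; the density is unchanged because [s] is. *)
transitivity (\int[@leb R k]_r \int[@leb R m]_t (rho (N t r) * f t))%E.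
  apply: eq_integral => r _ /=.
  rewrite -[RHS](tr r (fun t => rho (N t r) * f t)%E).
  - by apply: eq_integral => t _; rewrite /N sE.
  - by apply: emeasurable_funM => //; exact: measurable_fun_pair1 mrhoN.
  - by move=> t; rewrite mule_ge0.
rewrite -(@fubini_tonelli _ _ _ _ _ (@leb R m) (@leb R k)
  (fun p => rho (N p.1 p.2) * f p.1)%E); last first.
- by move=> p; rewrite mule_ge0.
- by apply: emeasurable_funM => //; exact: (measurableT_comp mf measurable_fst).
apply: eq_integral => t _ /=; rewrite [RHS]avg //.
have := (preserves_tshift (fun j => - tnth (s t) j)).2 (fun r => rho r * f t)%E.
apply; last by move=> r; rewrite mule_ge0.
by apply: emeasurable_funM => //; exact: measurable_cst.
Qed.

End shear.

Section rotation.
Variables (R : realType) (n : nat).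
Implicit Types t : (n + n).-tuple R.

Definition rotT (c s : R) t : (n + n).-tuple R :=
  [tuple match fintype.split i with
         | inl j => c * tnth t (lshift n j) - s * tnth t (rshift n j)
         | inr j => s * tnth t (lshift n j) + c * tnth t (rshift n j)
         end | i < n + n].

Lemma tnth_rotl c s t j : tnth (rotT c s t) (lshift n j) =
  c * tnth t (lshift n j) - s * tnth t (rshift n j).
Proof. by rewrite tnth_mktuple (unsplitK (inl j)). Qed.

Lemma tnth_rotr c s t j : tnth (rotT c s t) (rshift n j) =
  s * tnth t (lshift n j) + c * tnth t (rshift n j).
Proof. by rewrite tnth_mktuple (unsplitK (inr j)). Qed.

Lemma tuple_splitP t t' :
  (forall j, tnth t (lshift n j) = tnth t' (lshift n j)) ->
  (forall j, tnth t (rshift n j) = tnth t' (rshift n j)) -> t = t'.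
Proof.
move=> hl hr; apply: eq_from_tnth => i.
by rewrite -(splitK i); case: (fintype.split i) => j /=.
Qed.

Lemma cvec_rotT c s t : cvec (rotT c s t) = (c +i* s) *: cvec t.
Proof.
apply/matrixP => j k; rewrite !mxE tnth_rotl tnth_rotr.
by apply: complexP; rewrite ?ReM ?ImM /=; ring.
Qed.

Let upT (x : R) t : (n + n).-tuple R :=
  [tuple match fintype.split i with
         | inl j => tnth t (lshift n j) + x * tnth t (rshift n j)
         | inr j => tnth t (rshift n j)
         end | i < n + n].

Let dnT (x : R) t : (n + n).-tuple R :=
  [tuple match fintype.split i with
         | inl j => tnth t (lshift n j)
         | inr j => tnth t (rshift n j) + x * tnth t (lshift n j)
         end | i < n + n].

Let preserves_up x : preserves (@leb R (n + n)) (upT x).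
Proof.
pose E (r : n.-tuple R) (i : 'I_(n + n)) : R :=
  if fintype.split i is inl j then tnth r j else 0.
pose s t : n.-tuple R := [tuple x * tnth t (rshift n j) | j < n].
have -> : upT x = fun t => tshift (E (s t)) t.
  apply/funext => t; apply: tuple_splitP => j; rewrite !tnth_mktuple /E.
    by rewrite !(unsplitK (inl j)) tnth_mktuple.
  by rewrite !(unsplitK (inr j)) addr0.
apply: preserves_shear.
- move=> i; rewrite /E; case: (fintype.split i) => j; first exact: measurable_tnth.
  exact: measurable_cst.
- apply/measurable_fun_tnthP => i; rewrite /comp.
  under eq_fun do rewrite tnth_mktuple.
  by apply: measurable_funM; [exact: measurable_cst|exact: measurable_tnth].
- move=> r r' i; rewrite /E; case: (fintype.split i) => j; last by rewrite addr0.
  by rewrite tnth_mktuple.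
- move=> t r; apply: eq_from_tnth => j; rewrite !tnth_mktuple /E.
  by rewrite (unsplitK (inr j)) addr0.
Qed.

Let preserves_dn x : preserves (@leb R (n + n)) (dnT x).
Proof.
pose E (r : n.-tuple R) (i : 'I_(n + n)) : R :=
  if fintype.split i is inr j then tnth r j else 0.
pose s t : n.-tuple R := [tuple x * tnth t (lshift n j) | j < n].
have -> : dnT x = fun t => tshift (E (s t)) t.
  apply/funext => t; apply: tuple_splitP => j; rewrite !tnth_mktuple /E.
    by rewrite !(unsplitK (inl j)) addr0.
  by rewrite !(unsplitK (inr j)) tnth_mktuple.
apply: preserves_shear.
- move=> i; rewrite /E; case: (fintype.split i) => j; last exact: measurable_tnth.
  exact: measurable_cst.
- apply/measurable_fun_tnthP => i; rewrite /comp.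
  under eq_fun do rewrite tnth_mktuple.
  by apply: measurable_funM; [exact: measurable_cst|exact: measurable_tnth].
- move=> r r' i; rewrite /E; case: (fintype.split i) => j; first by rewrite addr0.
  by rewrite tnth_mktuple.
- move=> t r; apply: eq_from_tnth => j; rewrite !tnth_mktuple /E.
  by rewrite (unsplitK (inl j)) addr0.
Qed.

                                                                         
(** A rotation is a product of three shears: up, down and up again, the outer two with the same
    slope. *)
Lemma preserves_rotT c s : c ^+ 2 + s ^+ 2 = 1 -> preserves (@leb R (n + n)) (rotT c s).
Proof.
move=> cs.
have main (c' s' : R) : c' ^+ 2 + s' ^+ 2 = 1 -> c' != -1 ->
    preserves (@leb R (n + n)) (rotT c' s').
  move=> cs' c1; have c10 : 1 + c' != 0 by rewrite addrC addr_eq0.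
  (* For the angle $\theta$ this slope is $-\tan(\theta/2)$, which excludes only the half turn. *)
  set x := - s' / (1 + c').
  have e2 : x * (1 + c') = - s' by rewrite /x mulfVK.
  have e1 : 1 + x * s' = c'.
    apply: (mulfI c10); rewrite mulrDr mulr1 mulrA [_ * x]mulrC e2.
    by move: cs'; rewrite !expr2 => cs'; lra.
  have -> : rotT c' s' = fun t => upT x (dnT s' (upT x t)).
    apply/funext => t; apply: tuple_splitP => j.
      rewrite tnth_rotl !tnth_mktuple.
      rewrite !(unsplitK (inl j), unsplitK (inr j)) !tnth_mktuple.
      rewrite !(unsplitK (inl j), unsplitK (inr j)) !tnth_mktuple.
      rewrite !(unsplitK (inl j), unsplitK (inr j)).
      by rewrite -[- (s' * _)]mulNr -e2 -{1}e1 -{1}e1; ring.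
    rewrite tnth_rotr !tnth_mktuple.
    rewrite !(unsplitK (inl j), unsplitK (inr j)) !tnth_mktuple.
    rewrite !(unsplitK (inl j), unsplitK (inr j)) !tnth_mktuple.
    rewrite !(unsplitK (inl j), unsplitK (inr j)).
    by rewrite -{1}e1; ring.
  apply: preserves_comp; first exact: preserves_up.
  by apply: preserves_comp; [exact: preserves_dn|exact: preserves_up].
have [c1|] := eqVneq c (-1); last exact: main.
have s0 : s = 0.
  by apply/eqP; rewrite -sqrf_eq0; apply/eqP; move: cs; rewrite c1; lra.
(* The half turn is a product of two quarter turns. *)
have -> : rotT c s = fun t => rotT 0 1 (rotT 0 1 t).
  apply/funext => t; apply: tuple_splitP => j; rewrite !(tnth_rotl, tnth_rotr) c1 s0; ring.
have p01 : preserves (@leb R (n + n)) (rotT 0 1).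
  by apply: main; [ring|rewrite eq_sym oppr_eq0 oner_eq0].
exact: preserves_comp.
Qed.

End rotation.

                                             

(** * Goursat's theorem on rectangles and the mean value property *)

Section segment_integral.
Variable R : realType.
Implicit Types (f g : R -> R) (a b c : R).

Definition segint f a b : R := \int[@lebesgue_measure R]_(x in `[a, b]) f x.

Lemma segint_integrable f a b : continuous f ->
  (@lebesgue_measure R).-integrable `[a, b]%classic (EFin \o f).
Proof.
move=> cf; apply: continuous_compact_integrable; first exact: segment_compact.
exact: continuous_subspaceT.
Qed.

Lemma segint_cst a b k : a <= b -> segint (fun=> k) a b = k * (b - a).
Proof.
move=> ab; rewrite /segint Rintegral_cst //.
have := lebesgue_measure_itv `[a, b]; rewrite /= lte_fin => ->.
by case: (ltgtP a b) ab => // -> _; rewrite subrr.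
Qed.

Lemma segintD f g a b : continuous f -> continuous g ->
  segint (fun x => f x + g x) a b = segint f a b + segint g a b.
Proof. by move=> cf cg; rewrite /segint RintegralD //; exact: segint_integrable. Qed.

Lemma segint_split f a m b : continuous f -> a <= m -> m <= b ->
  segint f a b = segint f a m + segint f m b.
Proof.
move=> cf am mb; apply/eqP; rewrite addrC -subr_eq; apply/eqP.
rewrite /segint Rintegral_itvB; [|exact: segint_integrable|by rewrite bnd_simp|by rewrite bnd_simp].
rewrite Rintegral_itv_obnd_cbnd //.
apply: integrableS (segint_integrable a b cf) => //.
by move=> x /=; rewrite !in_itv /= => /andP[/ltW xm ->]; rewrite (le_trans am).
Qed.

Lemma segint_bound f a b M : continuous f -> a <= b ->
  (forall x, a <= x <= b -> `|f x| <= M) -> `|segint f a b| <= M * (b - a).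
Proof.
move=> cf ab fM; apply: le_trans (le_normr_Rintegral _ _) _ => //.
  exact: segint_integrable.
rewrite -segint_cst //; apply: le_Rintegral => //.
- have := segint_integrable a b cf; exact: integrable_norm.
- by apply: segint_integrable; exact: cst_continuous.
Qed.

End segment_integral.

Section goursat_real.
Variable R : realType.
Implicit Types a b c d x y e : R.

Lemma nested_intervals (a_ b_ : nat -> R) :
  (forall k, a_ k <= a_ k.+1) -> (forall k, b_ k.+1 <= b_ k) ->
  (forall k, a_ k <= b_ k) -> exists x, forall k, a_ k <= x <= b_ k.
Proof.
move=> ha hb hab.
have ma i j : (i <= j)%N -> a_ i <= a_ j.
  by move/subnK <-; elim: (j - i)%N => //= l /le_trans; apply; rewrite addSn.
have mb i j : (i <= j)%N -> b_ j <= b_ i.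
  by move/subnK <-; elim: (j - i)%N => //= l; apply: le_trans; rewrite addSn.
have abk i k : a_ i <= b_ k.
  apply: le_trans (ma _ _ (leq_maxl i k)) _; apply: le_trans (hab _) _.
  exact: mb (leq_maxr i k).
exists (sup (range a_)) => k; apply/andP; split.
  apply: ub_le_sup; last by exists k.
  by exists (b_ 0%N) => _ [i _ <-].
apply: ge_sup; first by exists (a_ 0%N), 0%N.
by move=> _ [i _ <-].
Qed.

Variables P Q : R -> R -> R.

                                                             
(** At every point $P\,dx+Q\,dy$ is differentiable with equal cross derivatives
    $\partial_yP=\partial_xQ=D$. The derivatives are only assumed to exist. *)
Hypothesis closed_form : forall x0 y0, exists p D q, forall e, 0 < e ->
  exists2 dl, 0 < dl & forall x y, `|x - x0| < dl -> `|y - y0| < dl ->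
    `|P x y - P x0 y0 - (p * (x - x0) + D * (y - y0))| <= e * (`|x - x0| + `|y - y0|) /\
    `|Q x y - Q x0 y0 - (D * (x - x0) + q * (y - y0))| <= e * (`|x - x0| + `|y - y0|).

Let lip (F : R -> R) x0 k dl : 0 < dl ->
  (forall x, `|x - x0| < dl -> `|F x - F x0| <= k * `|x - x0|) ->
  {for x0, continuous F}.
Proof.
move=> dl0 hF; apply/(@cvgrPdist_le _ _ _ _ _ F (F x0)) => e e0.
have k0 : 0 < `|k| + 1 by rewrite ltr_wpDl.
near=> x; rewrite distrC.
have hx : `|x - x0| < dl.
  rewrite distrC; near: x; exact: cvgr_dist_lt.
apply: le_trans (hF _ hx) _.
apply: (@le_trans _ _ ((`|k| + 1) * `|x - x0|)).
  by apply: ler_wpM2r => //; rewrite ler_wpDr // ler_norm.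
rewrite mulrC -ler_pdivlMr //; apply: ltW; rewrite distrC; near: x.
by apply: cvgr_dist_lt => //; rewrite divr_gt0.
Unshelve. all: by end_near. Qed.

Let diff_bound x0 y0 : exists k dl, 0 < dl /\
  (forall x, `|x - x0| < dl -> `|P x y0 - P x0 y0| <= k * `|x - x0|) /\
  (forall y, `|y - y0| < dl -> `|Q x0 y - Q x0 y0| <= k * `|y - y0|).
Proof.
have [p [D [q h]]] := closed_form x0 y0.
have [dl dl0 hd] := h 1 ltr01.
exists (`|p| + `|q| + 1), dl; split => //; split.
  move=> x hx; have := (hd x y0 hx); rewrite subrr normr0 => /(_ dl0)[+ _].
  rewrite mulr0 !addr0 mul1r => hp.
  rewrite -[P x y0 - _](subrK (p * (x - x0))); apply: le_trans (ler_normD _ _) _.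
  rewrite normrM; apply: le_trans (lerD hp (lexx _)) _.
  by rewrite -{1}[`|x - x0|]mul1r -mulrDl ler_wpM2r // addrC lerD2r lerDl.
move=> y hy; have := (hd x0 y); rewrite subrr normr0 => /(_ dl0 hy)[_].
rewrite mulr0 !add0r mul1r => hp.
rewrite -[Q x0 y - _](subrK (q * (y - y0))); apply: le_trans (ler_normD _ _) _.
rewrite normrM; apply: le_trans (lerD hp (lexx _)) _.
by rewrite -{1}[`|y - y0|]mul1r -mulrDl ler_wpM2r // addrC lerD2r lerDr.
Qed.

Let contP c : continuous (fun x => P x c).
Proof.
move=> x0; have [k [dl [dl0 [h _]]]] := diff_bound x0 c.
exact: (@lip (fun x => P x c) x0 k dl).
Qed.

Let contQ a : continuous (fun y => Q a y).
Proof.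
move=> y0; have [k [dl [dl0 [_ h]]]] := diff_bound a y0.
exact: (@lip (fun y => Q a y) y0 k dl).
Qed.

Let contPB c d : continuous (fun x => P x c - P x d).
Proof. by move=> x; apply: continuousB; exact: contP. Qed.

Let contQB a b : continuous (fun y => Q b y - Q a y).
Proof. by move=> x; apply: continuousB; exact: contQ. Qed.

(** Circulation of $P\,dx+Q\,dy$ around the boundary of $[a,b]\times[c,d]$, counterclockwise. *)
Let circ a b c d := segint (fun x => P x c - P x d) a b +
                    segint (fun y => Q b y - Q a y) c d.

Let circ_splitx a m b c d : a <= m -> m <= b ->
  circ a b c d = circ a m c d + circ m b c d.
Proof.
move=> am mb; rewrite /circ (segint_split (@contPB c d) am mb).
rewrite addrACA -segintD; [|exact: contQB|exact: contQB].
by congr (_ + segint _ _ _); apply/funext => y; ring.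
Qed.

Let circ_splity a b c m d : c <= m -> m <= d ->
  circ a b c d = circ a b c m + circ a b m d.
Proof.
move=> cm md; rewrite /circ (segint_split (@contQB a b) cm md).
rewrite addrACA -segintD; [|exact: contPB|exact: contPB].
by congr (segint _ _ _ + _); apply/funext => y; ring.
Qed.

(** The affine approximation at $(x_0,y_0)$ is again a closed form and has circulation zero. Only
    the approximation error contributes, and it is at most $eL$ on a boundary of half-length $L$. *)
Let circ_local x0 y0 e : 0 < e -> exists2 dl, 0 < dl &
  forall a b c d, a <= x0 <= b -> c <= y0 <= d -> b - a < dl -> d - c < dl ->
    `|circ a b c d| <= 2 * e * (b - a + (d - c)) ^+ 2.
Proof.
move=> e0; have [p [D [q h]]] := closed_form x0 y0.
have [dl dl0 hd] := h e e0; exists dl => // a b c d.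
move=> /andP[ax xb] /andP[cy yd] bal dcl.
have ab : a <= b by exact: le_trans xb.
have cd : c <= d by exact: le_trans yd.
have nx x : a <= x <= b -> `|x - x0| <= b - a.
  by move=> /andP[? ?]; rewrite ler_norml; apply/andP; split; lra.
have ny y : c <= y <= d -> `|y - y0| <= d - c.
  by move=> /andP[? ?]; rewrite ler_norml; apply/andP; split; lra.
set L := b - a + (d - c).
have est x y : a <= x <= b -> c <= y <= d ->
    `|P x y - P x0 y0 - (p * (x - x0) + D * (y - y0))| <= e * L /\
    `|Q x y - Q x0 y0 - (D * (x - x0) + q * (y - y0))| <= e * L.
  move=> hx hy; have [||h1 h2] := hd x y.
  - exact: le_lt_trans (nx _ hx) bal.
  - exact: le_lt_trans (ny _ hy) dcl.
  have LL : e * (`|x - x0| + `|y - y0|) <= e * L.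
    by apply: ler_wpM2l; [exact: ltW|apply: lerD; [exact: nx|exact: ny]].
  by split; [exact: le_trans h1 LL|exact: le_trans h2 LL].
have cc : c <= c <= d by rewrite lexx.
have dd : c <= d <= d by rewrite lexx cd.
have aa : a <= a <= b by rewrite lexx.
have bb : a <= b <= b by rewrite lexx ab.
(* The corrections $D(d-c)$ here and $-D(b-a)$ below integrate to opposite numbers, so the
   circulation is unchanged by them. *)
have e1 : `|segint (fun x => P x c - P x d + D * (d - c)) a b| <= 2 * e * L * (b - a).
  apply: segint_bound => //.
    move=> x; apply: (@continuousD _ _ _ (fun x => P x c - P x d) (fun=> D * (d - c))).
      exact: contPB.
    exact: cst_continuous.
  move=> x hx; have [h1 _] := est x c hx cc; have [h2 _] := est x d hx dd.
  have -> : P x c - P x d + D * (d - c) =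
    (P x c - P x0 y0 - (p * (x - x0) + D * (c - y0))) -
    (P x d - P x0 y0 - (p * (x - x0) + D * (d - y0))) by ring.
  apply: le_trans (ler_normB _ _) _; apply: le_trans (lerD h1 h2) _.
  by rewrite le_eqVlt; apply/orP; left; apply/eqP; ring.
have e2 : `|segint (fun y => Q b y - Q a y + - (D * (b - a))) c d| <= 2 * e * L * (d - c).
  apply: segint_bound => //.
    move=> x; apply: (@continuousD _ _ _ (fun y => Q b y - Q a y) (fun=> - (D * (b - a)))).
      exact: contQB.
    exact: cst_continuous.
  move=> y hy; have [_ h1] := est b y bb hy; have [_ h2] := est a y aa hy.
  have -> : Q b y - Q a y + - (D * (b - a)) =
    (Q b y - Q x0 y0 - (D * (b - x0) + q * (y - y0))) -
    (Q a y - Q x0 y0 - (D * (a - x0) + q * (y - y0))) by ring.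
  apply: le_trans (ler_normB _ _) _; apply: le_trans (lerD h1 h2) _.
  by rewrite le_eqVlt; apply/orP; left; apply/eqP; ring.
have -> : circ a b c d = segint (fun x => P x c - P x d + D * (d - c)) a b +
    segint (fun y => Q b y - Q a y + - (D * (b - a))) c d.
  rewrite (@segintD _ (fun x => P x c - P x d)); [|exact: contPB|exact: cst_continuous].
  rewrite (@segintD _ (fun y => Q b y - Q a y)); [|exact: contQB|exact: cst_continuous].
  by rewrite !segint_cst // /circ; ring.
apply: le_trans (ler_normD _ _) _; apply: le_trans (lerD e1 e2) _.
by rewrite -mulrDr -/L expr2 mulrA.
Qed.

Let quad : Type := (R * R * (R * R))%type.
Let cq (r : quad) := circ r.1.1 r.1.2 r.2.1 r.2.2.
Let mid a b : R := (a + b) / 2.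
(** Chooses a quarter of the rectangle that carries at least a quarter of the circulation; when the
    first three fail, the triangle inequality forces the fourth. *)
Let step (r : quad) : quad :=
  let: (a, b, (c, d)) := r in
  if `|cq r| <= 4 * `|cq (a, mid a b, (c, mid c d))| then (a, mid a b, (c, mid c d))
  else if `|cq r| <= 4 * `|cq (mid a b, b, (c, mid c d))| then (mid a b, b, (c, mid c d))
  else if `|cq r| <= 4 * `|cq (a, mid a b, (mid c d, d))| then (a, mid a b, (mid c d, d))
  else (mid a b, b, (mid c d, d)).

Let stepP (r : quad) : r.1.1 <= r.1.2 -> r.2.1 <= r.2.2 ->
  [/\ r.1.1 <= (step r).1.1, (step r).1.2 <= r.1.2,
      r.2.1 <= (step r).2.1, (step r).2.2 <= r.2.2 &
      [/\ (step r).1.2 - (step r).1.1 = (r.1.2 - r.1.1) / 2,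
          (step r).2.2 - (step r).2.1 = (r.2.2 - r.2.1) / 2 &
          `|cq r| <= 4 * `|cq (step r)| ] ].
Proof.
case: r => -[a b] [c d] /= ab cd.
have am : a <= mid a b by rewrite /mid; lra.
have mb : mid a b <= b by rewrite /mid; lra.
have cm : c <= mid c d by rewrite /mid; lra.
have md : mid c d <= d by rewrite /mid; lra.
have split4 : cq (a, b, (c, d)) = cq (a, mid a b, (c, mid c d)) +
   cq (mid a b, b, (c, mid c d)) + cq (a, mid a b, (mid c d, d)) +
   cq (mid a b, b, (mid c d, d)).
  rewrite /cq /= (circ_splity _ _ cm md) (circ_splitx _ _ am mb).
  by rewrite [circ a b (mid c d) d](circ_splitx _ _ am mb) addrA.
have halfx1 : mid a b - a = (b - a) / 2 by rewrite /mid; field.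
have halfx2 : b - mid a b = (b - a) / 2 by rewrite /mid; field.
have halfy1 : mid c d - c = (d - c) / 2 by rewrite /mid; field.
have halfy2 : d - mid c d = (d - c) / 2 by rewrite /mid; field.
case: ifPn => [h1|]; first by split.
rewrite -ltNge => h1; case: ifPn => [h2|]; first by split.
rewrite -ltNge => h2; case: ifPn => [h3|]; first by split.
rewrite -ltNge => h3; split => //; split => //.
move: h1 h2 h3; rewrite split4.
set q1 := cq _; set q2 := cq _; set q3 := cq _; set q4 := cq _ => h1 h2 h3.
have := ler_normD (q1 + q2 + q3) q4; have := ler_normD (q1 + q2) q3.
have := ler_normD q1 q2; lra.
Qed.

(** Bisection: after $k$ steps the circulation has decreased at most by $4^k$ while the sides have
    shrunk by $2^k$. Near the common point of the nested rectangles [circ_local] bounds the initial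
    circulation by $4^k\cdot2e(L/2^k)^2=2eL^2$, for every $e>0$. *)
Lemma goursat_closed_form a b c d : a <= b -> c <= d ->
  segint (fun x => P x c - P x d) a b + segint (fun y => Q b y - Q a y) c d = 0.
Proof.
move=> ab cd; pose r k : quad := iter k step (a, b, (c, d)).
have ord k : (r k).1.1 <= (r k).1.2 /\ (r k).2.1 <= (r k).2.2.
  elim: k => [//|k [h1 h2]]; have [_ _ _ _ [e1 e2 _]] := stepP h1 h2.
  rewrite /r iterS -/(r k); split; rewrite -subr_ge0.
    by rewrite e1 divr_ge0 ?subr_ge0.
  by rewrite e2 divr_ge0 ?subr_ge0.
have st k := stepP (ord k).1 (ord k).2.
have [x0 hx] : exists x, forall k, (r k).1.1 <= x <= (r k).1.2.
  apply: nested_intervals => k; last exact: (ord k).1.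
    by have [h _ _ _ _] := st k.
  by have [_ h _ _ _] := st k.
have [y0 hy] : exists y, forall k, (r k).2.1 <= y <= (r k).2.2.
  apply: nested_intervals => k; last exact: (ord k).2.
    by have [_ _ h _ _] := st k.
  by have [_ _ _ h _] := st k.
have lx k : (r k).1.2 - (r k).1.1 = (b - a) / 2 ^+ k.
  elim: k => [|k IH]; first by rewrite expr0 divr1.
  by have [_ _ _ _ [e1 _ _]] := st k; rewrite /r iterS -/(r k) e1 IH exprSr invfM mulrA.
have ly k : (r k).2.2 - (r k).2.1 = (d - c) / 2 ^+ k.
  elim: k => [|k IH]; first by rewrite expr0 divr1.
  by have [_ _ _ _ [_ e1 _]] := st k; rewrite /r iterS -/(r k) e1 IH exprSr invfM mulrA.
have big k : `|cq (a, b, (c, d))| <= (2 ^+ k) ^+ 2 * `|cq (r k)|.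
  elim: k => [|k IH]; first by rewrite expr0 expr1n mul1r.
  apply: le_trans IH _; have [_ _ _ _ [_ _ e1]] := st k.
  have -> : (2 ^+ k.+1) ^+ 2 = (2 ^+ k) ^+ 2 * 4 :> R by rewrite [2 ^+ k.+1]exprSr exprMn; congr (_ * _); ring.
  by rewrite -[_ * 4 * _]mulrA ler_wpM2l ?sqr_ge0.
set L := b - a + (d - c).
have small e : 0 < e -> `|cq (a, b, (c, d))| <= 2 * e * L ^+ 2.
  move=> e0; have [dl dl0 hd] := circ_local x0 y0 e0.
  pose k := (Num.truncn (L / dl)).+1.
  have kL : L / 2 ^+ k < dl.
    rewrite ltr_pdivrMr ?exprn_gt0 // mulrC -ltr_pdivrMr //.
    apply: lt_le_trans (truncnS_gt _) _.
    by rewrite -natrX ler_nat ltnW // ltn_expl.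
  have ba0 : 0 <= b - a by rewrite subr_ge0.
  have dc0 : 0 <= d - c by rewrite subr_ge0.
  have k0 : 0 <= (2 ^+ k)^-1 :> R by rewrite invr_ge0 exprn_ge0.
  have hk : `|cq (r k)| <= 2 * e * ((L / 2 ^+ k) ^+ 2).
    have -> : L / 2 ^+ k = (r k).1.2 - (r k).1.1 + ((r k).2.2 - (r k).2.1).
      by rewrite lx ly -mulrDl.
    apply: hd => //.
      by rewrite lx; apply: le_lt_trans kL; rewrite ler_wpM2r // /L lerDl.
    by rewrite ly; apply: le_lt_trans kL; rewrite ler_wpM2r // /L lerDr.
  apply: le_trans (big k) _.
  apply: (le_trans (ler_wpM2l _ hk)); first exact: sqr_ge0.
  have p0 : 2 ^+ k != 0 :> R by rewrite expf_neq0 ?pnatr_eq0.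
  rewrite le_eqVlt; apply/orP; left; apply/eqP.
  by move: (2 ^+ k) p0 => p p0; field.
apply/eqP; rewrite -normr_eq0 -/(circ a b c d) -/(cq (a, b, (c, d))).
set N := `|_| in small *; have N0 : 0 <= N by exact: normr_ge0.
case: ltgtP N0 => // N0 _; exfalso.
have L0 : 0 <= L ^+ 2 by exact: sqr_ge0.
have p1 : 0 < 4 * (L ^+ 2 + 1) by rewrite mulr_gt0 // ltr_wpDl.
(* With this $e$ the bound becomes $N L^2/(2(L^2+1))<N$, a contradiction. *)
have := small (N / (4 * (L ^+ 2 + 1))); rewrite divr_gt0 // => /(_ isT).
move: (L ^+ 2) L0 p1 => l l0 p1.
have l1 : l + 1 != 0 by rewrite gt_eqF // ltr_wpDl.
have -> : 2 * (N / (4 * (l + 1))) * l = N * l / (2 * (l + 1)) by field.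
rewrite ler_pdivlMr; last by nra.
by apply/negP; rewrite -ltNge; nra.
Qed.

End goursat_real.

Section differentiable_estimates.

Lemma diff_eps (K : numFieldType) (F : K -> K) (x : K) :
  differentiable (F : K^o -> K^o) x ->
  forall e : K, 0 < e -> exists2 dl : K, 0 < dl & forall h, `|h| < dl ->
    `|F (x + h) - F x - ('D_1 (F : K^o -> K^o) x) * h| <= e * `|h|.
Proof.
move=> df e e0; have H := diff_locallyx df.
move: H; set r := the_littleo _ _ _ _ _ => H.
have := @littleoP _ _ _ _ _ _ r e e0.
rewrite nearE => /nbhs_normP [dl /= dl0 hdl].
exists dl => // h hh.
have hr := hdl h; rewrite /ball_ /= sub0r normrN in hr; have {}hr := hr hh.
rewrite deriveE //.
have -> : 'd (F : K^o -> K^o) x 1 * h = 'd (F : K^o -> K^o) x h.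
  by rewrite -{2}[h]mulr1 -[h * 1]/(h *: (1 : K^o)) linearZ /= mulrC.
have E : F (x + h) = F x + ('d (F : K^o -> K^o) x h : K) + (r h : K).
  by rewrite addrC; exact: H.
have E2 : F (x + h) - F x - ('d (F : K^o -> K^o) x h : K) = (r h : K).
  by rewrite E; move: ('d _ _ _ : K) (r h : K) => u v; ring.
by rewrite E2; exact: hr.
Qed.

Variable R : realType.
Local Notation C := R[i].

Lemma real_diff_eps (F : R -> R) (x D : R) : is_derive x 1 F D ->
  forall e : R, 0 < e -> exists2 dl : R, 0 < dl & forall h, `|h| < dl ->
    `|F (x + h) - F x - D * h| <= e * `|h|.
Proof.
move=> [dF DF] e e0; have /derivable1_diffP dF' := dF.
have [dl dl0 hdl] := @diff_eps _ F x dF' e e0.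
by exists dl => // h /hdl; rewrite DF.
Qed.

                                                 
(** Complex differentiability with real tolerances and real moduli, the form in which it feeds the
    two real closed forms of Goursat's theorem. *)
Definition cder (F : C -> C) (z D : C) := forall e : R, 0 < e ->
  exists2 dl : R, 0 < dl & forall w, normc w < dl ->
    normc (F (z + w) - F z - D * w) <= e * normc w.

Lemma diff_cder (F : C -> C) z : differentiable (F : C^o -> C^o) z ->
  exists D, cder F z D.
Proof.
move=> dF; exists ('D_1 (F : C^o -> C^o) z) => e e0.
have e0' : 0 < e%:C by rewrite ltcR.
have [dl dl0 h] := diff_eps dF e0'.
have dlE : dl = (ReC dl)%:C by apply: complexP => //=; move: dl0; rewrite ltcE => /andP[/eqP].
rewrite dlE ltcR in dl0; exists (ReC dl) => // w hw.
have := h w; rewrite dlE; change `|w| with (normc w)%:C; rewrite ltcR => /(_ hw).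
change `|_| with (normc (F (z + w) - F z - 'D_1 (F : C^o -> C^o) z * w))%:C.
by rewrite -rmorphM lecR.
Qed.

Lemma expC_cder0 : cder (@expC R) 0 1.
Proof.
move=> e e0.
(* The errors estimated below add up to at most $9e_1|w|$, so $16e_1\le e$ is enough. *)
pose e1 := Num.min 1 (e / 16).
have e10 : 0 < e1 by rewrite lt_min ltr01 divr_gt0.
have e11 : e1 <= 1 by rewrite ge_min lexx.
have e1e : 16 * e1 <= e.
  by rewrite -ler_pdivlMl // mulrC ge_min lexx orbT.
clearbody e1.
have [d1 d10 h1] := real_diff_eps (is_derive_expR (0 : R)) e10.
have [d2 d20 h2] := real_diff_eps (is_derive_sin (0 : R)) e10.
have [d3 d30 h3] := real_diff_eps (is_derive_cos (0 : R)) e10.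
pose dl := Num.min (Num.min d1 d2) (Num.min d3 e1).
have dl0 : 0 < dl by rewrite !lt_min d10 d20 d30 e10.
exists dl => // -[a b] hw; rewrite add0r expC0 mul1r.
have ha : `|a| < dl := le_lt_trans (normc_Re (a +i* b)) hw.
have hb : `|b| < dl := le_lt_trans (normc_Im (a +i* b)) hw.
move: ha hb; rewrite !lt_min => /andP[/andP[ha1 ha2] /andP[ha3 ha4]].
move=> /andP[/andP[hb1 hb2] /andP[hb3 hb4]].
have := h1 _ ha1; rewrite add0r expR0 mul1r.
have := h2 _ hb2; rewrite add0r sin0 cos0 mul1r subr0.
have := h3 _ hb3; rewrite add0r sin0 cos0 oppr0 mul0r subr0.
set E := expR a; set Cs := cos b; set S := sin b => k3 k2 k1.
have kE1 : `|E - 1| <= 2 * `|a|.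
  rewrite -[E - 1](subrK a); apply: le_trans (ler_normD _ _) _.
  by apply: le_trans (lerD k1 (lexx _)) _; have := normr_ge0 a; nra.
have E3 : 0 <= E <= 3.
  rewrite expR_ge0 /= -[E](subrK 1).
  apply: le_trans (lerD (ler_norm _) (lexx _)) _; lra.
have := normc_Re (a +i* b); have := normc_Im (a +i* b).
set W := normc (a +i* b); rewrite [ImC _]/= [ReC _]/= => kb ka.
apply: le_trans (normc_ReIm _) _.
rewrite !(ReB, ImB) /expC ReMR ImMR /= -/E -/Cs -/S oppr0 addr0.
have -> : E * Cs - 1 - a = (E - 1 - a) + E * (Cs - 1) by ring.
have -> : E * S - b = E * (S - b) + (E - 1) * b by ring.
have l1 := ler_normD (E - 1 - a) (E * (Cs - 1)).
have l2 := ler_normD (E * (S - b)) ((E - 1) * b).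
have /andP[E30 E33] := E3.
have l3 : `|E * (Cs - 1)| <= 3 * (e1 * W).
  rewrite normrM ger0_norm //; apply: ler_pM => //.
  by apply: le_trans k3 _; rewrite ler_wpM2l // ltW.
have l4 : `|E * (S - b)| <= 3 * (e1 * W).
  rewrite normrM ger0_norm //; apply: ler_pM => //.
  by apply: le_trans k2 _; rewrite ler_wpM2l // ltW.
have l5 : `|(E - 1) * b| <= 2 * e1 * W.
  rewrite normrM; apply: ler_pM => //; apply: le_trans kE1 _.
  by rewrite ler_wpM2l // ltW.
have l6 : e1 * `|a| <= e1 * W by rewrite ler_wpM2l // ltW.
have W0 : 0 <= W by exact: le_trans (normr_ge0 _) ka.
have l7 : 16 * e1 * W <= e * W by rewrite ler_wpM2r.
have l8 : 0 <= e1 * W by rewrite mulr_ge0 // ltW.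
lra.
Qed.

(** The functional equation $e^{z+h}=e^ze^h$ moves the difference quotient to the origin, where
    [expC_cder0] applies. *)
Lemma differentiable_expC (z : C^o) : differentiable (@expC R : C^o -> C^o) z.
Proof.
apply/derivable1_diffP; apply/cvg_ex; exists (expC z).
apply/(@cvgrPdist_le C C^o) => eps eps0.
have epsE : eps = (ReC eps)%:C by apply: complexP => //=; move: eps0; rewrite ltcE => /andP[/eqP].
move: eps0; rewrite epsE ltcR => e0.
have z0 : 0 < normc (expC z) by rewrite normc_expC expR_gt0.
have [|dl dl0 hdl] := @expC_cder0 (ReC eps / normc (expC z)); first by rewrite divr_gt0.
have dl0' : 0 < dl%:C :> C by rewrite ltcR.
near=> h.
have h0 : h != 0 by near: h; exact: nbhs_dnbhs_neq.
have hdl' : normc h < dl.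
  have : `|h| < dl%:C by near: h; exact: dnbhs0_lt.
  by change `|h| with (normc h)%:C; rewrite ltcR.
have nh0 : 0 < normc h.
  rewrite lt_def normc_ge0 andbT; apply/eqP => /eq0_normc; exact/eqP.
have := hdl h hdl'; rewrite add0r expC0 mul1r => hh.
change ((normc (expC z - h^-1 * (expC (h * 1 + z) - expC z)))%:C <= (ReC eps)%:C).
rewrite lecR mulr1 expCD.
have -> : expC z - h^-1 * (expC h * expC z - expC z) =
  - (expC z * h^-1 * (expC h - 1 - h)) by field.
rewrite normcN normcM [normc (expC z * _)]normcM normcV.
rewrite mulrAC ler_pdivrMr // mulrC -ler_pdivlMr // mulrAC.
exact: hh.
Unshelve. all: by end_near. Qed.

End differentiable_estimates.

Section goursat_complex.
Variable R : realType.
Local Notation C := R[i].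

Definition holo (F : C -> C) := forall z, exists D, cder F z D.

(** Here [g] stands for a side of a rectangle, which is Lipschitz in its parameter. *)
Lemma holo_cont_Re F (g : R -> C) x : holo F ->
  (exists k, forall y, normc (g y - g x) <= k * `|y - x|) ->
  {for x, continuous (fun y => ReC (F (g y)))} /\
  {for x, continuous (fun y => ImC (F (g y)))}.
Proof.
move=> hF [k hk]; have [D hD] := hF (g x).
have [dl dl0 hdl] := hD 1 ltr01.
pose K := (normc D + 1) * (`|k| + 1).
have k0 : 0 < `|k| + 1 by rewrite ltr_wpDl.
have K0 : 0 < K by rewrite mulr_gt0 // ltr_wpDl // normc_ge0.
have main e : 0 < e -> \forall y \near x, normc (F (g y) - F (g x)) <= e.
  move=> e0; near=> y.
  have hyx : normc (g y - g x) <= (`|k| + 1) * `|y - x|.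
    by apply: le_trans (hk y) _; rewrite ler_wpM2r // ler_wpDr // ler_norm.
  have hy : normc (g y - g x) < dl.
    apply: le_lt_trans hyx _; rewrite mulrC -ltr_pdivlMr // distrC.
    by near: y; apply: cvgr_dist_lt => //; rewrite divr_gt0.
  have gE : g x + (g y - g x) = g y by rewrite addrC subrK.
  have h := hdl _ hy; rewrite gE mul1r in h.
  rewrite -[F (g y) - F (g x)](subrK (D * (g y - g x))).
  apply: le_trans (le_normcD _ _) _; rewrite normcM.
  apply: le_trans (lerD h (lexx _)) _; rewrite -{1}[normc (g y - _)]mul1r -mulrDl addrC.
  apply: (@le_trans _ _ (K * `|y - x|)).
    by rewrite /K -mulrA; apply: ler_wpM2l => //; rewrite addr_ge0 // normc_ge0.
  rewrite mulrC -ler_pdivlMr // distrC ltW //.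
  by near: y; apply: cvgr_dist_lt => //; rewrite divr_gt0.
split; apply/(@cvgrPdist_le R R) => e /main; apply: filterS => y; apply: le_trans.
  by rewrite distrC -ReB normc_Re.
by rewrite distrC -ImB normc_Im.
Unshelve. all: by end_near. Qed.

Lemma normc_iRe (s t : R) : normc (s +i* t) <= `|s| + `|t|.
Proof. exact: normc_ReIm. Qed.

Lemma holo_seg_cont F c : holo F ->
  continuous (fun x => ReC (F (x +i* c))) /\ continuous (fun x => ImC (F (x +i* c))) /\
  continuous (fun x => ReC (F (c +i* x))) /\ continuous (fun x => ImC (F (c +i* x))).
Proof.
move=> hF.
have h1 x : exists k, forall y, normc (y +i* c - x +i* c) <= k * `|y - x|.
  exists 1 => y; rewrite mul1r; have -> : y +i* c - x +i* c = (y - x)%:C.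
    by apply: complexP; rewrite ?ReB ?ImB //= subrr.
  by rewrite normcR.
have h2 x : exists k, forall y, normc (c +i* y - c +i* x) <= k * `|y - x|.
  exists 1 => y; rewrite mul1r; have -> : c +i* y - c +i* x = 'i * (y - x)%:C.
    by apply: complexP; rewrite ?ReB ?ImB ?ReM ?ImM //= ?subrr; ring.
  by rewrite normcM normcR normcE /= expr0n expr1n add0r sqrtr1 mul1r.
split; [|split; [|split]] => x.
- by have [] := holo_cont_Re hF (h1 x).
- by have [] := holo_cont_Re hF (h1 x).
- by have [] := holo_cont_Re hF (h2 x).
- by have [] := holo_cont_Re hF (h2 x).
Qed.

(** With $F=u+iv$, the parts of $F\,dz$ are $u\,dx-v\,dy$ and $v\,dx+u\,dy$. Both are closed because
    a single complex number approximates both partial differences, which encodes the Cauchy-Riemann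
    equations. *)
Lemma goursat_segint F a b c d : holo F -> a <= b -> c <= d ->
  segint (fun x => ReC (F (x +i* c)) - ReC (F (x +i* d))) a b +
  segint (fun y => - ImC (F (b +i* y)) - - ImC (F (a +i* y))) c d = 0 /\
  segint (fun x => ImC (F (x +i* c)) - ImC (F (x +i* d))) a b +
  segint (fun y => ReC (F (b +i* y)) - ReC (F (a +i* y))) c d = 0.
Proof.
move=> hF ab cd.
have est x0 y0 : exists D : C, forall e, 0 < e -> exists2 dl, 0 < dl &
    forall x y, `|x - x0| < dl -> `|y - y0| < dl ->
    normc (F (x +i* y) - F (x0 +i* y0) - D * ((x - x0) +i* (y - y0))) <=
      e * (`|x - x0| + `|y - y0|).
  have [D hD] := hF (x0 +i* y0); exists D => e e0; have [dl dl0 h] := hD e e0.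
  (* Halved since $|s+it|\le|s|+|t|$. *)
  exists (dl / 2); first by rewrite divr_gt0.
  move=> x y hx hy; have n1 := normc_iRe (x - x0) (y - y0).
  have := h ((x - x0) +i* (y - y0)).
  have -> : x0 +i* y0 + (x - x0) +i* (y - y0) = x +i* y.
    by apply: complexP; rewrite ?ReD ?ImD /=; ring.
  have hlt : normc ((x - x0) +i* (y - y0)) < dl.
    by apply: le_lt_trans n1 _; rewrite [dl]splitr ltrD.
  move=> /(_ hlt) h'; apply: le_trans h' _; apply: ler_wpM2l => //; exact: ltW.
split.
  apply: (@goursat_closed_form R (fun x y => ReC (F (x +i* y)))
    (fun x y => - ImC (F (x +i* y)))) => // x0 y0.
  have [D hD] := est x0 y0; exists (ReC D), (- ImC D), (- ReC D) => e e0.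
  have [dl dl0 h] := hD e e0; exists dl => // x y hx hy; have {}h := h x y hx hy.
  split.
    have := le_trans (normc_Re _) h; rewrite !ReB ReM /=.
    by congr (`|_| <= _); ring.
  have := le_trans (normc_Im _) h; rewrite !ImB ImM /= -normrN.
  by congr (`|_| <= _); ring.
apply: (@goursat_closed_form R (fun x y => ImC (F (x +i* y)))
    (fun x y => ReC (F (x +i* y)))) => // x0 y0.
have [D hD] := est x0 y0; exists (ImC D), (ReC D), (- ImC D) => e e0.
have [dl dl0 h] := hD e e0; exists dl => // x y hx hy; have {}h := h x y hx hy.
split.
  have := le_trans (normc_Im _) h; rewrite !ImB ImM /=.
  by congr (`|_| <= _); ring.
have := le_trans (normc_Re _) h; rewrite !ReB ReM /=.
by congr (`|_| <= _); ring.
Qed.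

Lemma Rintegral_uniform (a b : R) (ab : a < b) (f : R -> R) : continuous f ->
  \int[uniform_prob ab]_x f x = (b - a)^-1 * segint f a b.
Proof.
move=> cf.
have mf : measurable_fun [set: measurableTypeR R] (EFin \o f).
  by apply/measurable_EFinP; exact: continuous_measurable_fun.
have fi := segint_integrable a b cf.
have mf' : measurable_fun (`[a, b]%classic : set (measurableTypeR R)) (EFin \o f).
  exact: measurable_int fi.
rewrite /segint /Rintegral [in LHS]integralE [in RHS]integralE.
rewrite (integral_uniform ab (measurable_funepos mf) (fun x => funepos_ge0 _ x)).
rewrite (integral_uniform ab (measurable_funeneg mf) (fun x => funeneg_ge0 _ x)).
have mI : measurable (`[a, b]%classic : set (measurableTypeR R)) by exact: measurable_itv.
have f1 := integrable_fin_num mI (integrable_funepos mI fi).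
have f2 := integrable_fin_num mI (integrable_funeneg mI fi).
set Ip := (X in (_ * X - _)%E); set In := (X in (_ - _ * X)%E).
transitivity ((b - a)^-1 * fine (Ip - In)%E); last by [].
have I1 : Ip \is a fin_num by exact: f1.
have I2 : In \is a fin_num by exact: f2.
by rewrite -(fineK I1) -(fineK I2) -!EFinM -!EFinB /= mulrBr.
Qed.

Lemma cint_uniform (a b : R) (ab : a < b) (f : R -> C) :
  continuous (fun x => ReC (f x)) -> continuous (fun x => ImC (f x)) ->
  cint (uniform_prob ab) f = ((b - a)^-1 * segint (fun x => ReC (f x)) a b) +i*
    ((b - a)^-1 * segint (fun x => ImC (f x)) a b).
Proof. by move=> c1 c2; rewrite /cint !Rintegral_uniform. Qed.

(** Stated with averages over the sides: the side parameter then ranges over a probability space,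
    where Fubini's theorem for [cint] applies. *)
Lemma goursat_average F (a b c d : R) (ab : a < b) (cd : c < d) : holo F ->
  (b - a)%:C * (cint (uniform_prob ab) (fun x => F (x +i* c)) -
                cint (uniform_prob ab) (fun x => F (x +i* d))) +
  'i * (d - c)%:C * (cint (uniform_prob cd) (fun y => F (b +i* y)) -
                     cint (uniform_prob cd) (fun y => F (a +i* y))) = 0.
Proof.
move=> hF; have [g1 g2] := goursat_segint hF (ltW ab) (ltW cd).
have [c1 [c2 _]] := holo_seg_cont c hF; have [d1 [d2 _]] := holo_seg_cont d hF.
have [_ [_ [a1 a2]]] := holo_seg_cont a hF; have [_ [_ [b1 b2]]] := holo_seg_cont b hF.
have cN (f : R -> R) : continuous f -> continuous (fun x => - f x).
  by move=> cf x; apply: continuousN; exact: cf.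
have sB (f g : R -> R) l r : continuous f -> continuous g ->
    segint (fun x => f x - g x) l r = segint f l r - segint g l r.
  move=> cf cg; rewrite (@segintD _ f (fun x => - g x)) //; last exact: cN.
  congr (_ + _); apply/eqP; rewrite -addr_eq0; apply/eqP.
  rewrite addrC -segintD //; last exact: cN.
  under [LHS]eq_Rintegral do rewrite subrr.
  by rewrite /Rintegral integral0.
have sN (f : R -> R) l r : continuous f -> segint (fun x => - f x) l r = - segint f l r.
  move=> cf; rewrite -[RHS]add0r.
  transitivity (segint (fun x => (fun=> 0) x - f x) l r).
    by congr segint; apply/funext => x /=; rewrite sub0r.
  rewrite sB //; last exact: cst_continuous.
  by congr (_ - _); rewrite /segint /Rintegral integral0.
move: g1 g2; rewrite !sB //; try exact: cN.
rewrite !sN // => g1 g2.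
have ba0 : b - a != 0 by rewrite subr_eq0 gt_eqF.
have dc0 : d - c != 0 by rewrite subr_eq0 gt_eqF.
rewrite !cint_uniform //.
move: (segint _ a b) (segint (fun x => ReC (F (x +i* d))) a b) g1.
move: (segint _ a b) (segint (fun x => ImC (F (x +i* d))) a b) g2.
move: (segint _ c d) (segint (fun x => ReC (F (a +i* x))) c d).
move: (segint _ c d) (segint (fun x => ImC (F (a +i* x))) c d).
move=> s1 s2 s3 s4 s5 s6 g2 s7 s8 g1.
apply: complexP.
  by rewrite [RHS]/= -g1 /=; field; rewrite ?ba0 ?dc0.
by rewrite [RHS]/= -g2 /=; field; rewrite ?ba0 ?dc0.
Qed.

End goursat_complex.

Section mean_value.
Variable R : realType.
Local Notation C := R[i].

Lemma cder_comp (F G : C -> C) z D D' : cder G z D -> cder F (G z) D' ->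
  cder (fun x => F (G x)) z (D' * D).
Proof.
move=> hG hF e e0.
pose K := normc D + 1.
have K0 : 0 < K by rewrite ltr_wpDl // normc_ge0.
have K0' : 0 < normc D' + 1 by rewrite ltr_wpDl // normc_ge0.
have [d1 d10 h1] := hF (e / 2 / K) (divr_gt0 (divr_gt0 e0 (ltr0Sn R 1)) K0).
have m0 : 0 < Num.min 1 (e / 2 / (normc D' + 1)) by rewrite lt_min ltr01 !divr_gt0.
have [d2 d20 h2] := hG _ m0.
exists (Num.min d2 (d1 / K)); first by rewrite lt_min d20 divr_gt0.
move=> w; rewrite lt_min => /andP[hw2 hw1].
have {}h2 := h2 w hw2.
have h2a : normc (G (z + w) - G z - D * w) <= normc w.
  by apply: le_trans h2 _; rewrite -{2}[normc w]mul1r ler_wpM2r ?normc_ge0 // ge_min lexx.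
have h2b : normc (G (z + w) - G z - D * w) <= e / 2 / (normc D' + 1) * normc w.
  by apply: le_trans h2 _; rewrite ler_wpM2r ?normc_ge0 // ge_min lexx orbT.
set v := G (z + w) - G z.
have vK : normc v <= K * normc w.
  rewrite -[v](subrK (D * w)); apply: le_trans (le_normcD _ _) _.
  by rewrite normcM /K mulrDl mul1r addrC lerD2l.
have hv : normc v < d1.
  by apply: le_lt_trans vK _; rewrite mulrC -ltr_pdivlMr.
have := h1 v hv; have -> : G z + v = G (z + w) by rewrite /v addrC subrK.
move=> h1'.
have -> : F (G (z + w)) - F (G z) - D' * D * w =
  (F (G (z + w)) - F (G z) - D' * v) + D' * (v - D * w) by ring.
apply: le_trans (le_normcD _ _) _.
rewrite [e]splitr mulrDl; apply: lerD.
  apply: le_trans h1' _; apply: le_trans (ler_wpM2l _ vK) _.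
    by rewrite ltW // !divr_gt0.
  by rewrite mulrA divfK ?gt_eqF.
rewrite normcM; apply: le_trans (ler_wpM2l (normc_ge0 _) h2b) _.
rewrite mulrA ler_wpM2r ?normc_ge0 // mulrA ler_pdivrMr // mulrC.
by rewrite ler_wpM2l ?lerDl // ltW // divr_gt0.
Qed.

Lemma cder_affine (a b : C) z : cder (fun x => a * x + b) z a.
Proof.
move=> e e0; exists 1 => // w _.
have -> : a * (z + w) + b - (a * z + b) - a * w = 0 by ring.
by rewrite normc0 mulr_ge0 ?normc_ge0 // ltW.
Qed.

Lemma cder_expC (z : C) : exists D, cder (@expC R) z D.
Proof. exact: diff_cder (differentiable_expC z). Qed.

Lemma two_pi_gt0 : 0 < (2 * pi : R). Proof. by rewrite mulr_gt0 // pi_gt0. Qed.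

Lemma cintg_uniform_bounded (a b : R) (ab : a < b) (f : R -> C) M :
  continuous (fun x => ReC (f x)) -> continuous (fun x => ImC (f x)) ->
  (forall x, normc (f x) <= M) -> cintg (uniform_prob ab) f.
Proof.
move=> c1 c2 fM; apply: (@cintg_le _ _ _ _ _ (fun=> M)) => //.
  by split; exact: continuous_measurable_fun.
by apply: finite_measure_integrable_cst.
Qed.

Lemma cint_uniform_cst (a b : R) (ab : a < b) (k : C) :
  cint (uniform_prob ab) (fun=> k) = k.
Proof.
have E (r : R) : \int[uniform_prob ab]_x r = r.
  rewrite Rintegral_cst //; have := @probability_setT _ _ _ (uniform_prob ab).
  by move=> /= ->; rewrite mulr1.
by apply: complexP; rewrite /cint /= E.
Qed.

(** Apply Goursat's theorem to $F(e^{i\lambda})$ on $[0,2\pi]\times[0,Y]$. By periodicity the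
    vertical sides cancel, so the average over the circle of radius $e^{-Y}$ equals that over the
    unit circle; as the radius shrinks it tends to $F(0)$. *)
Lemma mean_value (F : C -> C) : holo F ->
  cint (uniform_prob two_pi_gt0) (fun t => F (cos t +i* sin t)) = F 0.
Proof.
move=> hF.
pose h (l : C) := F (expC ('i * l + 0)).
have hE x y : h (x +i* y) = F ((expR (- y))%:C * (cos x +i* sin x)).
  by rewrite /h /expC addr0 ReM ImM /= !mul0r !mul1r !add0r.
have hh : holo h.
  move=> z; have [D1 h1] := cder_expC ('i * z + 0).
  have [D2 h2] := hF (expC ('i * z + 0)).
  exists (D2 * (D1 * 'i)).
  apply: (@cder_comp F (fun l => expC ('i * l + 0)) z (D1 * 'i) D2 _ h2).
  exact: (@cder_comp (@expC R) (fun l => 'i * l + 0) z 'i D1 (cder_affine 'i 0 z) h1).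
have shift Y : 0 < Y -> cint (uniform_prob two_pi_gt0) (fun x => h (x +i* 0)) =
    cint (uniform_prob two_pi_gt0) (fun x => h (x +i* Y)).
  move=> Y0; have := goursat_average two_pi_gt0 Y0 hh.
  have -> : (fun y => h (2 * pi +i* y)) = (fun y => h (0 +i* y)).
    have e : 2 * pi = pi *+ 2 :> R by rewrite mulr_natl.
    by apply/funext => y; rewrite !hE cos0 sin0 e cos2pi sin2pi.
  rewrite [X in _ + _ * X]subrr mulr0 addr0 => /eqP; rewrite mulf_eq0 => /orP[|].
    by rewrite subr0 => /eqP /(congr1 (@ReC R)) /= /eqP; rewrite gt_eqF // two_pi_gt0.
  by rewrite subr_eq0 => /eqP.
have -> : (fun t => F (cos t +i* sin t)) = (fun x => h (x +i* 0)).
  by apply/funext => t; rewrite hE oppr0 expR0 mul1r.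
apply/eqP; rewrite -subr_eq0; apply/eqP; apply: eq0_normc.
apply/eqP; rewrite eq_le normc_ge0 andbT.
apply/ler_addgt0Pl => e e0; rewrite addr0.
have [D hD] := hF 0.
have [dl dl0 hdl] := hD 1 ltr01.
have KD : 0 < normc D + 1 by rewrite ltr_wpDl // normc_ge0.
(* The radius $r=e^{-Y}$, with $Y=-\ln r>0$; on this circle $F$ differs from $F(0)$ by at most
   $r(|D|+1)\le e$. *)
pose r := Num.min (Num.min (1 / 2) (dl / 2)) (e / (normc D + 1)).
have r0 : 0 < r by rewrite !lt_min !divr_gt0.
have r1 : r < 1.
  apply: (@le_lt_trans _ _ (1 / 2)); last lra.
  by rewrite !ge_min lexx.
have rdl : r < dl.
  apply: (@le_lt_trans _ _ (dl / 2)); last lra.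
  by rewrite !ge_min lexx !orbT.
have re : r * (normc D + 1) <= e.
  by rewrite -ler_pdivlMr // !ge_min lexx !orbT.
have lr : 0 < - ln r by rewrite oppr_gt0 ln_lt0 // r0 r1.
rewrite (shift _ lr).
have bnd x : normc (h (x +i* - ln r) - F 0) <= e.
  rewrite hE opprK lnK ?posrE //.
  have nw : normc (r%:C * (cos x +i* sin x)) = r.
    by rewrite normcM normcR ger0_norm ?ltW // normcE /= cos2Dsin2 sqrtr1 mulr1.
  have := hdl (r%:C * (cos x +i* sin x)); rewrite nw add0r => /(_ rdl) hw.
  rewrite -[F _ - F 0](subrK (D * (r%:C * (cos x +i* sin x)))).
  apply: le_trans (le_normcD _ _) _; apply: le_trans (lerD hw (lexx _)) _.
  by rewrite normcM nw mul1r; apply: le_trans re; rewrite mulrDr mulr1 addrC [r * _]mulrC.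
have [c1 [c2 _]] := holo_seg_cont (- ln r) hh.
have cF : cintg (uniform_prob two_pi_gt0) (fun x => h (x +i* - ln r)).
  apply: (@cintg_uniform_bounded _ _ _ _ (e + normc (F 0))) => // x.
  rewrite -[h _](subrK (F 0)); apply: le_trans (le_normcD _ _) _.
  by rewrite lerD2r.
have cc : cintg (uniform_prob two_pi_gt0) (fun=> F 0 : C).
  apply: (@cintg_uniform_bounded _ _ _ _ (normc (F 0))) => // x; exact: cst_continuous.
rewrite -[F 0 in leLHS](cint_uniform_cst two_pi_gt0) -cintB //.
have ci := cintgB cF cc.
apply: le_trans (le_normc_cint ci) _.
have -> : e = \int[uniform_prob two_pi_gt0]_x e.
  rewrite -[RHS]/(ReC (cint (uniform_prob two_pi_gt0) (fun=> e%:C))).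
  by rewrite cint_uniform_cst.
apply: le_Rintegral => //; first exact: cintg_norm.
exact: finite_measure_integrable_cst.
Qed.

End mean_value.

                                   

(** * Gaussian integrals with complex quadratic exponents *)

Section gaussian_integrability.
Variable R : realType.

(** Up to a constant this is the density of the centred normal law of variance $1/(2c)$. *)
Lemma gauss1_lty (c : R) : 0 < c ->
  (\int[@lebesgue_measure R]_x (expR (- c * x ^+ 2))%:E < +oo)%E.
Proof.
move=> c0; pose s := Num.sqrt ((2 * c)^-1).
have s2 : s ^+ 2 = (2 * c)^-1 by rewrite sqr_sqrtr // invr_ge0 mulr_ge0 // ltW.
have s0 : s != 0 by rewrite sqrtr_eq0 -ltNge invr_gt0 mulr_gt0.
have ip := @integrable_normal_pdf R 0 s.
have p0 : 0 < normal_peak s by rewrite normal_peak_gt0.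
have /(integrableZl measurableT (normal_peak s)^-1) ip' := ip.
have := ip'; move=> /integrableP[_]; apply: le_lt_trans.
rewrite le_eqVlt; apply/orP; left; apply/eqP; apply: eq_integral => x _.
have -> : normal_pdf 0 s x = normal_peak s * normal_fun 0 s x.
  by rewrite normal_pdfE.
rewrite /= /normal_fun subr0 s2.
rewrite mulKf ?gt_eqF //; congr (_%:E).
rewrite ger0_norm ?expR_ge0 //; congr expR.
have -> : (2 * c)^-1 *+ 2 = c^-1 by rewrite -mulr_natl; field; rewrite gt_eqF.
by rewrite invrK mulNr mulrC mulNr.
Qed.

Definition tsq m (t : m.-tuple R) : R := \sum_(i < m) tnth t i ^+ 2.

Lemma tsq_ge0 m (t : m.-tuple R) : 0 <= tsq t.
Proof. by apply: sumr_ge0 => i _; exact: sqr_ge0. Qed.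

Lemma measurable_tsum m (F : 'I_m -> R -> R) : (forall i, measurable_fun setT (F i)) ->
  measurable_fun setT (fun t : m.-tuple R => \sum_(i < m) F i (tnth t i)).
Proof.
move=> mF; apply: measurable_sum => i.
exact: (measurableT_comp (mF i) (measurable_tnth i)).
Qed.

Lemma measurable_tgauss m (c : R) :
  measurable_fun setT (fun t : m.-tuple R => expR (- c * tsq t)).
Proof.
apply: (measurableT_comp (@measurable_expR R)).
apply: measurable_funM; first exact: measurable_cst.
apply: (@measurable_tsum m (fun _ x => x ^+ 2)) => i.
exact: (measurable_funX 2 (@measurable_id _ _ _)).
Qed.

Lemma tgauss_lty m (c : R) : 0 < c ->
  (\int[@leb R m]_t (expR (- c * tsq t))%:E < +oo)%E.
Proof.
move=> c0; elim: m => [|m IH].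
  rewrite leb0_integral ?ltry //.
  by apply/measurable_EFinP; exact: measurable_tgauss.
rewrite lebS_integral; last 2 first.
- by apply/measurable_EFinP; exact: measurable_tgauss.
- by move=> t; rewrite lee_fin expR_ge0.
have fin1 := gauss1_lty c0.
have g1 : (0 <= \int[@lebesgue_measure R]_x (expR (- c * x ^+ 2))%:E)%E.
  by apply: integral_ge0 => x _; rewrite lee_fin expR_ge0.
have m1 : measurable_fun setT (fun x : R => (expR (- c * x ^+ 2))%:E).
  apply/measurable_EFinP; apply: (measurableT_comp (@measurable_expR R)).
  apply: measurable_funM; first exact: measurable_cst.
  exact: (measurable_funX 2 (@measurable_id _ _ _)).
under eq_integral => t _.
  under eq_integral => x _.
    have -> : expR (- c * tsq (tcons (t, x))) = expR (- c * tsq t) * expR (- c * x ^+ 2).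
      rewrite -expRD -mulrDr /tsq big_ord_recl (tnth_nth 0) /= addrC.
      have E : \sum_(i < m) tnth (tcons (t, x)) (lift ord0 i) ^+ 2 = \sum_(i < m) tnth t i ^+ 2.
        by apply: eq_bigr => i _; rewrite !(tnth_nth 0).
      by rewrite E.
    rewrite EFinM; over.
  have -> : (\int[@lebesgue_measure R]_x ((expR (- c * tsq t))%:E * (expR (- c * x ^+ 2))%:E) =
    (expR (- c * tsq t))%:E * \int[@lebesgue_measure R]_x (expR (- c * x ^+ 2))%:E)%E.
    by apply: ge0_integralZl.
  over.
rewrite ge0_integralZr //; first by rewrite lte_mul_pinfty // ?ge0_fin_numE //;
  apply: integral_ge0 => x _; rewrite lee_fin expR_ge0.
by apply/measurable_EFinP; exact: measurable_tgauss.
Qed.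

Lemma integrable_tgauss m (c K : R) : 0 < c ->
  (@leb R m).-integrable setT (fun t => (K * expR (- c * tsq t))%:E).
Proof.
move=> c0; have h : (@leb R m).-integrable setT (fun t => (expR (- c * tsq t))%:E).
  apply/ge0_integrableP; first by move=> t; exact: expR_ge0.
  by split; [exact: measurable_tgauss|exact: tgauss_lty].
by have := integrableZl measurableT K h; apply: eq_integrable.
Qed.

(** Complete the square in each coordinate. *)
Lemma linear_le_tsq m (c L : R) (t : m.-tuple R) : 0 < c ->
  L * \sum_(i < m) `|tnth t i| - c * tsq t <=
  m%:R * (L ^+ 2 / (2 * c)) - c / 2 * tsq t.
Proof.
move=> c0; rewrite /tsq !mulr_sumr -sumrB.
have -> : m%:R * (L ^+ 2 / (2 * c)) = \sum_(i < m) (L ^+ 2 / (2 * c)).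
  by rewrite sumr_const card_ord mulr_natl.
rewrite -sumrB; apply: ler_sum => i _.
have -> : tnth t i ^+ 2 = `|tnth t i| ^+ 2 by rewrite real_normK // num_real.
set x := `|_|; rewrite -subr_ge0.
have -> : L ^+ 2 / (2 * c) - c / 2 * x ^+ 2 - (L * x - c * x ^+ 2) =
  (L - c * x) ^+ 2 / (2 * c) by field; rewrite gt_eqF.
by rewrite divr_ge0 ?sqr_ge0 // mulr_ge0 // ltW.
Qed.

Definition qf m (A : 'M[R]_m) (t : m.-tuple R) : R :=
  \sum_(i < m) \sum_(j < m) A i j * tnth t i * tnth t j.

Definition tpos m (A : 'M[R]_m) :=
  forall t : m.-tuple R, (exists i, tnth t i != 0) -> 0 < qf A t.

Lemma continuous_sumr (T : topologicalType) I (s : seq I) (F : I -> T -> R) :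
  (forall i, continuous (F i)) -> continuous (fun x => \sum_(i <- s) F i x).
Proof.
move=> cF; elim: s => [|i s IH] x.
  by under eq_fun do rewrite big_nil; exact: cst_continuous.
under eq_fun do rewrite big_cons.
by apply: (@continuousD _ _ _ (F i) (fun x => \sum_(j <- s) F j x)); [exact: cF|exact: IH].
Qed.

(** The minimum on the compact unit sphere serves as the constant, by homogeneity. *)
Lemma qf_lower m (A : 'M[R]_m) : tpos A ->
  exists2 c, 0 < c & forall t, c * tsq t <= qf A t.
Proof.
move=> Apos.
pose tv (x : 'rV[R]_m) : m.-tuple R := [tuple x 0 i | i < m].
have tvE x i : tnth (tv x) i = x 0 i by rewrite tnth_mktuple.
pose S := [set x : 'rV[R]_m | tsq (tv x) = 1].
have cc i : continuous (fun x : 'rV[R]_m => tnth (tv x) i).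
  by under eq_fun do rewrite tvE; exact: coord_continuous.
have csq : continuous (fun x : 'rV[R]_m => tsq (tv x)).
  apply: (@continuous_sumr _ _ _ (fun i (x : 'rV[R]_m) => tnth (tv x) i ^+ 2)) => i x.
  have -> : (fun x : 'rV[R]_m => tnth (tv x) i ^+ 2) = (fun x => tnth (tv x) i * tnth (tv x) i).
    by apply/funext => y; rewrite expr2.
  by apply: (@continuousM _ _ (fun x => tnth (tv x) i) (fun x => tnth (tv x) i)); exact: cc.
have cqf : continuous (fun x : 'rV[R]_m => qf A (tv x)).
  apply: (@continuous_sumr _ _ _ (fun i (x : 'rV[R]_m) => \sum_(j < m) A i j * tnth (tv x) i * tnth (tv x) j)) => i.
  apply: (@continuous_sumr _ _ _ (fun j (x : 'rV[R]_m) => A i j * tnth (tv x) i * tnth (tv x) j)) => j x.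
  apply: (@continuousM _ _ (fun x => A i j * tnth (tv x) i) (fun x => tnth (tv x) j)); last exact: cc.
  by apply: (@continuousM _ _ (fun=> A i j) (fun x => tnth (tv x) i)); [exact: cst_continuous|exact: cc].
have Scompact : compact S.
  apply: bounded_closed_compact.
    exists 1; split; first exact: num_real.
    move=> M M1 x Sx; apply: (le_trans _ (ltW M1)).
    rewrite [leLHS]mx_normrE; apply/bigmax_leP; split => // -[i j] _ /=.
    rewrite ord1 -(@ler_pXn2r _ 2) ?nnegrE // expr1n real_normK ?num_real //.
    by rewrite -Sx /tsq (bigD1 j) //= tvE lerDl sumr_ge0 // => k _; exact: sqr_ge0.
  have -> : S = (fun x => tsq (tv x)) @^-1` [set 1] by [].
  by apply: closed_comp; [move=> x _; exact: csq|exact: closed_eq].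
have scale (a : R) (t : m.-tuple R) : qf A [tuple a * tnth t i | i < m] = a ^+ 2 * qf A t.
  rewrite /qf mulr_sumr; apply: eq_bigr => i _; rewrite mulr_sumr; apply: eq_bigr => j _.
  by rewrite !tnth_mktuple; ring.
have scale2 (a : R) (t : m.-tuple R) : tsq [tuple a * tnth t i | i < m] = a ^+ 2 * tsq t.
  by rewrite /tsq mulr_sumr; apply: eq_bigr => i _; rewrite tnth_mktuple exprMn.
have norm1 (t : m.-tuple R) : 0 < tsq t -> exists a, a ^+ 2 * tsq t = 1.
  move=> t0; exists (Num.sqrt (tsq t))^-1; rewrite exprVn sqr_sqrtr ?ltW //.
  by rewrite mulVf // gt_eqF.
(* An empty sphere means that every [t] is zero, and any constant will do. *)
have [S0|S0] := pselect (S !=set0); last first.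
  exists 1 => // t.
  have [t0|] := ltP 0 (tsq t).
    exfalso; apply: S0; have [a ha] := norm1 t t0.
    exists (\row_i (a * tnth t i)) => /=.
    rewrite /S /= -ha -scale2; congr tsq; apply: eq_from_tnth => i.
    by rewrite tvE tnth_mktuple mxE.
  move=> tle; have t0 : tsq t = 0 by apply/eqP; rewrite eq_le tle tsq_ge0.
  have ti i : tnth t i = 0.
    apply/eqP; rewrite -sqrf_eq0; apply/eqP.
    have /psumr_eq0P : \sum_(i < m) tnth t i ^+ 2 = 0 by exact: t0.
    by move=> h; apply: h => // k _; exact: sqr_ge0.
  rewrite t0 mulr0 /qf big1 // => i _; rewrite big1 // => j _.
  by rewrite !ti !mulr0.
have [x0 Sx0 hx0] := EVT_min_rV S0 Scompact (continuous_subspaceT cqf).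
have Sx : tsq (tv x0) = 1 by move: Sx0; rewrite inE.
exists (qf A (tv x0)).
  apply: Apos; apply: contrapT => hn.
  have : tsq (tv x0) = 0.
    rewrite /tsq big1 // => i _; apply/eqP; rewrite sqrf_eq0; apply/negPn/negP => hi.
    by apply: hn; exists i.
  by rewrite Sx => /eqP; rewrite oner_eq0.
move=> t; have [t0|] := ltP 0 (tsq t); last first.
  move=> tle; have t0 : tsq t = 0 by apply/eqP; rewrite eq_le tle tsq_ge0.
  have ti i : tnth t i = 0.
    apply/eqP; rewrite -sqrf_eq0; apply/eqP.
    have /psumr_eq0P : \sum_(i < m) tnth t i ^+ 2 = 0 by exact: t0.
    by move=> h; apply: h => // k _; exact: sqr_ge0.
  rewrite t0 mulr0 /qf big1 // => i _; rewrite big1 // => j _.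
  by rewrite !ti !mulr0.
have [a ha] := norm1 t t0.
have a0 : 0 < a ^+ 2.
  rewrite lt_def sqr_ge0 andbT; apply/eqP => a0.
  by move: ha; rewrite a0 mul0r => /eqP; rewrite eq_sym oner_eq0.
have := hx0 (\row_i (a * tnth t i)).
have -> : tv (\row_i (a * tnth t i)) = [tuple a * tnth t i | i < m].
  by apply: eq_from_tnth => i; rewrite tvE tnth_mktuple mxE.
rewrite scale => h.
rewrite -(ler_pM2l a0) mulrCA ha mulr1; apply: h.
rewrite inE /S /= -ha -scale2; congr tsq; apply: eq_from_tnth => i.
by rewrite tvE tnth_mktuple mxE.
Qed.

End gaussian_integrability.

Section bilinear.
Variables (R : realType) (m : nat).
Local Notation C := R[i].
Implicit Types (M N : 'M[C]_m) (x y z : 'cV[C]_m) (t s : m.-tuple R).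

Definition bil M x y : C := (x^T *m M *m y) 0 0.

Lemma bilE M x y : bil M x y = \sum_i \sum_j M i j * x i 0 * y j 0.
Proof.
rewrite /bil !mxE exchange_big; apply: eq_bigr => j _ /=.
rewrite !mxE mulr_suml; apply: eq_bigr => i _.
by rewrite !mxE; ring.
Qed.

Lemma bilDl M x y z : bil M (x + y) z = bil M x z + bil M y z.
Proof. by rewrite /bil linearD /= !mulmxDl mxE. Qed.

Lemma bilDr M x y z : bil M x (y + z) = bil M x y + bil M x z.
Proof. by rewrite /bil mulmxDr mxE. Qed.

Lemma bilZl M (a : C) x y : bil M (a *: x) y = a * bil M x y.
Proof. by rewrite /bil linearZ /= -!scalemxAl mxE. Qed.

Lemma bilZr M (a : C) x y : bil M x (a *: y) = a * bil M x y.
Proof. by rewrite /bil -scalemxAr mxE. Qed.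

Lemma bilNl M x y : bil M (- x) y = - bil M x y.
Proof. by rewrite -scaleN1r bilZl mulN1r. Qed.

Lemma bilNr M x y : bil M x (- y) = - bil M x y.
Proof. by rewrite -scaleN1r bilZr mulN1r. Qed.

Lemma bilC M x y : M^T = M -> bil M x y = bil M y x.
Proof.
move=> sM; rewrite !bilE exchange_big; apply: eq_bigr => i _; apply: eq_bigr => j _.
by rewrite -{1}sM mxE; ring.
Qed.

Lemma bilDm M N x y : bil (M + N) x y = bil M x y + bil N x y.
Proof. by rewrite /bil mulmxDr mulmxDl mxE. Qed.

Lemma bilZm (a : C) M x y : bil (a *: M) x y = a * bil M x y.
Proof. by rewrite /bil -scalemxAr -scalemxAl mxE. Qed.

Lemma bilNm M x y : bil (- M) x y = - bil M x y.
Proof. by rewrite -scaleN1r bilZm mulN1r. Qed.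

Lemma bil0l M x : bil M 0 x = 0.
Proof. by rewrite /bil trmx0 !mul0mx mxE. Qed.

Lemma bil0r M x : bil M x 0 = 0.
Proof. by rewrite /bil mulmx0 mxE. Qed.

Lemma bil_mulr M N x y : bil M x (N *m y) = bil (M *m N) x y.
Proof. by rewrite /bil !mulmxA. Qed.

Definition cv t : 'cV[C]_m := \col_i (tnth t i)%:C.
Definition ret x : m.-tuple R := [tuple ReC (x i 0) | i < m].
Definition imt x : m.-tuple R := [tuple ImC (x i 0) | i < m].
Definition tadd s t : m.-tuple R := tshift (tnth s) t.
Definition tscale (a : R) t : m.-tuple R := [tuple a * tnth t i | i < m].

Lemma cvD s t : cv (tadd s t) = cv t + cv s.
Proof. by apply/matrixP => i j; rewrite !mxE tnth_mktuple rmorphD. Qed.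

Lemma cvZ a t : cv (tscale a t) = a%:C *: cv t.
Proof. by apply/matrixP => i j; rewrite !mxE tnth_mktuple rmorphM. Qed.

Lemma cv_reim x : x = cv (ret x) + 'i *: cv (imt x).
Proof.
apply/matrixP => i j; rewrite !mxE !tnth_mktuple ord1.
exact: complexE.
Qed.

Lemma conj_cv t : map_mx conjc (cv t) = cv t.
Proof. by apply/matrixP => i j; rewrite !mxE; apply: complexP => /=; rewrite ?oppr0. Qed.

Lemma bil_conj M x y : (bil M x y)^*%C = bil (map_mx conjc M) (map_mx conjc x) (map_mx conjc y).
Proof.
rewrite !bilE rmorph_sum; apply: eq_bigr => i _.
rewrite rmorph_sum; apply: eq_bigr => j _.
by rewrite !mxE !rmorphM.
Qed.

Definition remx M : 'M[R]_m := map_mx (@ReC R) M.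

Lemma Re_sum I (s : seq I) (F : I -> C) : ReC (\sum_(i <- s) F i) = \sum_(i <- s) ReC (F i).
Proof. by elim: s => [|i s IH]; rewrite ?big_nil ?big_cons ?ReD ?IH. Qed.

Lemma Re_bil_cv M t : ReC (bil M (cv t) (cv t)) = qf (remx M) t.
Proof.
rewrite bilE /qf Re_sum; apply: eq_bigr => i _; rewrite Re_sum; apply: eq_bigr => j _.
by rewrite !mxE !ReMC.
Qed.

Lemma cmeas_cv (d : measure_display) (T : measurableType d) (f : T -> m.-tuple R) i :
  measurable_fun setT f -> cmeas (fun w => cv (f w) i 0).
Proof.
move=> mf; under eq_fun do rewrite mxE; apply: cmeasR.
exact: (measurableT_comp (measurable_tnth i) mf).
Qed.

Lemma cmeas_bil (d : measure_display) (T : measurableType d) M (f g : T -> 'cV[C]_m) :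
  (forall i, cmeas (fun w => f w i 0)) -> (forall i, cmeas (fun w => g w i 0)) ->
  cmeas (fun w => bil M (f w) (g w)).
Proof.
move=> mf mg; under eq_fun do rewrite bilE.
apply: (@cmeas_sum _ _ _ _ _ (fun i w => \sum_j M i j * f w i 0 * g w j 0)) => i.
apply: (@cmeas_sum _ _ _ _ _ (fun j w => M i j * f w i 0 * g w j 0)) => j.
by apply: cmeasM => //; apply: cmeasM => //; exact: cmeas_cst.
Qed.

Lemma bil_linear_bound M z : exists L, 0 <= L /\
  forall t, normc (bil M z (cv t)) <= L * \sum_(i < m) `|tnth t i|.
Proof.
pose L := \sum_i \sum_j normc (M i j * z i 0).
have L0 : 0 <= L by apply: sumr_ge0 => i _; apply: sumr_ge0 => j _; exact: normc_ge0.
exists L; split => // t; rewrite bilE.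
have nsum I (s : seq I) (F : I -> C) : normc (\sum_(i <- s) F i) <= \sum_(i <- s) normc (F i).
  elim: s => [|i s IH]; first by rewrite !big_nil normc0.
  by rewrite !big_cons; apply: le_trans (le_normcD _ _) _; rewrite lerD2l.
apply: le_trans (nsum _ _ _) _; rewrite /L mulr_suml; apply: ler_sum => i _.
apply: le_trans (nsum _ _ _) _; rewrite mulr_suml; apply: ler_sum => j _.
rewrite normcM ler_wpM2l ?normc_ge0 // mxE normcR (bigD1 j) //= lerDl.
by apply: sumr_ge0 => k _; exact: normr_ge0.
Qed.

End bilinear.

Lemma eq_cint d (T : measurableType d) (R : realType) (mu : {measure set T -> \bar R})
    (f g : T -> R[i]) : f =1 g -> cint mu f = cint mu g.
Proof. by move=> /funext ->. Qed.

Lemma cint0 d (T : measurableType d) (R : realType) (mu : {measure set T -> \bar R}) :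
  cint mu (fun=> 0) = 0.
Proof. by apply: complexP; rewrite /cint /= /Rintegral integral0. Qed.

Lemma cint_comb d (T : measurableType d) (R : realType) (mu : {measure set T -> \bar R})
    (k : R[i]) (f1 f2 f3 f4 : T -> R[i]) :
  cintg mu f1 -> cintg mu f2 -> cintg mu f3 -> cintg mu f4 ->
  cint mu (fun t => f1 t - f2 t + k * (f3 t - f4 t)) =
  cint mu f1 - cint mu f2 + k * (cint mu f3 - cint mu f4).
Proof.
move=> i1 i2 i3 i4.
rewrite -(cintB i1 i2) -(cintB i3 i4) -(cintZ k (cintgB i3 i4)).
exact: (cintD (cintgB i1 i2) (cintgM k (cintgB i3 i4))).
Qed.

Section gaussian_shift.
Variables (R : realType) (m : nat).
Local Notation C := R[i].
Implicit Types (y : 'cV[C]_m) (t s : m.-tuple R).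
Variable M : 'M[C]_m.
Hypothesis Mpos : tpos (remx M).

(** One Gaussian dominates all shifts $zx$ with $|z|\le2$, a disc containing the unit square used in
    [gauss_shift]. The cross terms grow linearly in [t] and are absorbed by half of the quadratic
    form. *)
Lemma gauss_bound (x : 'cV[C]_m) : exists K c, 0 < c /\ forall (z : C) t, normc z <= 2 ->
  normc (expC (- bil M (cv t + z *: x) (cv t + z *: x))) <= K * expR (- c * tsq t).
Proof.
have [c c0 hc] := qf_lower Mpos.
have [L1 [L10 hL1]] := bil_linear_bound M x.
have [L2 [L20 hL2]] := bil_linear_bound (M^T) x.
pose L := 2 * (L1 + L2); pose B := 4 * normc (bil M x x).
exists (expR (m%:R * (L ^+ 2 / (2 * c)) + B)), (c / 2); split; first by rewrite divr_gt0.
move=> z t z2; rewrite normc_expC -expRD ler_expR ReN.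
rewrite bilDl !bilDr !bilZl !bilZr.
have -> : bil M (cv t) x = bil M^T x (cv t).
  rewrite !bilE exchange_big; apply: eq_bigr => i _; apply: eq_bigr => j _.
  by rewrite [M^T i j]mxE; ring.
rewrite !ReD Re_bil_cv.
set S := \sum_(i < m) `|tnth t i|.
have S0 : 0 <= S by apply: sumr_ge0 => i _; exact: normr_ge0.
have e1 : - (2 * (L2 * S)) <= ReC (z * bil M^T x (cv t)).
  rewrite lerNl; apply: le_trans (ler_norm _) _; rewrite normrN.
  apply: le_trans (normc_Re _) _; rewrite normcM; apply: ler_pM; rewrite ?normc_ge0 //.
have e2 : - (2 * (L1 * S)) <= ReC (z * bil M x (cv t)).
  rewrite lerNl; apply: le_trans (ler_norm _) _; rewrite normrN.
  apply: le_trans (normc_Re _) _; rewrite normcM; apply: ler_pM; rewrite ?normc_ge0 //.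
have e3 : - B <= ReC (z * (z * bil M x x)).
  rewrite lerNl; apply: le_trans (ler_norm _) _; rewrite normrN.
  apply: le_trans (normc_Re _) _; rewrite !normcM mulrA /B.
  apply: ler_wpM2r; first exact: normc_ge0.
  have -> : 4 = 2 * 2 :> R by ring.
  by apply: ler_pM; rewrite ?normc_ge0.
have e4 := hc t; have e5 := linear_le_tsq L t c0; rewrite -/S in e5.
have e6 : L * S = 2 * (L1 * S) + 2 * (L2 * S) by rewrite /L; ring.
rewrite e6 in e5; lra.
Qed.

Lemma cder_quadratic (a b k z : C) : cder (fun w => a + b * w + k * w * w) z (b + 2 * k * z).
Proof.
move=> e e0; have k0 : 0 < normc k + 1 by rewrite ltr_wpDl // normc_ge0.
exists (e / (normc k + 1)); first by rewrite divr_gt0.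
move=> w hw.
have -> : a + b * (z + w) + k * (z + w) * (z + w) - (a + b * z + k * z * z) -
  (b + 2 * k * z) * w = k * w * w by ring.
rewrite !normcM; apply: ler_wpM2r; first exact: normc_ge0.
move: hw; rewrite ltr_pdivlMr // => /ltW; apply: le_trans.
by rewrite mulrDr mulr1 mulrC lerDl normc_ge0.
Qed.

Lemma holo_gauss (x : 'cV[C]_m) y : holo (fun z : C => expC (- bil M (y + z *: x) (y + z *: x))).
Proof.
move=> z; pose G w := - bil M y y + - (bil M y x + bil M x y) * w + - bil M x x * w * w.
have GE w : G w = - bil M (y + w *: x) (y + w *: x).
  by rewrite bilDl !bilDr !bilZl !bilZr /G; ring.
have -> : (fun w : C => expC (- bil M (y + w *: x) (y + w *: x))) = (fun w => expC (G w)).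
  by apply/funext => w; rewrite GE.
have [D hD] := cder_expC (G z).
eexists; apply: (@cder_comp _ (@expC R) G z _ D _ hD).
exact: cder_quadratic.
Qed.

Lemma uniform_le (a b K : R) (ab : a < b) (g : R -> R) : measurable_fun setT g ->
  (forall r, 0 <= g r) -> (forall r, a <= r <= b -> g r <= K) ->
  (\int[uniform_prob ab]_r (g r)%:E <= K%:E)%E.
Proof.
move=> mg g0 gK; have ab0 : 0 < b - a by rewrite subr_gt0.
have mg' : measurable_fun [set: measurableTypeR R] (EFin \o g) by exact/measurable_EFinP.
rewrite (integral_uniform ab mg' (fun r => g0 r)).
have mI : measurable (`[a, b]%classic : set (measurableTypeR R)) by exact: measurable_itv.
have K0 : 0 <= K by apply: le_trans (g0 a) (gK a _); rewrite lexx ltW.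
have : (\int[@lebesgue_measure R]_(r in `[a, b]) (EFin \o g) r <=
        \int[@lebesgue_measure R]_(r in `[a, b]) (K%:E))%E.
  apply: ge0_le_integral => //=.
  - by move=> x _; rewrite lee_fin.
  - exact: measurable_funTS.
rewrite integral_cst //; have := lebesgue_measure_itv `[a, b]; rewrite /= lte_fin ab => ->.
move=> h; apply: (@le_trans _ _ (((b - a)^-1)%:E * (K%:E * (b%:E - a%:E)))%E).
  by apply: lee_wpmul2l => //; rewrite lee_fin invr_ge0 ltW.
rewrite -EFinB -!EFinM lee_fin le_eqVlt; apply/orP; left; apply/eqP; field.
by rewrite gt_eqF.
Qed.

Lemma cmeas_gauss y : cmeas (fun t => expC (- bil M (cv t + y) (cv t + y))).
Proof.
apply: cmeas_expC; apply: cmeasN.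
by apply: cmeas_bil => i; under eq_fun do rewrite mxE; apply: cmeasD;
  (try exact: cmeas_cst); apply: cmeas_cv; exact: measurable_id.
Qed.

Lemma cintg_gauss y : cintg (@leb R m) (fun t => expC (- bil M (cv t + y) (cv t + y))).
Proof.
have [K [c [c0 h]]] := gauss_bound y.
apply: (@cintg_le _ _ _ _ _ (fun t => K * expR (- c * tsq t))).
- exact: cmeas_gauss.
- move=> t; have := h 1 t; rewrite scale1r; apply.
  by rewrite normc1 ler1n.
- exact: integrable_tgauss.
Qed.

                                                                          
                                                                              
(** Let $J(y)$ be the integral shifted by $y$. Real shifts leave $J$ unchanged by translation
    invariance. For an imaginary shift $is$, the Goursat identity for $z\mapsto e^{-M(t+zs,t+zs)}$
    on the unit square is integrated over $t$: the two vertical sides differ by a real shift and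
    cancel, and the horizontal sides become $J(0)$ and $J(is)$. *)
Lemma gauss_shift y :
  cint (@leb R m) (fun t => expC (- bil M (cv t + y) (cv t + y))) =
  cint (@leb R m) (fun t => expC (- bil M (cv t) (cv t))).
Proof.
pose J y := cint (@leb R m) (fun t => expC (- bil M (cv t + y) (cv t + y))).
have Jreal s (z : 'cV[C]_m) : J (z + cv s) = J z.
  rewrite /J -[RHS](@preserves_cint _ _ _ (@leb R m) (tadd s)).
  - by apply: eq_cint => t; rewrite cvD -!addrA [cv s + z]addrC.
  - exact: preserves_tshift.
  - exact: cmeas_gauss.
transitivity (J 0); last by apply: eq_cint => t; rewrite addr0.
suff Jim s : J ('i *: cv s) = J 0.
  by rewrite -/(J y) [y]cv_reim addrC Jreal Jim.
have JE z : cint (@leb R m) (fun t => expC (- bil M (cv t + z) (cv t + z))) = J z by [].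
clearbody J.
pose F t (z : C) := expC (- bil M (cv t + z *: cv s) (cv t + z *: cv s)).
have Jz (a b : R) : J ((a +i* b) *: cv s) = J ((0 +i* b) *: cv s).
  have -> : (a +i* b) *: cv s = (0 +i* b) *: cv s + cv (tscale a s).
    rewrite cvZ -scalerDl; congr (_ *: _); apply: complexP; rewrite ?ReD ?ImD /= ?add0r ?addr0 //.
  exact: Jreal.
have [K [c [c0 hK]]] := gauss_bound (cv s).
pose U := uniform_prob (@ltr01 R).
(* For one side [g] of the square: averaging over the side and integrating over [t] commute. *)
have seg (g : R -> C) : (forall x, 0 <= x <= 1 -> normc (g x) <= 2) ->
    (measurable_fun setT (fun x => ReC (g x))) -> (measurable_fun setT (fun x => ImC (g x))) ->
    exists2 A : m.-tuple R -> C, (forall t, A t = cint U (fun x => F t (g x))) &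
    cintg (@leb R m) A /\ cint (@leb R m) A = cint U (fun x => J (g x *: cv s)).
  move=> g2 mg1 mg2; exists (fun t => cint U (fun x => F t (g x))) => //.
  have mF : cmeas (fun p : m.-tuple R * measurableTypeR R => F p.1 (g p.2)).
    apply: cmeas_expC; apply: cmeasN.
    have mcol i : cmeas (fun p : m.-tuple R * measurableTypeR R =>
        (cv p.1 + g p.2 *: cv s) i 0).
      under eq_fun do rewrite mxE; apply: cmeasD.
        by apply: cmeas_cv; exact: measurable_fst.
      under eq_fun do rewrite mxE; apply: cmeasM; last exact: cmeas_cst.
      by apply: (@cmeas_comp _ _ _ _ _ g snd) => //; exact: measurable_snd.
    exact: cmeas_bil.
  have fin : (\int[@leb R m]_t \int[U]_x (normc (F t (g x)))%:E < +oo)%E.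
    have /ge0_integrableP := @integrable_tgauss R m c `|K| c0.
    move=> [|mk kfin]; first by move=> t; rewrite mulr_ge0 ?expR_ge0.
    apply: le_lt_trans kfin; apply: ge0_le_integral => //.
    - by move=> t _; apply: integral_ge0 => x _; rewrite lee_fin normc_ge0.
    - apply: (@measurable_fun_fubini_tonelli_F _ _ _ _ _ U
        (fun p => (normc (F p.1 (g p.2)))%:E)).
        by apply/measurable_EFinP; exact: measurable_normc mF.
      by move=> p; rewrite lee_fin normc_ge0.
    - exact/measurable_EFinP.
    - move=> t _; apply: uniform_le.
      + have := measurable_normc mF.
        by move=> h; exact: (measurable_fun_pair2 t h).
      + by move=> x; exact: normc_ge0.
      + move=> x x01; apply: le_trans (hK _ _ (g2 x x01)) _.
        by rewrite ler_wpM2r ?expR_ge0 // ler_norm.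
  split; first exact: (@cintg_iterated _ _ _ _ _ (@leb R m) U (fun p => F p.1 (g p.2))).
  rewrite (@cfubini _ _ _ _ _ (@leb R m) U (fun p => F p.1 (g p.2)) mF fin).
  by apply: eq_cint => x; exact: (JE (g x *: cv s)).
have n2 (a b : R) : 0 <= a <= 1 -> 0 <= b <= 1 -> normc (a +i* b) <= 2.
  move=> /andP[a0 a1] /andP[b0 b1]; apply: le_trans (normc_iRe _ _) _.
  by rewrite !ger0_norm //; lra.
have o01 : 0 <= (0 : R) <= 1 by rewrite lexx ler01.
have o11 : 0 <= (1 : R) <= 1 by rewrite lexx ler01.
have mc (r : R) : measurable_fun (setT : set (measurableTypeR R)) (fun=> r) by exact: measurable_cst.
have mi : measurable_fun (setT : set (measurableTypeR R)) (fun x => x : R) by exact: measurable_id.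
have [A1 e1 [i1 s1]] := seg (fun x => x +i* 0) (fun x h => n2 x 0 h o01) mi (mc 0).
have [A2 e2 [i2 s2]] := seg (fun x => x +i* 1) (fun x h => n2 x 1 h o11) mi (mc 1).
have [A3 e3 [i3 s3]] := seg (fun x => 1 +i* x) (fun x h => n2 1 x o11 h) (mc 1) mi.
have [A4 e4 [i4 s4]] := seg (fun x => 0 +i* x) (fun x h => n2 0 x o01 h) (mc 0) mi.
have G t := goursat_average (@ltr01 R) (@ltr01 R) (holo_gauss (cv s) (cv t)).
have : cint (@leb R m) (fun t => A1 t - A2 t + 'i * (A3 t - A4 t)) = 0.
  rewrite -[RHS](cint0 (@leb R m)); apply: eq_cint => t.
  by rewrite e1 e2 e3 e4 -[RHS](G t) /F subr0 mul1r mulr1.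
rewrite (cint_comb 'i i1 i2 i3 i4) s1 s2 s3 s4.
have {}s1 : cint U (fun x => J ((x +i* 0) *: cv s)) = J 0.
  rewrite -[RHS](cint_uniform_cst (@ltr01 R)); apply: eq_cint => x.
  by rewrite Jz -[0 +i* 0]/(0 : C) scale0r.
have {}s2 : cint U (fun x => J ((x +i* 1) *: cv s)) = J ('i *: cv s).
  rewrite -[RHS](cint_uniform_cst (@ltr01 R)); apply: eq_cint => x.
  by rewrite Jz.
have {}s3 : cint U (fun x => J ((1 +i* x) *: cv s)) = cint U (fun x => J ((0 +i* x) *: cv s)).
  by apply: eq_cint => x; rewrite Jz.
rewrite s1 s2 s3 subrr mulr0 addr0 => /eqP.
by rewrite subr_eq0 => /eqP ->.
Qed.

End gaussian_shift.

Lemma eq_cintg d (T : measurableType d) (R : realType) (mu : {measure set T -> \bar R})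
    (f g : T -> R[i]) : f =1 g -> cintg mu f -> cintg mu g.
Proof. by move=> /funext ->. Qed.

Section gaussian_formula.
Variables (R : realType) (m : nat).
Local Notation C := R[i].
Implicit Types (M : 'M[C]_m) (p r u : 'cV[C]_m) (s t : m.-tuple R).

(** Kept as an unevaluated constant; the arguments below only distinguish whether it vanishes. *)
Definition gauss0 M : C := cint (@leb R m) (fun t => expC (- bil M (cv t) (cv t))).

(** Completing the square turns the linear term into the complex shift by [- u]. *)
Lemma gauss_formula M u : M^T = M -> tpos (remx M) ->
  cint (@leb R m) (fun t => expC (- bil M (cv t) (cv t) + 2 * bil M u (cv t))) =
  expC (bil M u u) * gauss0 M.
Proof.
move=> sM pM; rewrite /gauss0 -(gauss_shift pM (- u)) -cintZ; last exact: cintg_gauss.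
apply: eq_cint => t; rewrite -expCD; congr expC.
by rewrite bilDl !bilDr !bilNl !bilNr (bilC (cv t) u sM); ring.
Qed.

Lemma cintg_formula M u : M^T = M -> tpos (remx M) ->
  cintg (@leb R m) (fun t => expC (- bil M (cv t) (cv t) + 2 * bil M u (cv t))).
Proof.
move=> sM pM; have := cintgM (expC (bil M u u)) (cintg_gauss pM (- u)).
apply: eq_cintg => t; rewrite -expCD; congr expC.
by rewrite bilDl !bilDr !bilNl !bilNr (bilC (cv t) u sM); ring.
Qed.

Definition cj p : 'cV[C]_m := map_mx conjc p.

Lemma cjD p r : cj (p + r) = cj p + cj r.
Proof. by rewrite /cj map_mxD. Qed.

Lemma cjZ (a : C) p : cj (a *: p) = a^*%C *: cj p.
Proof. by rewrite /cj map_mxZ. Qed.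

Lemma cjN p : cj (- p) = - cj p.
Proof. by rewrite /cj map_mxN. Qed.

Lemma cjK p : cj (cj p) = p.
Proof. by apply/matrixP => i j; rewrite !mxE conjcK. Qed.

Lemma cj_cv t : cj (cv t) = cv t.
Proof. exact: conj_cv. Qed.

Lemma Re_bil_cj M p : M^T = M ->
  ReC (bil M (cj p) p) = qf (remx M) (ret p) + qf (remx M) (imt p).
Proof.
move=> sM; rewrite -!Re_bil_cv -ReD; congr ReC.
rewrite {1 2}[p]cv_reim cjD cjZ !cj_cv bilDl !bilDr !bilZl !bilZr.
rewrite (bilC (cv (imt p)) (cv (ret p)) sM).
move: (bil M (cv (ret p)) (cv (ret p))) (bil M (cv (ret p)) (cv (imt p))).
move: (bil M (cv (imt p)) (cv (imt p))) => [a1 a2] [b1 b2] [c1 c2].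
by apply: complexP => /=; ring.
Qed.

Lemma qf_ge0 (A : 'M[R]_m) t : tpos A -> 0 <= qf A t.
Proof.
move=> Ap; have [|ht] := pselect (exists i, tnth t i != 0); first by move=> /Ap /ltW.
rewrite /qf big1 // => i _; rewrite big1 // => j _.
have -> : tnth t i = 0 by apply: contrapT => /eqP hi; apply: ht; exists i.
by rewrite mulr0 mul0r.
Qed.

Lemma qf_eq0 (A : 'M[R]_m) t : tpos A -> qf A t = 0 -> cv t = 0.
Proof.
move=> Ap h; apply/matrixP => i j; rewrite !mxE.
have -> // : tnth t i = 0.
apply: contrapT => /eqP hi.
by have := Ap t (ex_intro _ i hi); rewrite h ltxx.
Qed.

Lemma Re_bil_cj_eq0 M p : M^T = M -> tpos (remx M) -> ReC (bil M (cj p) p) <= 0 -> p = 0.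
Proof.
move=> sM pM; rewrite Re_bil_cj // => h.
have h1 := qf_ge0 (ret p) pM; have h2 := qf_ge0 (imt p) pM.
have e1 : qf (remx M) (ret p) = 0 by lra.
have e2 : qf (remx M) (imt p) = 0 by lra.
by rewrite [p]cv_reim (qf_eq0 pM e1) (qf_eq0 pM e2) scaler0 addr0.
Qed.

(** A null vector [v] would satisfy $\operatorname{Re}\,\bar v^TMv=0$, a sum of the positive values
    at its real and imaginary parts. *)
Lemma tpos_unitmx M : M^T = M -> tpos (remx M) -> M \in unitmx.
Proof.
move=> sM pM; rewrite unitmxE unitfE; apply/negP => /det0P [v v0 vM].
have Mv : M *m v^T = 0 by rewrite -sM -trmx_mul vM trmx0.
have : v^T = 0.
  apply: (Re_bil_cj_eq0 sM pM).
  by rewrite /bil -mulmxA Mv mulmx0 mxE.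
by move=> /(congr1 trmx); rewrite trmxK trmx0 => /eqP; rewrite (negbTE v0).
Qed.

End gaussian_formula.

Section real_quadratic_bounds.
Variable R : realType.

Lemma quadratic_leading_le0 (a b c : R) : (forall s, s ^+ 2 * a + s * b <= c) -> a <= 0.
Proof.
move=> h; rewrite leNgt; apply/negP => a0.
have c0 : 0 <= c by have := h 0; rewrite expr0n /= !mul0r addr0.
have h1 := h ((`|b| + c + 1) / a); have := h (- ((`|b| + c + 1) / a)).
rewrite sqrrN => h2.
set s := (`|b| + c + 1) / a in h1 h2.
have : s ^+ 2 * a <= c by lra.
have -> : s ^+ 2 * a = (`|b| + c + 1) * s by rewrite /s; field; rewrite gt_eqF.
have b0 : 0 <= `|b| by [].
have l1 := h 1; have l2 := h (-1).
have ac : a <= c + `|b|.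
  have := ler_norm (- b); rewrite normrN => nb.
  move: l1; rewrite expr1n !mul1r => l1; lra.
have s1 : 1 <= s by rewrite ler_pdivlMr // mul1r; lra.
move=> h3; nra.
Qed.

Lemma linear_bounded_eq0 (b c : R) : (forall s, s * b <= c) -> b = 0.
Proof.
move=> h; apply/eqP; rewrite -normr_le0 leNgt; apply/negP => b0.
have bn0 : b != 0 by rewrite -normr_gt0.
by have := h ((c + 1) / b); rewrite divfK //; lra.
Qed.

End real_quadratic_bounds.

Section real_gaussian.
Variables (R : realType) (m : nat).
Local Notation C := R[i].

Lemma qfD (A A' : 'M[R]_m) t : qf (A + A') t = qf A t + qf A' t.
Proof.
rewrite /qf -big_split; apply: eq_bigr => i _; rewrite -big_split; apply: eq_bigr => j _ /=.
by rewrite mxE !mulrDl.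
Qed.

Lemma qfZ a (A : 'M[R]_m) t : qf (a *: A) t = a * qf A t.
Proof.
rewrite /qf mulr_sumr; apply: eq_bigr => i _; rewrite mulr_sumr; apply: eq_bigr => j _ /=.
by rewrite mxE !mulrA.
Qed.

Lemma tposZ a (A : 'M[R]_m) : 0 < a -> tpos A -> tpos (a *: A).
Proof. by move=> a0 pA t ht; rewrite qfZ mulr_gt0 // pA. Qed.

Lemma tposD (A A' : 'M[R]_m) : tpos A -> tpos A' -> tpos (A + A').
Proof. by move=> pA pA' t ht; rewrite qfD addr_gt0 ?pA ?pA'. Qed.

Lemma measurable_qf (A : 'M[R]_m) : measurable_fun setT (qf A).
Proof.
have h : cmeas (fun t : m.-tuple R => bil (map_mx (real_complex R) A) (cv t) (cv t)).
  by apply: cmeas_bil => i; apply: cmeas_cv; exact: measurable_id.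
have := h.1.
congr (measurable_fun _ _); apply/funext => t; rewrite Re_bil_cv; congr qf.
by apply/matrixP => i j; rewrite !mxE.
Qed.

(** On the unit cube the form is at most the sum [L] of the moduli of its coefficients. *)
Lemma qf_gauss_gt0 (A : 'M[R]_m) : (0 < \int[@leb R m]_t (expR (- qf A t))%:E)%E.
Proof.
pose L := \sum_i \sum_j `|A i j|.
pose D := @tbox R m `[0, 1]%classic.
have mD : measurable D by exact: measurable_tbox.
have : (\int[@leb R m]_t ((expR (- L))%:E * (\1_D t)%:E) <=
  \int[@leb R m]_t (expR (- qf A t))%:E)%E.
  apply: ge0_le_integral => //.
  - apply: emeasurable_funM; first exact: measurable_cst.
    by apply/measurable_EFinP; exact: measurable_indic.
  - apply/measurable_EFinP; apply: (measurableT_comp (@measurable_expR R)).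
    by apply: measurable_funN; exact: measurable_qf.
  - move=> t _; rewrite -EFinM lee_fin indicE; have [tD|_] := boolP (t \in D); last first.
      by rewrite mulr0 expR_ge0.
    rewrite mulr1 ler_expR lerN2; apply: ler_sum => i _; apply: ler_sum => j _.
    move: tD; rewrite inE => tD; have := tD i; have := tD j.
    rewrite /= !in_itv /= => /andP[j0 j1] /andP[i0 i1].
    apply: le_trans (ler_norm _) _; rewrite !normrM (ger0_norm i0) (ger0_norm j0) -mulrA.
    rewrite -[leRHS]mulr1; apply: ler_wpM2l => //.
    by rewrite -[leRHS]mulr1; apply: ler_pM.
apply: lt_le_trans; rewrite ge0_integralZl //; last first.
  by apply/measurable_EFinP; exact: measurable_indic.
by rewrite integral_indic // setIT [X in (_ * X)%E](leb_tbox_unit R m) mule1 lte_fin expR_gt0.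
Qed.

Lemma gauss0_real (A : 'M[R]_m) : tpos A -> gauss0 (map_mx (real_complex R) A) != 0.
Proof.
move=> pA; have rA : remx (map_mx (real_complex R) A) = A.
  by apply/matrixP => i j; rewrite !mxE.
have := qf_gauss_gt0 A; apply: contraTneq => h.
have := @cintg_gauss R m (map_mx (real_complex R) A); rewrite rA => /(_ pA 0) ci.
have nE t : normc (expC (- bil (map_mx (real_complex R) A) (cv t + 0) (cv t + 0))) = expR (- qf A t).
  by rewrite addr0 normc_expC ReN Re_bil_cv rA.
have fin : (\int[@leb R m]_t (expR (- qf A t))%:E < +oo)%E.
  by have := ci.2; under eq_integral do rewrite nE.
rewrite -EFin_Rintegral //.
rewrite lte_fin -leNgt.
have -> : \int[@leb R m]_t expR (- qf A t) = ReC (gauss0 (map_mx (real_complex R) A)).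
  transitivity (\int[@leb R m]_t ReC (expC (- bil (map_mx (real_complex R) A) (cv t) (cv t)))).
    apply: eq_Rintegral => t _.
    have -> : bil (map_mx (real_complex R) A) (cv t) (cv t) = (qf A t)%:C.
      apply: complexP; first by rewrite Re_bil_cv rA.
      have cB : map_mx conjc (map_mx (real_complex R) A) = map_mx (real_complex R) A.
        by apply/matrixP => i j; rewrite !mxE; apply: complexP => /=; rewrite ?oppr0.
      have := bil_conj (map_mx (real_complex R) A) (cv t) (cv t).
      rewrite cB conj_cv => /(congr1 (@ImC R)); rewrite ImJ => h'.
      by rewrite /=; lra.
    by rewrite -rmorphN expC_real.
  by [].
by rewrite h.
Qed.

End real_gaussian.

(** * The kernel and the Weyl symbol as explicit Gaussians *)

Section euclidean_core.
Variables (R : realType) (m : nat).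
Local Notation C := R[i].
Variables (B : 'M[R]_m) (Q : 'M[C]_m) (l : 'cV[C]_m) (c0 : C).
Implicit Types (p r x : 'cV[C]_m) (s t : m.-tuple R).
Hypotheses (sB : B^T = B) (sQ : Q^T = Q) (pB : tpos B)
  (pQ : tpos (B - 2 *: remx Q)).

Let Bc : 'M[C]_m := map_mx (real_complex R) B.
Definition qc x : C := bil Q x x + 2 * bil 1%:M l x + c0.

Let sBc : Bc^T = Bc. Proof. by rewrite /Bc map_trmx sB. Qed.
Let rBc : remx Bc = B. Proof. by apply/matrixP => i j; rewrite !mxE. Qed.
Let cBc : map_mx conjc Bc = Bc.
Proof. by apply/matrixP => i j; rewrite !mxE; apply: complexP => /=; rewrite ?oppr0. Qed.

Lemma remxD (M N : 'M[C]_m) : remx (M + N) = remx M + remx N.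
Proof. by apply/matrixP => i j; rewrite !mxE ReD. Qed.
Lemma remxN (M : 'M[C]_m) : remx (- M) = - remx M.
Proof. by apply/matrixP => i j; rewrite !mxE ReN. Qed.
Lemma remxZ (a : R) (M : 'M[C]_m) : remx (a%:C *: M) = a *: remx M.
Proof. by apply/matrixP => i j; rewrite !mxE ReMR. Qed.

(** [MK] and [Ma] are minus the quadratic parts, in the integration variable, of the exponents in
    [Kf] and [af]. *)
Definition MK : 'M[C]_m := Bc - Q.
Definition Ma : 'M[C]_m := 2%:C *: Bc - Q.

Lemma sMK : MK^T = MK. Proof. by rewrite /MK linearB /= sBc sQ. Qed.
Lemma sMa : Ma^T = Ma. Proof. by rewrite /Ma linearB /= linearZ /= sBc sQ. Qed.

Lemma pMK : tpos (remx MK).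
Proof.
rewrite /MK remxD remxN rBc.
have -> : B - remx Q = (1 / 2) *: (B - 2 *: remx Q) + (1 / 2) *: B.
  by apply/matrixP => i j; rewrite !mxE; field.
by apply: tposD; apply: tposZ => //; rewrite divr_gt0.
Qed.

Lemma pMa : tpos (remx Ma).
Proof.
rewrite /Ma remxD remxN remxZ rBc.
have -> : 2 *: B - remx Q = (1 / 2) *: (B - 2 *: remx Q) + (3 / 2) *: B.
  by apply/matrixP => i j; rewrite !mxE; field.
by apply: tposD; apply: tposZ => //; rewrite divr_gt0.
Qed.

(** [Kf] at [pt w z] is the matrix element of $e^q$ between $k_z$ and $k_w$ ([Kc_Kf]), and [af] is
    the Weyl symbol before normalisation ([weyl_symbolE]). *)
Definition Kf p : C := cint (@leb R m)
  (fun t => expC (qc (cv t) - bil Bc (cv t) (cv t) + 2 * bil Bc p (cv t))).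
Definition af x : C := cint (@leb R m)
  (fun t => expC (qc (cv t) - 2 * bil Bc (cv t - x) (cv t - x))).

(** [xiK p] and [xia x] are the critical points of the exponents integrated in [Kf p] and [af x]. *)
Definition xiK p := invmx MK *m (Bc *m p + l).
Definition xia x := invmx Ma *m (2%:C *: (Bc *m x) + l).

Lemma bil_mull (M : 'M[C]_m) p r : M^T = M -> bil M p r = bil 1%:M (M *m p) r.
Proof. by move=> sM; rewrite /bil trmx_mul sM mulmx1. Qed.

Lemma MK_xiK p : MK *m xiK p = Bc *m p + l.
Proof. by rewrite /xiK mulKVmx // tpos_unitmx ?sMK //; exact: pMK. Qed.

Lemma Ma_xia x : Ma *m xia x = 2%:C *: (Bc *m x) + l.
Proof. by rewrite /xia mulKVmx // tpos_unitmx ?sMa //; exact: pMa. Qed.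

Lemma K_exponent p x : qc x - bil Bc x x + 2 * bil Bc p x =
  - bil MK x x + 2 * bil MK (xiK p) x + c0.
Proof.
rewrite (bil_mull (xiK p) _ sMK) MK_xiK bilDl -(bil_mull _ _ sBc) /MK bilDm bilNm /qc.
by ring.
Qed.

Lemma Kf_formula p : Kf p = gauss0 MK * expC (bil MK (xiK p) (xiK p) + c0).
Proof.
transitivity (cint (@leb R m) (fun t => expC (- bil MK (cv t) (cv t) +
    2 * bil MK (xiK p) (cv t)) * expC c0)).
  by apply: eq_cint => t; rewrite -expCD K_exponent.
rewrite cintZr; last exact: cintg_formula sMK pMK.
by rewrite (gauss_formula _ sMK pMK) expCD -mulrA mulrCA mulrA.
Qed.

Lemma cintg_K p : cintg (@leb R m)
  (fun t => expC (qc (cv t) - bil Bc (cv t) (cv t) + 2 * bil Bc p (cv t))).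
Proof.
have := cintgMr (expC c0) (cintg_formula (xiK p) sMK pMK).
by apply: eq_cintg => t; rewrite -expCD K_exponent.
Qed.

Lemma a_exponent x r : qc r - 2 * bil Bc (r - x) (r - x) =
  - bil Ma r r + 2 * bil Ma (xia x) r + (c0 - 2 * bil Bc x x).
Proof.
have two : (2%:C : C) = 2 by rewrite rmorph_nat.
have e : bil Ma (xia x) r = 2 * bil Bc x r + bil 1%:M l r.
  by rewrite (bil_mull (xia x) _ sMa) Ma_xia bilDl bilZl -(bil_mull _ _ sBc) two.
rewrite e /Ma bilDm bilNm /qc.
rewrite bilZm two bilDl !bilDr !bilNl !bilNr (bilC x r sBc).
by ring.
Qed.

Lemma af_formula x :
  af x = gauss0 Ma * expC (bil Ma (xia x) (xia x) + (c0 - 2 * bil Bc x x)).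
Proof.
transitivity (cint (@leb R m) (fun t => expC (- bil Ma (cv t) (cv t) +
    2 * bil Ma (xia x) (cv t)) * expC (c0 - 2 * bil Bc x x))).
  by apply: eq_cint => t; rewrite -expCD a_exponent.
rewrite cintZr; last exact: cintg_formula sMa pMa.
rewrite (gauss_formula _ sMa pMa) [in RHS]expCD.
by rewrite -mulrA mulrCA mulrA [gauss0 _ * _]mulrC -!mulrA.
Qed.

Lemma cintg_a x : cintg (@leb R m)
  (fun t => expC (qc (cv t) - 2 * bil Bc (cv t - x) (cv t - x))).
Proof.
have := cintgMr (expC (c0 - 2 * bil Bc x x)) (cintg_formula (xia x) sMa pMa).
by apply: eq_cintg => t; rewrite -expCD a_exponent.
Qed.

End euclidean_core.

                                             

(** * From a bounded symbol to the kernel bound *)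

Section weyl_to_kernel.
Variables (R : realType) (m : nat).
Local Notation C := R[i].
Variables (B : 'M[R]_m) (Q : 'M[C]_m) (l : 'cV[C]_m) (c0 : C).
Implicit Types (p r x : 'cV[C]_m) (s t : m.-tuple R).
Hypotheses (sB : B^T = B) (sQ : Q^T = Q) (pB : tpos B)
  (pQ : tpos (B - 2 *: remx Q)).

Let Bc : 'M[C]_m := map_mx (real_complex R) B.
Let sBc : Bc^T = Bc. Proof. by rewrite /Bc map_trmx sB. Qed.
Let rBc : remx Bc = B. Proof. by apply/matrixP => i j; rewrite !mxE. Qed.
Let cBc : map_mx conjc Bc = Bc.
Proof. by apply/matrixP => i j; rewrite !mxE; apply: complexP => /=; rewrite ?oppr0. Qed.
Local Notation K := (Kf B Q l c0).
Local Notation a := (af B Q l c0).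
Local Notation q := (qc Q l c0).
Local Notation leb := (@leb R m).

(** The Hermitian extension of [B] to $\mathbb C^m$, the growth allowed to $\log|K|$; at [pt w z] it
    equals $h(w)+h(z)$ ([NN_pt]). *)
Definition NN p : R := ReC (bil Bc (cj p) p).

Let cmeas_cvc (d : measure_display) (T : measurableType d) (f : T -> m.-tuple R) (p : 'cV[C]_m) i :
  measurable_fun setT f -> cmeas (fun w => (cv (f w) + p) i 0).
Proof.
move=> mf; under eq_fun do rewrite mxE.
by apply: cmeasD; [exact: cmeas_cv|exact: cmeas_cst].
Qed.

Let cmeas_q (d : measure_display) (T : measurableType d) (f : T -> m.-tuple R) :
  measurable_fun setT f -> cmeas (fun w => q (cv (f w))).
Proof.
move=> mf; apply: cmeasD; last exact: cmeas_cst.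
apply: cmeasD; first by apply: cmeas_bil => i; exact: cmeas_cv.
apply: cmeasM; first exact: cmeas_cst.
by apply: cmeas_bil => i; [exact: cmeas_cst|exact: cmeas_cv].
Qed.

Lemma integral_norm_shift (M : 'M[C]_m) s p : tpos (remx M) ->
  (\int[leb]_t (normc (expC (- bil M (cv t + (cv s + p)) (cv t + (cv s + p)))))%:E =
   \int[leb]_t (normc (expC (- bil M (cv t + p) (cv t + p))))%:E)%E.
Proof.
move=> pM; rewrite -[RHS]((preserves_tshift (tnth s)).2
  (fun t => (normc (expC (- bil M (cv t + p) (cv t + p))))%:E)).
- by apply: eq_integral => t _; rewrite (cvD s t) -addrA.
- by apply/measurable_EFinP; exact: measurable_normc (cmeas_gauss M p).
- by move=> t; rewrite lee_fin normc_ge0.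
Qed.

Let p4 : tpos (remx (4%:C *: Bc)).
Proof.
have -> : remx (4%:C *: Bc) = 4 *: B by rewrite -rBc; apply/matrixP => i j; rewrite !mxE ReMR.
by apply: tposZ.
Qed.

Let kern p x := expC (- (2 * bil Bc (x - p) (x - p)) + bil Bc p p).

(** With $y=s-\operatorname{Re}p$ and $b=\operatorname{Im}p$, the real part of the exponent is
    $-2B(y,y)+2B(b,b)+B(\operatorname{Re}p,\operatorname{Re}p)-B(b,b)$, and the last three terms
    make up [NN p]. *)
Lemma normc_kern p s : normc (kern p (cv s)) =
  expR (- qf (2 *: B) (tadd (tscale (-1) (ret p)) s)) * expR (NN p).
Proof.
rewrite normc_expC -expRD; congr expR; rewrite ReD ReN.
have -> : cv s - p = cv (tadd (tscale (-1) (ret p)) s) - 'i *: cv (imt p).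
  by rewrite cvD cvZ rmorphN1 scaleN1r {1}[p]cv_reim opprD addrA.
set y := tadd _ _; rewrite /NN.
rewrite bilDl !bilDr !bilNl !bilNr !bilZl !bilZr (bilC (cv (imt p)) (cv y) sBc).
have <- : ReC (bil (2%:C *: Bc) (cv y) (cv y)) = qf (2 *: B) y.
  rewrite Re_bil_cv; congr qf; apply/matrixP => i j; rewrite !mxE ReMR.
  by rewrite -[in RHS]rBc !mxE.
rewrite bilZm ReMR.
have im0 t t' : ImC (bil Bc (cv t) (cv t')) = 0.
  have := bil_conj Bc (cv t) (cv t'); rewrite cBc !conj_cv.
  by move=> /(congr1 (@ImC R)); rewrite ImJ => h; lra.
have -> : bil Bc p p = bil Bc (cv (ret p) + 'i *: cv (imt p)) (cv (ret p) + 'i *: cv (imt p)).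
  by rewrite -cv_reim.
have -> : bil Bc (cj p) p = bil Bc (cj (cv (ret p) + 'i *: cv (imt p))) (cv (ret p) + 'i *: cv (imt p)).
  by rewrite -cv_reim.
rewrite cjD cjZ !cj_cv !(bilDl, bilDr, bilZl, bilZr).
rewrite (bilC (cv (imt p)) (cv (ret p)) sBc).
move: (im0 y y) (im0 (imt p) (imt p)) (im0 y (imt p)) (im0 (ret p) (ret p)) (im0 (ret p) (imt p)).
move: (bil Bc (cv y) (cv y)) (bil Bc (cv (imt p)) (cv (imt p))) (bil Bc (cv y) (cv (imt p))).
move: (bil Bc (cv (ret p)) (cv (ret p))) (bil Bc (cv (ret p)) (cv (imt p))).
move=> [a1 a2] [b1 b2] [d1 d2] [e1 e2] [g1 g2] /= h1 h2 h3 h4 h5.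
rewrite ?h1 ?h2 ?h3 ?h4 ?h5; by ring.
Qed.

Let F p (ts : m.-tuple R * m.-tuple R) :=
  expC (q (cv ts.1) - 2 * bil Bc (cv ts.1 - cv ts.2) (cv ts.1 - cv ts.2)) * kern p (cv ts.2).

(** The identity $2B(t-s)+2B(s-p)-B(p)=4B(s-\frac{t+p}2)+B(t)-2B(p,t)$, which separates the
    integrand of [Kf p] from a shifted Gaussian in [s]. *)
Let FE p t s : F p (t, s) =
  expC (q (cv t) - bil Bc (cv t) (cv t) + 2 * bil Bc p (cv t)) *
  expC (- bil (4%:C *: Bc) (cv s + (cv (tscale (-1/2) t) + - ((1/2)%:C *: p)))
                           (cv s + (cv (tscale (-1/2) t) + - ((1/2)%:C *: p)))).
Proof.
rewrite /F /kern -!expCD; congr expC => /=.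
rewrite bilZm cvZ.
have -> : (-1 / 2 : R)%:C = - (2%:R^-1) :> C.
  by rewrite mulN1r rmorphN fmorphV rmorph_nat.
have -> : (1 / 2 : R)%:C = 2%:R^-1 :> C by rewrite mul1r fmorphV rmorph_nat.
have -> : (4%:C : C) = 4 by rewrite rmorph_nat.
rewrite !(bilDl, bilDr, bilNl, bilNr, bilZl, bilZr).
rewrite (bilC (cv s) (cv t) sBc) (bilC (cv s) p sBc) (bilC (cv t) p sBc).
move: (bil Bc (cv s) (cv s)) (bil Bc (cv t) (cv s)) (bil Bc p (cv s)) (bil Bc (cv t) (cv t)).
move: (bil Bc p (cv t)) (bil Bc p p) (q (cv t)) => z1 z2 z3 z4 z5 z6 z7.
by field.
Qed.

Let cmF p : cmeas (F p).
Proof.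
apply: cmeasM; apply: cmeas_expC.
  apply: cmeasB; first by apply: cmeas_q; exact: measurable_fst.
  apply: cmeasM; first exact: cmeas_cst.
  apply: cmeas_bil => i; under eq_fun do rewrite !mxE; apply: cmeasB.
  - by apply: cmeasR; exact: (measurableT_comp (measurable_tnth i) measurable_fst).
  - by apply: cmeasR; exact: (measurableT_comp (measurable_tnth i) measurable_snd).
  - by apply: cmeasR; exact: (measurableT_comp (measurable_tnth i) measurable_fst).
  - by apply: cmeasR; exact: (measurableT_comp (measurable_tnth i) measurable_snd).
apply: cmeasD; last exact: cmeas_cst.
apply: cmeasN; apply: cmeasM; first exact: cmeas_cst.
by apply: cmeas_bil => i; apply: cmeas_cvc; exact: measurable_snd.
Qed.

Let finF p : (\int[leb]_t \int[leb]_s (normc (F p (t, s)))%:E < +oo)%E.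
Proof.
pose k := (\int[leb]_s (normc (expC (- bil (4%:C *: Bc) (cv s + - ((1/2)%:C *: p))
                           (cv s + - ((1/2)%:C *: p)))))%:E)%E.
have kfin : (k < +oo)%E by exact: (cintg_gauss p4 _).2.
have k0 : (0 <= k)%E by apply: integral_ge0 => s _; rewrite lee_fin normc_ge0.
have -> : (\int[leb]_t \int[leb]_s (normc (F p (t, s)))%:E =
  \int[leb]_t ((normc (expC (q (cv t) - bil Bc (cv t) (cv t) + 2 * bil Bc p (cv t))))%:E * k))%E.
  apply: eq_integral => t _.
  have -> : k = (\int[leb]_s (normc (expC
      (- bil (4%:C *: Bc) (cv s + (cv (tscale (-1/2) t) + - ((1/2)%:C *: p)))
                          (cv s + (cv (tscale (-1/2) t) + - ((1/2)%:C *: p))))))%:E)%E.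
    by rewrite /k; symmetry; exact: integral_norm_shift.
  rewrite -ge0_integralZl //.
  - by apply: eq_integral => s _; rewrite FE normcM EFinM.
  - by apply/measurable_EFinP; exact: measurable_normc (cmeas_gauss _ _).
  - by move=> s _; rewrite lee_fin normc_ge0.
  - by rewrite lee_fin normc_ge0.
have cK := cintg_K l c0 sB sQ pB pQ p.
rewrite ge0_integralZr //; first last.
- by move=> t _; rewrite lee_fin normc_ge0.
- by apply/measurable_EFinP; exact: measurable_normc cK.1.
apply: lte_mul_pinfty; [|rewrite ge0_fin_numE|]; last exact: kfin.
- by apply: integral_ge0 => t _; rewrite lee_fin normc_ge0.
- exact: cK.2.
- by apply: integral_ge0 => t _; rewrite lee_fin normc_ge0.
Qed.

(** Integrating [F] over [s] first leaves [gauss0 (4%:C *: Bc)] times the integrand of [Kf p], by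
    [FE] and [gauss_shift]; integrating over [t] first leaves the symbol times [kern]. *)
Lemma weyl_transform p :
  gauss0 (4%:C *: Bc) * K p = cint leb (fun s => a (cv s) * kern p (cv s)).
Proof.
have h := cfubini (cmF p) (finF p).
have E1 : gauss0 (4%:C *: Bc) * K p = cint leb (fun t => cint leb (fun s => F p (t, s))).
  symmetry; rewrite mulrC -cintZr; last exact: cintg_K.
  apply: eq_cint => t; rewrite /gauss0.
  rewrite -(gauss_shift p4 (cv (tscale (-1/2) t) + - ((1/2)%:C *: p))).
  by rewrite -cintZ; [apply: eq_cint => s; exact: FE|exact: cintg_gauss].
have E2 : cint leb (fun s => cint leb (fun t => F p (t, s))) = cint leb (fun s => a (cv s) * kern p (cv s)).
  apply: eq_cint => s.
  have ca := cintg_a l c0 sB sQ pB pQ (cv s).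
  exact: (cintZr (kern p (cv s)) ca).
exact: (etrans E1 (etrans h E2)).
Qed.

(** By [normc_kern] the transform kernel has modulus $e^{N(p)}$ times a translate of one fixed
    integrable Gaussian. *)
Lemma kernel_bound_of_weyl S :
  (\forall s \ae leb, normc (a (cv s)) <= S) ->
  exists D, forall p, normc (K p) <= D * expR (NN p).
Proof.
move=> aS.
have g0 : gauss0 (4%:C *: Bc) != 0.
  have -> : 4%:C *: Bc = map_mx (real_complex R) (4 *: B).
    by apply/matrixP => i j; rewrite !mxE rmorphM.
  by apply: gauss0_real; exact: tposZ.
have p2 : tpos (2 *: B) by exact: tposZ.
have g0p : 0 < normc (gauss0 (4%:C *: Bc)).
  by rewrite lt_def normc_ge0 andbT; apply: contra_neq g0 => /eq0_normc.
pose S' := `|S|.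
pose k := fine (\int[leb]_s (expR (- qf (2 *: B) s))%:E)%E.
have mq : measurable_fun setT (fun s : m.-tuple R => expR (- qf (2 *: B) s)).
  apply: (measurableT_comp (@measurable_expR R)).
  by apply: measurable_funN; exact: measurable_qf.
have kfin : (\int[leb]_s (expR (- qf (2 *: B) s))%:E < +oo)%E.
  have e2 : remx (map_mx (real_complex R) (2 *: B)) = 2 *: B.
    by apply/matrixP => i j; rewrite !mxE.
  have pc2 : tpos (remx (map_mx (real_complex R) (2 *: B))) by rewrite e2.
  have := (cintg_gauss pc2 0).2; congr (_ < _)%E; apply: eq_integral => s _.
  by rewrite addr0 normc_expC ReN Re_bil_cv e2.
exists (S' * k / normc (gauss0 (4%:C *: Bc))) => p.
rewrite mulrAC ler_pdivlMr // mulrC -normcM weyl_transform.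
have ci : cintg leb (fun s => a (cv s) * kern p (cv s)).
  have := cfubini (cmF p) (finF p) => _.
  have fin' : (\int[leb]_s \int[leb]_t (normc (F p (t, s)))%:E < +oo)%E.
    rewrite -(@fubini_tonelli _ _ _ _ _ leb leb (fun ts => (normc (F p ts))%:E)).
    - exact: finF.
    - by apply/measurable_EFinP; exact: measurable_normc (cmF p).
    - by move=> ts; rewrite lee_fin normc_ge0.
  have cms : cmeas (fun st : m.-tuple R * m.-tuple R => F p (st.2, st.1)).
    apply: (@cmeas_comp _ _ _ _ _ (F p) (fun st => (st.2, st.1))); first exact: cmF.
    by apply: measurable_fun_pair; [exact: measurable_snd|exact: measurable_fst].
  have := @cintg_iterated _ _ _ _ _ leb leb (fun st => F p (st.2, st.1)) cms fin'.
  apply: eq_cintg => s; rewrite -cintZr //.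
  exact: (cintg_a l c0 sB sQ pB pQ (cv s)).
rewrite -lee_fin; apply: le_trans (le_normc_cintE ci) _.
apply: (@le_trans _ _ (\int[leb]_s ((S' * expR (NN p))%:E *
    (expR (- qf (2 *: B) (tadd (tscale (-1) (ret p)) s)))%:E))%E).
  apply: ae_ge0_le_integral => //.
  - by move=> s _; rewrite lee_fin normc_ge0.
  - by apply/measurable_EFinP; exact: measurable_normc ci.1.
  - by move=> s _; rewrite -EFinM lee_fin !mulr_ge0 ?expR_ge0 // /S'.
  - apply: emeasurable_funM; first exact: measurable_cst.
    apply/measurable_EFinP; apply: (measurableT_comp mq); exact: measurable_tshift.
  - apply: filterS aS => s hs _; rewrite -EFinM lee_fin normcM normc_kern.
    rewrite -mulrA [expR (NN p) * _]mulrC; apply: ler_wpM2r; first by rewrite mulr_ge0 ?expR_ge0.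
    by apply: le_trans hs _; exact: ler_norm.
rewrite ge0_integralZl //; first last.
- by rewrite lee_fin mulr_ge0 ?expR_ge0 // /S'.
- by apply/measurable_EFinP; apply: (measurableT_comp mq); exact: measurable_tshift.
rewrite ((preserves_tshift (tnth (tscale (-1) (ret p)))).2
  (fun s => (expR (- qf (2 *: B) s))%:E)) //; last first.
- by apply/measurable_EFinP.
rewrite -[X in (_ * X)%E]fineK; last first.
  by rewrite ge0_fin_numE // integral_ge0 // => s _; rewrite lee_fin expR_ge0.
by rewrite -EFinM lee_fin -/k mulrAC.
Qed.

End weyl_to_kernel.

(** * From the kernel bound to a bounded symbol *)

Section semidefinite.
Variables (R : realFieldType) (m : nat).
Implicit Types (x y : 'cV[R]_m).

(** A row vector vanishing on the kernel of $P$ lies in its row space, $b=uP$; completing the square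
    at $v=u^T/2$ gives the bound $v^TPv$. *)
Lemma semidefinite_bounded_above (P : 'M[R]_m) (b : 'rV[R]_m) :
  P^T = P -> (forall x, 0 <= (x^T *m P *m x) 0 0) ->
  (forall x, P *m x = 0 -> (b *m x) 0 0 = 0) ->
  exists S, forall x, - (x^T *m P *m x) 0 0 + (b *m x) 0 0 <= S.
Proof.
move=> sP P0 bP.
have : (b <= P)%MS.
  rewrite submxE; apply/eqP/matrixP => i j; rewrite (ord1 i) [RHS]mxE.
  have hc : P *m col j (cokermx P) = 0 by rewrite colE mulmxA mulmx_coker mul0mx.
  by have := bP _ hc; rewrite colE mulmxA -colE mxE.
move=> /submxP [u ub]; pose v : 'cV_m := 2^-1 *: u^T.
exists ((v^T *m P *m v) 0 0) => x; rewrite ub.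
have e1 : (v^T *m P *m x) 0 0 = (x^T *m P *m v) 0 0.
  transitivity ((x^T *m P *m v)^T 0 0); last by rewrite mxE.
  by rewrite !trmx_mul trmxK sP mulmxA.
have -> : u = 2 *: v^T by rewrite /v linearZ /= trmxK scalerA mulfV ?scale1r.
rewrite -!scalemxAl [X in _ + X]mxE.
have := P0 (x - v).
have -> : (x - v)^T *m P *m (x - v) =
    x^T *m P *m x - x^T *m P *m v - v^T *m P *m x + v^T *m P *m v.
  have -> : (x - v)^T = x^T - v^T by apply/matrixP => i j; rewrite !mxE.
  by rewrite !mulmxBl !mulmxBr opprB addrA [in RHS]addrAC.
have mD (M N : 'M[R]_1) : (M + N) 0 0 = M 0 0 + N 0 0 by rewrite mxE.
have mN (M : 'M[R]_1) : (- M) 0 0 = - M 0 0 by rewrite mxE.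
rewrite !(mD, mN) e1.
by lra.
Qed.

End semidefinite.
Section kernel_to_weyl.
Variables (R : realType) (m : nat).
Local Notation C := R[i].
Variables (B : 'M[R]_m) (Q : 'M[C]_m) (l : 'cV[C]_m) (c0 : C).
Implicit Types (p r x : 'cV[C]_m) (s t : m.-tuple R).
Hypotheses (sB : B^T = B) (sQ : Q^T = Q) (pB : tpos B)
  (pQ : tpos (B - 2 *: remx Q)).

Let Bc : 'M[C]_m := map_mx (real_complex R) B.
Let sBc : Bc^T = Bc. Proof. by rewrite /Bc map_trmx sB. Qed.
Let rBc : remx Bc = B. Proof. by apply/matrixP => i j; rewrite !mxE. Qed.
Let cBc : map_mx conjc Bc = Bc.
Proof. by apply/matrixP => i j; rewrite !mxE; apply: complexP => /=; rewrite ?oppr0. Qed.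
Local Notation K := (Kf B Q l c0).
Local Notation a := (af B Q l c0).
Local Notation q := (qc Q l c0).
Local Notation leb := (@leb R m).
Local Notation NNB := (NN B).
Local Notation MK := (MK B Q).
Local Notation Ma := (Ma B Q).
Local Notation xK := (xiK B Q l).
Local Notation xia := (xia B Q l).

Lemma MK_unit : MK \in unitmx.
Proof. by apply: tpos_unitmx; [exact: sMK|exact: pMK]. Qed.

Lemma Ma_unit : Ma \in unitmx.
Proof. by apply: tpos_unitmx; [exact: sMa|exact: pMa]. Qed.

(** The quadratic part of the exponent of [Kf], as a form in [p]. *)
Let E : 'M[C]_m := Bc *m invmx MK *m Bc.
Let sE : E^T = E.
Proof. by rewrite /E !trmx_mul trmx_inv sMK // sBc mulmxA. Qed.

Lemma ReBc_cj p r : ReC (bil Bc (cj p) r) = ReC (bil Bc (cj r) p).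
Proof.
have h := bil_conj Bc (cj p) r; rewrite cBc -/(cj _) -/(cj _) cjK in h.
by rewrite (bilC (cj r) p sBc) -h ReJ.
Qed.

Lemma NND p r : NNB (p + r) = NNB p + NNB r + 2 * ReC (bil Bc (cj p) r).
Proof.
rewrite /NNB cjD bilDl bilDr bilDr ReD ReD ReD (ReBc_cj r p).
move: (ReC (bil Bc (cj p) p)) (ReC (bil Bc (cj r) r)) (ReC (bil Bc (cj p) r)) => x y z.
by lra.
Qed.

Lemma NNZ (k : C) p : NNB (k *: p) = normc k ^+ 2 * NNB p.
Proof.
rewrite /NNB cjZ bilZl bilZr sqr_normc; move: k (bil _ _ _) => [k1 k2] [b1 b2] /=.
by ring.
Qed.

Lemma NN_cj p : NNB (cj p) = NNB p.
Proof. by rewrite /NNB cjK (bilC p (cj p) sBc). Qed.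

Lemma NN_decomposition p : NNB p + ReC (bil Bc p p) = 2 * qf B (ret p).
Proof.
have := NND (cv (ret p)) ('i *: cv (imt p)); rewrite -cv_reim => ->.
rewrite NNZ sqr_normc /= cj_cv.
have -> : bil Bc p p = bil Bc (cv (ret p) + 'i *: cv (imt p)) (cv (ret p) + 'i *: cv (imt p)).
  by rewrite -cv_reim.
rewrite bilDl !bilDr !bilZl !bilZr (bilC (cv (imt p)) (cv (ret p)) sBc).
rewrite /NNB !cj_cv !Re_bil_cv rBc.
rewrite !ReD.
have -> : ReC ('i * ('i * bil Bc (cv (imt p)) (cv (imt p)))) = - qf B (imt p).
  by rewrite -[in RHS]rBc -Re_bil_cv; move: (bil _ _ _) => [b1 b2] /=; ring.
rewrite !Re_bil_cv rBc.
have im0 : ImC (bil Bc (cv (ret p)) (cv (imt p))) = 0.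
  have := bil_conj Bc (cv (ret p)) (cv (imt p)); rewrite cBc !conj_cv.
  by move=> /(congr1 (@ImC R)); rewrite ImJ => h; lra.
move: im0; move: (qf B (imt p)) (qf B (ret p)) (bil Bc (cv (ret p)) (cv (imt p))) => x y [b1 b2] /= ->.
by ring.
Qed.

Section bounded.
Variable D : R.
Hypothesis KD : forall p, normc (K p) <= D * expR (NNB p).
Hypothesis g0 : gauss0 MK != 0.

Lemma kernel_exponent_bound :
  exists D', forall p, ReC (bil MK (xK p) (xK p)) <= D' + NNB p.
Proof.
have g0p : 0 < normc (gauss0 MK).
  by rewrite lt_def normc_ge0 andbT; apply: contra_neq g0 => /eq0_normc.
exists (D / normc (gauss0 MK) - ReC c0) => p.
have := KD p; rewrite Kf_formula // normcM normc_expC ReD => h.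
have {}h : expR (ReC (bil MK (xK p) (xK p)) + ReC c0) <= D / normc (gauss0 MK) * expR (NNB p).
  by rewrite mulrAC ler_pdivlMr // mulrC.
(* The inequality $1+x\le e^x$ takes the place of a logarithm of this constant. *)
have h2 := expR_ge1Dx (D / normc (gauss0 MK) : R).
have : expR (ReC (bil MK (xK p) (xK p)) + ReC c0) <= expR (D / normc (gauss0 MK) + NNB p).
  rewrite [leRHS]expRD; apply: le_trans h _; apply: ler_wpM2r; first exact: expR_ge0.
  by apply: le_trans h2; rewrite lerDr.
by rewrite ler_expR; lra.
Qed.

Lemma bilE_xi p r : bil MK (invmx MK *m (Bc *m p)) (invmx MK *m (Bc *m r)) = bil E p r.
Proof.
rewrite bil_mulr mulmxV ?MK_unit // /bil !trmx_mul trmx_inv sMK // sBc !mulmxA mulmx1.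
by rewrite /E ?mulmxA.
Qed.

(** Along the line $sp$ the exponent bound is a quadratic inequality in $s$, so its leading
    coefficient has a sign. *)
Lemma kernel_form_le p : ReC (bil E p p) <= NNB p.
Proof.
have [D' h] := kernel_exponent_bound.
pose w := invmx MK *m l.
have xiE r : xK r = invmx MK *m (Bc *m r) + w by rewrite /xK mulmxDr.
rewrite -subr_le0.
apply: (@quadratic_leading_le0 _ _ (2 * ReC (bil MK w (invmx MK *m (Bc *m p))))
  (D' - ReC (bil MK w w))) => s.
have := h (s%:C *: p); rewrite NNZ xiE -!scalemxAr !(bilDl, bilDr, bilZl, bilZr) bilE_xi.
rewrite normcR real_normK ?num_real // (bilC _ w (sMK sB sQ)) !ReD !ReMR.
move: (NNB p) (ReC (bil E p p)) (ReC (bil MK w w)) (ReC (bil MK w _)) => x y z v.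
by nra.
Qed.

(** Add [kernel_form_le] at $p+r$ and at $i(p-r)$: the factor $i$ changes the sign of the complex
    bilinear form [E] but not of the Hermitian [NNB], which obeys the parallelogram law. *)
Lemma kernel_form_le2 p r : 2 * ReC (bil E p r) <= NNB p + NNB r.
Proof.
have := kernel_form_le (p + r); have := kernel_form_le ('i *: (p - r)).
rewrite NNZ sqr_normc /= !NND -[- r]scaleN1r NNZ sqr_normc /=.
rewrite !(bilDl, bilDr, bilZl, bilZr) (bilC r p sE).
move: (NNB p) (NNB r) (bil E p p) (bil E p r) (bil E r r) (bil Bc (cj p) r).
by move=> x y [a1 a2] [b1 b2] [d1 d2] [e1 e2] /=; lra.
Qed.

(** The linear part of the affine map [xia], whose constant part is [w]. *)
Let X x := invmx Ma *m (2%:C *: (Bc *m x)).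
Let w := invmx Ma *m l.

Let xiaE x : xia x = X x + w.
Proof. by rewrite /xia mulmxDr. Qed.

Let MaX x : Ma *m X x = 2%:C *: (Bc *m x).
Proof. by rewrite /X mulKVmx ?Ma_unit. Qed.

Let MKm : MK = Ma - Bc.
Proof.
apply/matrixP => i j; rewrite !mxE.
have -> : (2%:C : C) = 2 by rewrite rmorph_nat.
by ring.
Qed.

Let MKE p : MK *m p = Ma *m p - Bc *m p.
Proof.
by rewrite MKm mulmxBl.
Qed.

Let XE x : invmx MK *m (Bc *m (2%:C *: x - X x)) = X x.
Proof.
have -> : Bc *m (2%:C *: x - X x) = MK *m X x.
  by rewrite MKE MaX mulmxBr -scalemxAr.
by rewrite mulKmx ?MK_unit.
Qed.

(** The point of comparison: at $p=2x-\xi_a(x)$ the two integrands share their critical point, since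
    $M_K=M_a-B$. *)
Let xiK_xia x : xK (2%:C *: x - xia x) = xia x.
Proof.
rewrite /xiK.
have -> : Bc *m (2%:C *: x - xia x) + l = MK *m xia x.
  by rewrite MKE Ma_xia // mulmxBr -scalemxAr addrAC.
by rewrite mulKmx ?MK_unit.
Qed.

Let MKinv p y : bil MK (invmx MK *m (Bc *m p)) y = bil Bc p y.
Proof.
rewrite (bilC _ _ (sMK sB sQ)) bil_mulr mulmxV ?MK_unit // bil_mulr mul1mx.
by rewrite (bilC _ _ sBc).
Qed.

(** Take $p=2s-Xs$ and $r=\overline{Xs}$ in [kernel_form_le2]. Then $E(p,r)=N(Xs)$, so
    $2N(Xs)\le4B(s,s)-4\operatorname{Re}B(s,Xs)+2N(Xs)$ and the terms $N(Xs)$ cancel. *)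
Let X_contraction s : ReC (bil Bc (cv s) (X (cv s))) <= ReC (bil Bc (cv s) (cv s)).
Proof.
set x := cv s; have := kernel_form_le2 (2%:C *: x - X x) (cj (X x)).
rewrite -bilE_xi XE (bilC _ _ (sMK sB sQ)) MKinv.
rewrite NN_cj NND -[- X x]scaleN1r !NNZ sqr_normc sqr_normc.
rewrite cjZ /x cj_cv bilZl bilZr /NN cj_cv.
move: (ReC (bil Bc (cj (X (cv s))) (X (cv s)))) => N.
move: (bil Bc (cv s) (cv s)) (bil Bc (cv s) (X (cv s))) => [b1 b2] [d1 d2] /=.
by nra.
Qed.

                                             
Let A x := bil Ma (xia x) (xia x) - 2 * bil Bc x x.

(** The kernel bound at $p=2s-\xi$ with $\xi=\xi_a(s)$: by [xiK_xia] and $M_K=M_a-B$ the slack is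
    $N(2s-\xi)+\operatorname{Re}B(\xi,\xi)-2B(s,s)$, which equals
    $N(\xi-s)+\operatorname{Re}B(\xi-s,\xi-s)=2B(\operatorname{Re}\xi-s)$. *)
Let A_bound : exists D', forall s, ReC (A (cv s)) <= D' +
  2 * qf B (tadd (tscale (-1) s) (ret (xia (cv s)))).
Proof.
have [D' h] := kernel_exponent_bound; exists D' => s.
have := h (2%:C *: cv s - xia (cv s)); rewrite xiK_xia.
have -> : bil MK (xia (cv s)) (xia (cv s)) =
    bil Ma (xia (cv s)) (xia (cv s)) - bil Bc (xia (cv s)) (xia (cv s)).
  by rewrite MKm bilDm bilNm.
rewrite /A.
set y := xia (cv s).
have := NN_decomposition (y - cv s).
have -> : ret (y - cv s) = tadd (tscale (-1) s) (ret y).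
  by apply: eq_from_tnth => i; rewrite !tnth_mktuple !mxE ReB mulN1r.
move=> <-.
rewrite !NND -[- cv s]scaleN1r -[- y]scaleN1r !NNZ !sqr_normc.
rewrite bilDl !bilDr !bilZl !bilZr (bilC (cv s) y sBc).
rewrite cjZ cj_cv bilZl.
have := ReBc_cj y (cv s); rewrite cj_cv (bilC (cv s) y sBc).
have : NNB (cv s) = ReC (bil Bc (cv s) (cv s)) by rewrite /NN cj_cv.
move: (bil Bc (cj y) (cv s)) (bil Bc y (cv s)) (bil Bc y y) (bil Bc (cv s) (cv s)).
move: (bil Ma y y) (NNB y) (NNB (cv s)).
move=> [a1 a2] x z [b1 b2] [d1 d2] [e1 e2] [f1 f2] /= -> ->.
by lra.
Qed.

Let cr (x : 'cV[R]_m) : 'cV[C]_m := map_mx (real_complex R) x.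
(** Minus the quadratic part of $\operatorname{Re}A$ on real vectors; [bm] below is the linear
    part. *)
Let Pm : 'M[R]_m := remx (2%:C *: Bc - 4%:C *: (Bc *m invmx Ma *m Bc)).

Let sPm : Pm^T = Pm.
Proof.
rewrite /Pm /remx map_trmx; congr map_mx.
have e : (Bc *m invmx Ma *m Bc)^T = Bc *m invmx Ma *m Bc.
  by rewrite !trmx_mul trmx_inv sMa // sBc mulmxA.
apply/matrixP => i j; have := congr1 (fun N : 'M[C]_m => N i j) e.
have := congr1 (fun N : 'M[C]_m => N i j) sBc.
by rewrite !mxE => -> ->.
Qed.

Let tupleE (x : 'cV[R]_m) : cv [tuple x i 0 | i < m] = cr x.
Proof. by apply/matrixP => i j; rewrite !mxE tnth_mktuple (ord1 j). Qed.

Let Re_cr M (x y : 'cV[R]_m) : ReC (bil M (cr x) (cr y)) = (x^T *m remx M *m y) 0 0.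
Proof.
rewrite bilE Re_sum !mxE.
under [RHS]eq_bigr do rewrite mxE mulr_suml.
rewrite exchange_big /=; apply: eq_bigr => i _; rewrite Re_sum; apply: eq_bigr => j _.
by rewrite !mxE !ReMC; ring.
Qed.

Let Re_crr M x (y : 'cV[R]_m) : ReC (bil M x (cr y)) = (map_mx (@ReC R) (x^T *m M) *m y) 0 0.
Proof.
rewrite /bil !mxE Re_sum; apply: eq_bigr => i _.
by rewrite [in RHS]mxE [cr y _ _]mxE ReMC.
Qed.

Let BX y x : bil Bc y (X x) = 2%:C * bil (Bc *m invmx Ma *m Bc) y x.
Proof. by rewrite /X -scalemxAr bilZr !bil_mulr. Qed.

Let PmE y x : ReC (bil (2%:C *: Bc - 4%:C *: (Bc *m invmx Ma *m Bc)) y x) =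
  2 * ReC (bil Bc y x) - 2 * ReC (bil Bc y (X x)).
Proof.
rewrite bilDm bilNm !bilZm BX.
move: (bil Bc y x) (bil (Bc *m invmx Ma *m Bc) y x) => [b1 b2] [d1 d2] /=.
by ring.
Qed.

Let bm : 'rV[R]_m := map_mx (@ReC R) ((4%:C *: w)^T *m Bc).

Let AE (x : 'cV[R]_m) : ReC (A (cr x)) =
  - (x^T *m Pm *m x) 0 0 + (bm *m x) 0 0 + ReC (bil Ma w w).
Proof.
have MaXl y : bil Ma (X (cr x)) y = 2%:C * bil Bc (cr x) y.
  by rewrite (bil_mull _ _ (sMa sB sQ)) MaX -bilZl [RHS](bil_mull _ _ sBc) -scalemxAr.
rewrite -Re_cr PmE -Re_crr /A xiaE.
rewrite bilDl !bilDr (bilC w (X _) (sMa sB sQ)) !MaXl bilZl (bilC w (cr x) sBc).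
move: (bil Bc (cr x) (X (cr x))) (bil Bc (cr x) w) (bil Ma w w) (bil Bc (cr x) (cr x)).
by move=> [b1 b2] [d1 d2] [e1 e2] [f1 f2] /=; ring.
Qed.

(** [X_contraction] makes [Pm] positive semidefinite, and [A_bound] makes the linear part vanish on
    its null space; [semidefinite_bounded_above] then applies. *)
Lemma weyl_exponent_bound : exists S, forall s, ReC (A (cv s)) <= S.
Proof.
have crE s : cv s = cr (\col_i tnth s i) by apply/matrixP => i j; rewrite !mxE.
have [] := @semidefinite_bounded_above _ _ Pm bm sPm.
- move=> x; rewrite -Re_cr PmE -tupleE; have := X_contraction [tuple x i 0 | i < m]; lra.
- move=> x Px.
  have [D' AD] := A_bound.
  have Xx y : ReC (bil Bc (cr y) (cr x)) = ReC (bil Bc (cr y) (X (cr x))).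
    have := PmE (cr y) (cr x); rewrite Re_cr -mulmxA Px mulmx0 mxE; lra.
  pose xt : m.-tuple R := [tuple x i 0 | i < m].
  have cxt : cv xt = cr x by exact: tupleE.
  (* For [x] in the null space, $d=\operatorname{Re}X(x)-x$ is [B]-orthogonal to every real vector,
     hence zero. Along the line through [x] the slack in [A_bound] is therefore constant while
     $\operatorname{Re}A$ is affine, which forces its slope to vanish. *)
  pose d := tadd (tscale (-1) xt) (ret (X (cr x))).
  have d0 : cv d = 0.
    apply: (qf_eq0 pB); rewrite -rBc -Re_bil_cv.
    have := Xx (\col_i tnth d i); rewrite -crE => h.
    rewrite {2}cvD cvZ bilDr bilZr cxt.
    have -> : ReC (bil Bc (cv d) (cv (ret (X (cr x)))) + (-1)%:C * bil Bc (cv d) (cr x)) =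
      ReC (bil Bc (cv d) (cv (ret (X (cr x))))) - ReC (bil Bc (cv d) (cr x)).
      by rewrite ReD ReMR mulN1r.
    rewrite h {2}[X (cr x)]cv_reim bilDr bilZr.
    have im0 : ImC (bil Bc (cv d) (cv (imt (X (cr x))))) = 0.
      have := bil_conj Bc (cv d) (cv (imt (X (cr x)))); rewrite cBc !conj_cv.
      by move=> /(congr1 (@ImC R)); rewrite ImJ => h'; lra.
    move: im0; move: (bil Bc (cv d) (cv (ret (X (cr x))))) (bil Bc (cv d) (cv (imt (X (cr x))))).
    by move=> [b1 b2] [e1 e2] /= ->; ring.
  apply: (@linear_bounded_eq0 _ _ (D' + 2 * qf B (ret w) - ReC (bil Ma w w))) => s.
  have := AD (tscale s xt).
  have -> : tadd (tscale (-1) (tscale s xt)) (ret (xia (cv (tscale s xt)))) = ret w.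
    apply: eq_from_tnth => i; have := congr1 (fun z : 'cV[C]_m => ReC (z i 0)) d0.
    rewrite [cv d _ _]mxE [(0 : 'cV[C]_m) i 0]mxE !tnth_mktuple /=.
    have XZ : X (cv (tscale s xt)) = s%:C *: X (cr x).
      by rewrite /X cvZ cxt -!scalemxAr scalerA mulrC -scalerA.
    have vD (u v : 'cV[C]_m) : (u + v) i 0 = u i 0 + v i 0 by rewrite mxE.
    have vZ k (u : 'cV[C]_m) : (k *: u) i 0 = k * u i 0 by rewrite mxE.
    rewrite xiaE XZ vD vZ ReD ReMR; nra.
  have <- : cr (s *: x) = cv (tscale s xt).
    by apply/matrixP => i j; rewrite !mxE !tnth_mktuple (ord1 j).
  have ps : Pm *m (s *: x) = 0 by rewrite -scalemxAr Px scaler0.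
  have bs : (bm *m (s *: x)) 0 0 = s * (bm *m x) 0 0 by rewrite -scalemxAr [LHS]mxE.
  have z0 : (0 : 'M[R]_1) 0 0 = 0 by rewrite mxE.
  rewrite AE -mulmxA ps mulmx0 bs z0; lra.
move=> S hS; exists (S + ReC (bil Ma w w)) => s; rewrite crE AE lerD2r.
exact: hS.
Qed.

Lemma weyl_bounded_of_kernel_generic : exists S, forall s, normc (a (cv s)) <= S.
Proof.
have [S hS] := weyl_exponent_bound.
exists (normc (gauss0 Ma) * expR (S + ReC c0)) => s.
rewrite af_formula // normcM ler_wpM2l ?normc_ge0 // normc_expC ler_expR.
have := hS s; rewrite /A; move: (bil Ma _ _) (bil Bc _ _) c0 => [x1 x2] [y1 y2] [z1 z2] /=.
by lra.
Qed.

End bounded.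

Lemma cmeas_weyl : cmeas (fun t : m.-tuple R => a (cv t)).
Proof.
under eq_fun do rewrite af_formula //.
apply: cmeasM; first exact: cmeas_cst.
have cx i : cmeas (fun t : m.-tuple R => cv t i 0) by apply: (@cmeas_cv R m _ _ id); exact: measurable_id.
have cmx (N : 'M[C]_m) (f : m.-tuple R -> 'cV[C]_m) i : (forall i, cmeas (fun t => f t i 0)) ->
    cmeas (fun t => (N *m f t) i 0).
  move=> hf; under eq_fun do rewrite mxE.
  by apply: cmeas_sum => j; apply: cmeasM; [exact: cmeas_cst|exact: hf].
have cxi i : cmeas (fun t => xia (cv t) i 0).
  apply: (cmx) => j; under eq_fun do rewrite mxE; apply: cmeasD; last exact: cmeas_cst.
  under eq_fun do rewrite mxE; apply: cmeasM; first exact: cmeas_cst.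
  exact: cmx.
apply: cmeas_expC; apply: cmeasD; first exact: cmeas_bil.
apply: cmeasB; first exact: cmeas_cst.
by apply: cmeasM; [exact: cmeas_cst|exact: cmeas_bil].
Qed.

                                                                                
                                                                             
(** When the constant of [Kf] is zero, [Kf] vanishes identically, in particular at imaginary points
    $iy$, where it is a Fourier transform. Integrating against $e^{-B(y,y)-4iB(s,y)}$ and exchanging
    the integrals recovers the symbol, because $B(t)+B(t-2s)=2B(t-s)+2B(s)$. *)
Lemma weyl_vanishes s : gauss0 MK = 0 -> a (cv s) = 0.
Proof.
move=> g0.
have K0 p : K p = 0 by rewrite Kf_formula // g0 mul0r.
pose F (rt : m.-tuple R * m.-tuple R) :=
  expC (q (cv rt.2) - bil Bc (cv rt.2) (cv rt.2)) *
  expC (- bil Bc (cv rt.1) (cv rt.1) + 2 * bil Bc ('i *: (cv rt.2 - 2%:C *: cv s)) (cv rt.1)).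
have c1 (i : 'I_m) : cmeas (fun rt : m.-tuple R * m.-tuple R => cv rt.1 i 0).
  by apply: cmeas_cv; exact: measurable_fst.
have c2 (i : 'I_m) : cmeas (fun rt : m.-tuple R * m.-tuple R => cv rt.2 i 0).
  by apply: cmeas_cv; exact: measurable_snd.
have mF : cmeas F.
  apply: cmeasM; apply: cmeas_expC.
    apply: cmeasB; last exact: cmeas_bil.
    apply: cmeasD; last exact: cmeas_cst.
    apply: cmeasD; first exact: cmeas_bil.
    apply: cmeasM; first exact: cmeas_cst.
    by apply: cmeas_bil => // i; exact: cmeas_cst.
  apply: cmeasD; first by apply: cmeasN; exact: cmeas_bil.
  apply: cmeasM; first exact: cmeas_cst.
  apply: cmeas_bil => // i; under eq_fun do rewrite mxE; apply: cmeasM; first exact: cmeas_cst.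
  by under eq_fun do rewrite mxE; apply: cmeasD; last exact: cmeas_cst.
have im0 t t' : ImC (bil Bc (cv t) (cv t')) = 0.
  have := bil_conj Bc (cv t) (cv t'); rewrite cBc !conj_cv.
  by move=> /(congr1 (@ImC R)); rewrite ImJ => h; lra.
pose k := (\int[leb]_t (normc (expC (q (cv t) - bil Bc (cv t) (cv t))))%:E)%E.
have cK : cintg leb (fun t => expC (q (cv t) - bil Bc (cv t) (cv t))).
  apply: eq_cintg (cintg_K l c0 sB sQ pB pQ 0) => t.
  by rewrite bil0l mulr0 addr0.
have normF y t : normc (F (y, t)) = normc (expC (- bil Bc (cv y + 0) (cv y + 0))) *
    normc (expC (q (cv t) - bil Bc (cv t) (cv t))).
  rewrite /F normcM mulrC; congr (_ * _); rewrite !normc_expC addr0; congr expR.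
  rewrite ReD ReN bilZl bilDl bilNl bilZl.
  move: (im0 t y) (im0 s y); move: (bil Bc (cv t) (cv y)) (bil Bc (cv s) (cv y)) (bil Bc (cv y) (cv y)).
  by move=> [x1 x2] [y1 y2] [z1 z2] /= -> ->; ring.
have pBc : tpos (remx Bc) by rewrite rBc.
have finF : (\int[leb]_y \int[leb]_t (normc (F (y, t)))%:E < +oo)%E.
  have -> : (\int[leb]_y \int[leb]_t (normc (F (y, t)))%:E =
      \int[leb]_y ((normc (expC (- bil Bc (cv y + 0) (cv y + 0))))%:E * k))%E.
    apply: eq_integral => y _; rewrite /k -ge0_integralZl //.
    - by apply: eq_integral => t _; rewrite normF EFinM.
    - by apply/measurable_EFinP; exact: measurable_normc cK.1.
    - by move=> t _; rewrite lee_fin normc_ge0.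
    - by rewrite lee_fin normc_ge0.
  have k0 : (0 <= k)%E by apply: integral_ge0 => t _; rewrite lee_fin normc_ge0.
  have cB := cintg_gauss pBc 0.
  have I0 : (0 <= \int[leb]_y (normc (expC (- bil Bc (cv y + 0) (cv y + 0))))%:E)%E.
    by apply: integral_ge0 => t _; rewrite lee_fin normc_ge0.
  rewrite ge0_integralZr //; first last.
  - by move=> t _; rewrite lee_fin normc_ge0.
  - by apply/measurable_EFinP; exact: measurable_normc cB.1.
  by apply: lte_mul_pinfty; [|rewrite ge0_fin_numE; [exact: cB.2|]|exact: cK.2].
have h := cfubini mF finF.
have L0 : cint leb (fun y => cint leb (fun t => F (y, t))) = 0.
  transitivity (cint leb (fun _ : m.-tuple R => (0 : C))); last exact: cint0.
  apply: eq_cint => y.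
  pose e := expC (- bil Bc (cv y) (cv y) - 4 * ('i * bil Bc (cv s) (cv y))).
  transitivity (e * K ('i *: cv y)); last by rewrite K0 mulr0.
  rewrite /Kf -cintZ; last exact: cintg_K.
  apply: eq_cint => t; rewrite /F /e /= -!expCD; congr expC.
  rewrite !bilZl bilDl bilNl bilZl (bilC (cv y) (cv t) sBc).
  have -> : (2%:C : C) = 2 by rewrite rmorph_nat.
  move: (bil _ _ _) (bil _ _ _) (bil _ _ _) (bil _ _ _) (q _) => x1 x2 x3 x4 x5.
  by ring.
have Rt : cint leb (fun t => cint leb (fun y => F (y, t))) =
    a (cv s) * (expC (- (2 * bil Bc (cv s) (cv s))) * gauss0 Bc).
  rewrite -cintZr; last exact: cintg_a.
  apply: eq_cint => t.
  have cG := cintg_formula ('i *: (cv t - 2%:C *: cv s)) sBc pBc.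
  apply: etrans (cintZ (expC (q (cv t) - bil Bc (cv t) (cv t))) cG) _.
  rewrite (gauss_formula _ sBc pBc) [LHS]mulrA [RHS]mulrA -!expCD; congr (expC _ * _).
  rewrite !(bilZl, bilZr) !(bilDl, bilDr) !(bilNl, bilNr) !(bilZl, bilZr).
  rewrite (bilC (cv s) (cv t) sBc).
  have -> : (2%:C : C) = 2 by rewrite rmorph_nat.
  have ii (z : C) : 'i * ('i * z) = - z.
    by move: z => [z1 z2]; apply: complexP => /=; ring.
  rewrite ii -/Bc.
  move: (bil _ (cv t) (cv t)) (bil _ (cv t) (cv s)) (bil _ (cv s) (cv s)) (q _).
  by move=> x1 x2 x3 x4; ring.
have : a (cv s) * (expC (- (2 * bil Bc (cv s) (cv s))) * gauss0 Bc) = 0.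
  by rewrite -Rt -L0; symmetry; exact: h.
move=> /eqP; rewrite mulf_eq0 => /orP [/eqP //|].
by rewrite mulf_eq0 (negbTE (expC_neq0 _)) (negbTE (gauss0_real pB)).
Qed.

Lemma weyl_bounded_of_kernel D : (forall p, normc (K p) <= D * expR (NNB p)) ->
  exists S, forall s, normc (a (cv s)) <= S.
Proof.
move=> KD; have [g0|g0] := eqVneq (gauss0 MK) 0; last exact: weyl_bounded_of_kernel_generic KD g0.
by exists 0 => s; rewrite weyl_vanishes // normc0.
Qed.

End kernel_to_weyl.

                                            

(** * Uniform integrability of the weighted kernel along real subspaces *)

(** A near-maximiser replaces the maximum, whose attainment would need an argument. *)
Lemma near_sup (R : realType) T (g : T -> R) D (x0 : T) :
  (forall x, g x <= D) -> exists y, forall x, g x <= g y + 1.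
Proof.
move=> gD; have hF : has_sup (range g).
  by split; [exists (g x0); exists x0|exists D => _ [x _ <-]].
have [_ [y _ <-] h0] := sup_adherent ltr01 hF.
exists y => x; have : g x <= sup (range g) by apply: ub_le_sup; [exact: hF.2|exists x].
lra.
Qed.

Section schur_bound.
Variables (R : realType) (m : nat).
Local Notation C := R[i].
Variables (B : 'M[R]_m) (Q : 'M[C]_m) (l : 'cV[C]_m) (c0 : C).
Implicit Types (p r x : 'cV[C]_m) (s t : m.-tuple R).
Hypotheses (sB : B^T = B) (sQ : Q^T = Q) (pB : tpos B)
  (pQ : tpos (B - 2 *: remx Q)).

Let Bc : 'M[C]_m := map_mx (real_complex R) B.
Let sBc : Bc^T = Bc. Proof. by rewrite /Bc map_trmx sB. Qed.
Let rBc : remx Bc = B. Proof. by apply/matrixP => i j; rewrite !mxE. Qed.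
Local Notation K := (Kf B Q l c0).
Local Notation leb := (@leb R m).
Local Notation NNB := (NN B).
Local Notation MK := (MK B Q).
Local Notation xK := (xiK B Q l).
Let E : 'M[C]_m := Bc *m invmx MK *m Bc.
Let sE : E^T = E.
Proof. by rewrite /E !trmx_mul trmx_inv sMK // sBc mulmxA. Qed.

Variable D : R.
Hypothesis KD : forall p, normc (K p) <= D * expR (NNB p).
Hypothesis g0 : gauss0 MK != 0.

(** The defect in [kernel_form_le], that is, minus the quadratic part of the logarithm of the
    weighted kernel; [phi2] is its polar form. *)
Let phi r : R := NNB r - ReC (bil E r r).
Let phi2 r p : R := ReC (bil Bc (cj r) p) - ReC (bil E r p).

Let phiD r p : phi (r + p) = phi r + phi p + 2 * phi2 r p.
Proof.
rewrite /phi /phi2 NND // bilDl !bilDr (bilC p r sE).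
move: (NNB r) (NNB p) (bil E r r) (bil E p p) (bil E r p) (bil Bc (cj r) p).
by move=> x1 x2 [y1 y2] [z1 z2] [u1 u2] [v1 v2] /=; ring.
Qed.

Let phiZ (k : R) r : phi (k%:C *: r) = k ^+ 2 * phi r.
Proof.
rewrite /phi NNZ // normcR real_normK ?num_real // bilZl bilZr.
move: (NNB r) (bil E r r) => x1 [y1 y2] /=; ring.
Qed.

Let phi2Zr (k : R) r p : phi2 r (k%:C *: p) = k * phi2 r p.
Proof. by rewrite /phi2 !bilZr !ReMR mulrBr. Qed.

Let phi_ge0 r : 0 <= phi r.
Proof. by rewrite subr_ge0; exact: (kernel_form_le sB sQ pB pQ KD g0). Qed.

Lemma linear_form_eq0 (M N : 'M[C]_m) p r : (forall x, ReC (bil M p x) = ReC (bil N r x)) ->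
  M^T = M -> N^T = N -> M *m p = N *m r.
Proof.
move=> h sM sN; apply/matrixP => i j; rewrite (ord1 j).
have e (M' : 'M[C]_m) y k : M'^T = M' -> bil M' y (k *: delta_mx i 0) = k * (M' *m y) i 0.
  move=> sM'; rewrite bilZr; congr (_ * _).
  by rewrite (bil_mull _ _ sM') /bil mulmx1 -colE mxE [LHS]mxE.
apply: complexP.
  by have := h (1 *: delta_mx i 0); rewrite !e // !mul1r.
have := h ('i *: delta_mx i 0); rewrite !e //.
move: (_ i 0) (_ i 0) => [x1 x2] [y1 y2] /=; lra.
Qed.

(** A zero of the nonnegative form [phi] annihilates its polar form. The resulting identity of
    real-linear functionals gives $B\bar r=BM_K^{-1}Br$. *)
Let phi_eq0 r : phi r = 0 -> MK *m cj r = Bc *m r.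
Proof.
move=> r0.
have p2 p : phi2 r p = 0.
  have h (s : R) : 0 <= phi p * s ^+ 2 + 2 * phi2 r p * s.
    have := phi_ge0 (r + s%:C *: p); rewrite phiD phiZ phi2Zr r0; lra.
  (* A small step against the slope; the $1$ keeps the denominator positive when [phi p] is zero. *)
  have := h (- phi2 r p / (phi p + 1)); have := phi_ge0 p.
  move: (phi p) (phi2 r p) => x c x0 hx; apply/eqP; rewrite -sqrf_eq0; apply/eqP.
  apply/eqP; rewrite eq_le sqr_ge0 andbT.
  have x1 : 0 < x + 1 by lra.
  have : 0 <= (x * (- c / (x + 1)) ^+ 2 + 2 * c * (- c / (x + 1))) * (x + 1) ^+ 2.
    by rewrite mulr_ge0 // sqr_ge0.
  have -> : (x * (- c / (x + 1)) ^+ 2 + 2 * c * (- c / (x + 1))) * (x + 1) ^+ 2 =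
      - (c ^+ 2 * (x + 2)) by field; rewrite gt_eqF.
  rewrite oppr_ge0 pmulr_lle0 //; lra.
have h : Bc *m cj r = E *m r.
  apply: (@linear_form_eq0 Bc E (cj r) r _ sBc sE) => x; have := p2 x; rewrite /phi2.
  by move=> /eqP; rewrite subr_eq0 => /eqP.
have h2 : cj r = invmx MK *m (Bc *m r).
  have uB : Bc \in unitmx by apply: tpos_unitmx => //; rewrite rBc.
  by rewrite -[LHS](mulKmx uB) h /E -!mulmxA mulKmx.
by rewrite h2 mulKVmx // MK_unit.
Qed.

(** Logarithm of the weighted kernel $|K|e^{-N}$ up to an additive constant; [f_midpoint] is its
    exact second difference. *)
Let f p : R := ReC (bil MK (xK p) (xK p)) - NNB p.

Let f_midpoint p r : f (p + r) + f (p - r) = 2 * f p - 2 * phi r.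
Proof.
pose e (y : 'cV[C]_m) := invmx MK *m (Bc *m y).
have fE y : f (p + y) = f p + 2 * (ReC (bil MK (xK p) (e y)) - ReC (bil Bc (cj p) y)) - phi y.
  have -> : f (p + y) = ReC (bil MK (xK p + e y) (xK p + e y)) - NNB (p + y).
    by rewrite /f /xiK !mulmxDr addrAC.
  rewrite NND // bilDl bilDr bilDr (bilC (e y) (xK p) (sMK sB sQ)).
  rewrite [bil MK (e y) (e y)](bilE_xi sB sQ pB pQ).
  rewrite /f /phi -/E.
  move: (NNB y) (NNB p) (bil E y y) (bil MK (xK p) (xK p)) (bil MK (xK p) (e y)) (bil Bc (cj p) y).
  by move=> x1 x2 [y1 y2] [z1 z2] [u1 u2] [v1 v2] /=; ring.
have eN : e (- r) = - e r by rewrite /e !mulmxN.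
rewrite !fE eN !bilNr !ReN.
have -> : phi (- r) = phi r.
  by rewrite -scaleN1r -(rmorphN1 (real_complex R)) phiZ sqrrN expr1n mul1r.
move: (ReC _) (ReC _) (f p) (phi r) => x1 x2 x3 x4.
by ring.
Qed.

Lemma cmeas_mulmx (d : measure_display) (T : measurableType d) (N : 'M[C]_m) (h : T -> 'cV[C]_m) i :
  (forall i, cmeas (fun w => h w i 0)) -> cmeas (fun w => (N *m h w) i 0).
Proof.
move=> mh; under eq_fun do rewrite mxE.
by apply: cmeas_sum => j; apply: cmeasM; [exact: cmeas_cst|exact: mh].
Qed.

Lemma cmeas_Kf (d : measure_display) (T : measurableType d) (h : T -> 'cV[C]_m) :
  (forall i, cmeas (fun w => h w i 0)) -> cmeas (fun w => K (h w)).
Proof.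
move=> mh; under eq_fun do rewrite Kf_formula //.
apply: cmeasM; first exact: cmeas_cst.
have mxi i : cmeas (fun w => xK (h w) i 0).
  apply: cmeas_mulmx => j; under eq_fun do rewrite mxE.
  by apply: cmeasD; [exact: cmeas_mulmx|exact: cmeas_cst].
by apply: cmeas_expC; apply: cmeasD; [exact: cmeas_bil|exact: cmeas_cst].
Qed.

Lemma measurable_NN (d : measure_display) (T : measurableType d) (h : T -> 'cV[C]_m) :
  (forall i, cmeas (fun w => h w i 0)) -> measurable_fun setT (fun w => NNB (h w)).
Proof.
move=> mh; suff [] : cmeas (fun w => bil Bc (cj (h w)) (h w)) by [].
apply: cmeas_bil => // i; under eq_fun do rewrite mxE.
exact: cmeasJ.
Qed.

Section direction.
Variable V : 'M[C]_m.
(** The real subspace parametrised by [V] meets the null directions of [phi], as described by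
    [phi_eq0], only at the origin. *)
Hypothesis Vinj : forall t, MK *m cj (V *m cv t) = Bc *m (V *m cv t) -> cv t = 0.

Let cVE : exists N : 'M[R]_m, forall t, phi (V *m cv t) = qf N t.
Proof.
exists (remx ((map_mx conjc V)^T *m Bc *m V - V^T *m E *m V)) => t.
rewrite -Re_bil_cv bilDm bilNm ReD ReN; congr (_ - _).
  by rewrite /NN /cj map_mxM conj_cv /bil !trmx_mul !mulmxA.
by rewrite /bil !trmx_mul !mulmxA.
Qed.

                                                                                
                                                                             
(** On the range of [V] the form [phi] is positive definite, so [f] is strictly concave along it,
    with a Hessian that does not depend on [p]. It is bounded above by [D'] uniformly, so around a
    near-maximum it decays like a fixed Gaussian, and the integral is bounded independently of
    [p]. *)
Lemma schur_bound_generic : exists S, forall p,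
  (\int[leb]_t (normc (K (p + V *m cv t)) * expR (- NNB (p + V *m cv t)))%:E <= S%:E)%E.
Proof.
have [N phiN] := cVE.
have pN : tpos N.
  move=> t [i ti]; rewrite -phiN lt_def phi_ge0 andbT; apply: contraNneq ti => /phi_eq0 /Vinj.
  by move=> /(congr1 (fun z : 'cV[C]_m => ReC (z i 0))); rewrite !mxE /= => ->.
have [D' hD] := kernel_exponent_bound sB sQ pB pQ KD g0.
have fD p : f p <= D' by rewrite lerBlDr; exact: hD.
pose N2 : 'M[R]_m := 4^-1 *: N.
have pN2 : tpos N2 by apply: tposZ.
have Nfin : (\int[leb]_t (expR (- qf N2 t))%:E < +oo)%E.
  have e2 : remx (map_mx (real_complex R) N2) = N2.
    by apply/matrixP => i j; rewrite !mxE.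
  have pc2 : tpos (remx (map_mx (real_complex R) N2)) by rewrite e2.
  have := (cintg_gauss pc2 0).2; congr (_ < _)%E; apply: eq_integral => s _.
  by rewrite addr0 normc_expC ReN Re_bil_cv e2.
have mN : measurable_fun setT (fun t : m.-tuple R => (expR (- qf N2 t))%:E).
  apply/measurable_EFinP; apply: (measurableT_comp (@measurable_expR R)).
  by apply: measurable_funN; exact: measurable_qf.
pose J := fine (\int[leb]_t (expR (- qf N2 t))%:E).
pose G := normc (gauss0 MK) * expR (ReC c0).
have G0 : 0 <= G by rewrite mulr_ge0 ?normc_ge0 ?expR_ge0.
exists (G * expR (D' + 1) * J) => p.
have KE t : normc (K (p + V *m cv t)) * expR (- NNB (p + V *m cv t)) =
    G * expR (f (p + V *m cv t)).
  rewrite Kf_formula // normcM normc_expC ReD expRD /f expRB expRN.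
  rewrite /G; move: (expR _) (expR _) (expR _)^-1 (normc _) => x1 x2 x3 x4; ring.
have [t0 ht0] : exists t0, forall t, f (p + V *m cv t) <= f (p + V *m cv t0) + 1.
  by apply: (near_sup [tuple 0 | i < m]) => t; exact: fD.
have fE t : f (p + V *m cv t) <= D' + 1 - qf N2 (tadd (tscale (-1) t0) t).
  set d := tadd _ _.
  have dE : cv d = cv t - cv t0 by rewrite cvD cvZ rmorphN1 scaleN1r.
  (* The second difference between [t], [t0] and their midpoint:
     $f(t)+f(t_0)=2f(mid)-\frac12N(t-t_0)$, with $f(mid)\le D'$ and $f(t_0)\ge f(t)-1$. *)
  pose mid := p + (2^-1 : R)%:C *: (V *m (cv t + cv t0)).
  pose r := (2^-1 : R)%:C *: (V *m cv d).
  have h2 : (2^-1 : R)%:C + (2^-1 : R)%:C = 1 :> C.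
    by rewrite -rmorphD /=; apply: complexP => //=; field.
  have := f_midpoint mid r.
  have -> : mid + r = p + V *m cv t.
    rewrite /mid /r -addrA -scalerDr -mulmxDr dE addrACA subrr addr0.
    by rewrite mulmxDr scalerDr -scalerDl h2 scale1r.
  have -> : mid - r = p + V *m cv t0.
    rewrite /mid /r -addrA -scalerBr -mulmxBr dE opprB [cv t + _]addrC addrACA subrr addr0.
    by rewrite mulmxDr scalerDr -scalerDl h2 scale1r.
  rewrite phiZ phiN /N2 qfZ.
  have := fD mid; have := ht0 t; have := fD (p + V *m cv t).
  move: (f (p + V *m cv t)) (f (p + V *m cv t0)) (f mid) (qf N d) => x1 x2 x3 x4.
  by lra.
have -> : ((G * expR (D' + 1) * J)%:E = (G * expR (D' + 1))%:E *
    \int[leb]_t (expR (- qf N2 (tadd (tscale (-1) t0) t)))%:E)%E.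
  rewrite ((preserves_tshift (tnth (tscale (-1) t0))).2
    (fun s => (expR (- qf N2 s))%:E)) //.
  by rewrite EFinM fineK // ge0_fin_numE // integral_ge0 // => s _; rewrite lee_fin expR_ge0.
have mN' : measurable_fun setT (fun t : m.-tuple R => (expR (- qf N2 (tadd (tscale (-1) t0) t)))%:E).
  by apply: (measurableT_comp mN); exact: measurable_tshift.
rewrite -ge0_integralZl //; first last.
  by rewrite lee_fin mulr_ge0 ?expR_ge0.
have cV i : cmeas (fun t : m.-tuple R => (p + V *m cv t) i 0).
  under eq_fun do rewrite mxE; apply: cmeasD; first exact: cmeas_cst.
  by apply: cmeas_mulmx => j; apply: (@cmeas_cv R m _ _ id); exact: measurable_id.
apply: ge0_le_integral => //.
- by move=> t _; rewrite lee_fin mulr_ge0 ?normc_ge0 ?expR_ge0.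
- apply/measurable_EFinP; apply: measurable_funM.
    by apply: measurable_normc; exact: cmeas_Kf.
  apply: (measurableT_comp (@measurable_expR R)); apply: measurable_funN.
  exact: measurable_NN.
- by apply: emeasurable_funM => //; exact: measurable_cst.
move=> t _; have ht := fE t.
rewrite KE -EFinM lee_fin -[leRHS]mulrA; apply: ler_wpM2l => //.
by rewrite -expRD ler_expR.
Qed.

End direction.
End schur_bound.

(** Adds the degenerate case in which the kernel is identically zero. *)
Lemma schur_bound (R : realType) m (B : 'M[R]_m) (Q : 'M[R[i]]_m) l c0 D (V : 'M[R[i]]_m) :
  B^T = B -> Q^T = Q -> tpos B -> tpos (B - 2 *: remx Q) ->
  (forall p, normc (Kf B Q l c0 p) <= D * expR (NN B p)) ->
  (forall t, MK B Q *m cj (V *m cv t) = map_mx (real_complex R) B *m (V *m cv t) -> cv t = 0) ->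
  exists S, forall p, (\int[@leb R m]_t
    (normc (Kf B Q l c0 (p + V *m cv t)) * expR (- NN B (p + V *m cv t)))%:E <= S%:E)%E.
Proof.
move=> sB sQ pB pQ KD Vinj.
have [g0|g0] := eqVneq (gauss0 (MK B Q)) 0; last exact: schur_bound_generic KD g0 _ Vinj.
exists 0 => p; under eq_integral do rewrite Kf_formula // g0 mul0r normc0 mul0r.
by rewrite integral0.
Qed.

                            

(** * Wirtinger derivatives of quadratic forms in $(x,\bar x)$ *)

Section wirtinger_quadratic.
Variables (R : realType) (n : nat).
Local Notation C := R[i].
Implicit Types (x v : 'cV[C]_n) (P : 'M[C]_(n + n)) (k j : 'I_n).

Lemma derive1_quadratic (a b c : R) : derive1 (fun t : R => a + t * b + t ^+ 2 * c) 0 = b.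
Proof.
have -> : (fun t : R => a + t * b + t ^+ 2 * c) = horner (a%:P + b *: 'X + c *: ('X * 'X)).
  apply/funext => t /=; rewrite !(hornerD, hornerZ, hornerM, hornerX, hornerC).
  by rewrite expr2 [b * t]mulrC [c * _]mulrC.
rewrite -derivE !(derivD, derivZ, derivC, derivM, derivX).
rewrite !(hornerD, hornerZ, hornerM, hornerX, hornerC) hornerE; ring.
Qed.

Lemma Dreal_quadratic (f : 'cV[C]_n -> C) x v (b c : C) :
  (forall t : R, f (x + t%:C *: v) = f x + t%:C * b + (t ^+ 2)%:C * c) -> Dreal v f x = b.
Proof.
move=> h; rewrite /Dreal; apply: complexP => /=.
  rewrite -[RHS](derive1_quadratic (ReC (f x)) _ (ReC c)); congr (derive1 _ 0).
  by apply/funext => t; rewrite h !ReD !ReMR.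
rewrite -[RHS](derive1_quadratic (ImC (f x)) _ (ImC c)); congr (derive1 _ 0).
by apply/funext => t; rewrite h !ImD !ImMR.
Qed.

Lemma xxbarD x v : xxbar (x + v) = xxbar x + xxbar v.
Proof. by rewrite /xxbar map_mxD add_col_mx. Qed.

Lemma xxbarZ (t : R) v : xxbar (t%:C *: v) = t%:C *: xxbar v.
Proof. rewrite /xxbar map_mxZ scale_col_mx; congr (col_mx _ (_ *: _)).
by apply: complexP => //=; rewrite oppr0. Qed.

Lemma Dreal_principal P x v :
  Dreal v (fun y => bil P (xxbar y) (xxbar y)) x = bil (P + P^T) (xxbar v) (xxbar x).
Proof.
apply: (@Dreal_quadratic _ _ _ _ (bil P (xxbar v) (xxbar v))) => t.
have bT y z : bil P^T y z = bil P z y.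
  transitivity (((z^T *m P *m y)^T) 0 0); last by rewrite mxE.
  by rewrite /bil !trmx_mul trmxK mulmxA.
rewrite xxbarD xxbarZ bilDm bT !(bilDl, bilDr, bilZl, bilZr).
have -> : (t ^+ 2)%:C = t%:C * t%:C by apply: complexP => /=; ring.
by move: (bil _ _ _) (bil _ _ _) (bil _ _ _) (bil _ _ _) (t%:C) => x1 x2 x3 x4 x5; ring.
Qed.

Lemma Dreal_linear (u : 'cV[C]_(n + n)) x v :
  Dreal v (fun y => bil 1%:M u (xxbar y)) x = bil 1%:M u (xxbar v).
Proof.
apply: (@Dreal_quadratic _ _ _ _ 0) => t.
by rewrite xxbarD xxbarZ bilDr bilZr mulr0 addr0.
Qed.

Lemma xxbar_evec k : xxbar (evec R k) = delta_mx (lshift n k) 0 + delta_mx (rshift n k) 0.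
Proof.
apply/matrixP => i j; rewrite (ord1 j) -(splitK i) [RHS]mxE /xxbar /evec.
case: (fintype.split i) => i' /=; rewrite ?col_mxEu ?col_mxEd !mxE eqxx !andbT.
  by rewrite ?eq_lshift eq_lrshift addr0.
rewrite ?eq_rshift eq_rlshift add0r; case: eqP => _ /=; apply: complexP => //=; exact: oppr0.
Qed.

Lemma xxbar_ievec k :
  xxbar ('i *: evec R k) = 'i *: delta_mx (lshift n k) 0 - 'i *: delta_mx (rshift n k) 0.
Proof.
rewrite /xxbar.
have e : xxbar (evec R k) = delta_mx (lshift n k) 0 + delta_mx (rshift n k) 0 := xxbar_evec k.
have cjI (v : 'cV[C]_n) : map_mx conjc ('i *: v) = - 'i *: map_mx conjc v.
  by apply/matrixP => i j; rewrite !mxE; move: (v i j) => [a b]; apply: complexP => /=; ring.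
rewrite cjI.
have e1 : col_mx (evec R k) 0 = delta_mx (lshift n k) 0 :> 'cV[C]_(n + n).
  by apply/matrixP => i j; rewrite (ord1 j) -(splitK i); case: (fintype.split i) => i' /=;
    rewrite ?col_mxEu ?col_mxEd !mxE ?eq_lshift ?eq_rlshift.
have e2 : col_mx 0 (map_mx conjc (evec R k)) = delta_mx (rshift n k) 0 :> 'cV[C]_(n + n).
  move: e; rewrite /xxbar -{1}[evec R k]addr0 -[map_mx _ _]add0r -add_col_mx e1.
  by rewrite ?add0r => /addrI.
by rewrite -e1 -e2 -scaleNr !scale_col_mx add_col_mx !scaler0 addr0 add0r.
Qed.

Let linE (u : 'cV[C]_(n + n)) i : bil 1%:M u (delta_mx i 0) = u i 0.
Proof. by rewrite /bil mulmx1 -colE !mxE. Qed.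

Lemma dz_principal P k x :
  dz k (fun y => bil P (xxbar y) (xxbar y)) x = ((P + P^T) *m xxbar x) (lshift n k) 0.
Proof.
have sP : (P + P^T)^T = P + P^T by rewrite linearD /= trmxK addrC.
rewrite /dz !Dreal_principal ![bil _ (xxbar (_ : 'cV_n)) (xxbar x)](bilC _ _ sP).
rewrite xxbar_evec xxbar_ievec !(bilDr, bilNr, bilZr) !(bil_mull _ _ sP) !linE.
set a := _ (lshift n k) 0; set b := _ (rshift n k) 0.
have ii (z : C) : 'i * ('i * z) = - z.
  by move: z => [z1 z2]; apply: complexP => /=; ring.
by rewrite mulrBr !ii; field.
Qed.

Lemma dzbar_principal P k x :
  dzbar k (fun y => bil P (xxbar y) (xxbar y)) x = ((P + P^T) *m xxbar x) (rshift n k) 0.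
Proof.
have sP : (P + P^T)^T = P + P^T by rewrite linearD /= trmxK addrC.
rewrite /dzbar !Dreal_principal ![bil _ (xxbar (_ : 'cV_n)) (xxbar x)](bilC _ _ sP).
rewrite xxbar_evec xxbar_ievec !(bilDr, bilNr, bilZr) !(bil_mull _ _ sP) !linE.
set a := _ (lshift n k) 0; set b := _ (rshift n k) 0.
have ii (z : C) : 'i * ('i * z) = - z.
  by move: z => [z1 z2]; apply: complexP => /=; ring.
by rewrite mulrBr !ii; field.
Qed.

Lemma dz_linear (u : 'cV[C]_(n + n)) k x :
  dz k (fun y => bil 1%:M u (xxbar y)) x = u (lshift n k) 0.
Proof.
rewrite /dz !Dreal_linear xxbar_evec xxbar_ievec !(bilDr, bilNr, bilZr) !linE.
have ii (z : C) : 'i * ('i * z) = - z.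
  by move: z => [z1 z2]; apply: complexP => /=; ring.
by rewrite mulrBr !ii; field.
Qed.

Lemma dzbar_linear (u : 'cV[C]_(n + n)) k x :
  dzbar k (fun y => bil 1%:M u (xxbar y)) x = u (rshift n k) 0.
Proof.
rewrite /dzbar !Dreal_linear xxbar_evec xxbar_ievec !(bilDr, bilNr, bilZr) !linE.
have ii (z : C) : 'i * ('i * z) = - z.
  by move: z => [z1 z2]; apply: complexP => /=; ring.
by rewrite mulrBr !ii; field.
Qed.

Let entryE (N : 'M[C]_(n + n)) i x : (N *m xxbar x) i 0 = bil 1%:M (row i N)^T (xxbar x).
Proof. by rewrite /bil trmxK mulmx1 -row_mul [RHS]mxE. Qed.

(** The derivative in $\bar x_k$ selects a lower row of the symmetrised matrix and the one in $x_j$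
    a left column, whence the transposed lower left block. *)
Lemma dz_dzbar_principal P x :
  dz_dzbar (fun y => bil P (xxbar y) (xxbar y)) x = (dlsubmx (P + P^T))^T.
Proof.
apply/matrixP => j k; rewrite !mxE.
have -> : dzbar k (fun y => bil P (xxbar y) (xxbar y)) =
    (fun y => bil 1%:M (row (rshift n k) (P + P^T))^T (xxbar y)).
  by apply/funext => y; rewrite dzbar_principal entryE.
by rewrite dz_linear !mxE.
Qed.

Lemma dzbar_dz_principal P x :
  \matrix_(j, k) dzbar j (dz k (fun y => bil P (xxbar y) (xxbar y))) x = dlsubmx (P + P^T).
Proof.
apply/matrixP => j k; rewrite !mxE.
have -> : dz k (fun y => bil P (xxbar y) (xxbar y)) =
    (fun y => bil 1%:M (row (lshift n k) (P + P^T))^T (xxbar y)).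
  by apply/funext => y; rewrite dz_principal entryE.
by rewrite dzbar_linear !mxE addrC.
Qed.
End wirtinger_quadratic.

(** * The Hermitian part of the weight *)

Section hermitian_form.
Variables (R : realType) (n : nat).
Local Notation C := R[i].
Implicit Types (x y z w : 'cV[C]_n) (H G : 'M[C]_n).

Definition hdot H z y : C := bil H (cj z) y.
Definition hsq H y : R := ReC (hdot H y y).
Definition hermitian H := map_mx conjc H = H^T.
Definition hpos H := forall y, y != 0 -> 0 < hsq H y.

Lemma bil_tr (m : nat) (M : 'M[C]_m) (x y : 'cV[C]_m) : bil M^T x y = bil M y x.
Proof.
transitivity (((y^T *m M *m x)^T) 0 0); last by rewrite mxE.
by rewrite /bil !trmx_mul trmxK mulmxA.
Qed.

Lemma hdotC H z y : hermitian H -> (hdot H z y)^*%C = hdot H y z.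
Proof. by move=> hH; rewrite /hdot bil_conj hH -/(cj _) -/(cj _) cjK bil_tr. Qed.

Lemma Im_hdot H y : hermitian H -> ImC (hdot H y y) = 0.
Proof. by move=> hH; have := congr1 (@ImC R) (hdotC y y hH); rewrite ImJ; lra. Qed.

Lemma hdot_diag H y : hermitian H -> hdot H y y = (hsq H y)%:C.
Proof. by move=> hH; apply: complexP => //=; exact: Im_hdot. Qed.

Lemma posdefmx_hermitian H : posdefmx H -> hermitian H.
Proof.
move=> [hH _]; rewrite /hermitian {1}hH; apply/matrixP => i j; rewrite !mxE.
exact: conjcK.
Qed.

Lemma posdefmx_hpos H : posdefmx H -> hpos H.
Proof.
move=> [_ hH] y /hH; rewrite /hsq /hdot /bil /cj.
have -> : (map_mx conjc y)^T = map_mx conjc y^T by rewrite map_trmx.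
by rewrite ltcE /= => /andP [].
Qed.

Lemma xxbar_split x : xxbar x = col_mx x (cj x). Proof. by []. Qed.

Lemma bil_col_mx (P : 'M[C]_(n + n)) x y z w : bil P (col_mx x y) (col_mx z w) =
  bil (ulsubmx P) x z + bil (ursubmx P) x w + (bil (dlsubmx P) y z + bil (drsubmx P) y w).
Proof.
rewrite /bil -{1}[P]submxK tr_col_mx mul_row_block mul_row_col !mulmxDl !mxE.
by rewrite addrACA.
Qed.

(** [U] expresses real and imaginary parts through $x$ and $\bar x$. *)
Lemma real_quadratic_form_xxbar (Phi : 'cV[C]_n -> R) : real_quadratic_form Phi ->
  exists P : 'M[C]_(n + n), forall x, liftC Phi x = bil P (xxbar x) (xxbar x).
Proof.
move=> [S PhiS].
pose U : 'M[C]_(n + n) := block_mx (2^-1)%:M (2^-1)%:M (- (2^-1 * 'i))%:M (2^-1 * 'i)%:M.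
exists (U^T *m map_mx (real_complex R) S *m U) => x.
have e : map_mx (real_complex R) (reim x) = U *m xxbar x.
  rewrite /U mul_block_col !mul_scalar_mx /reim map_col_mx; congr col_mx.
    apply/matrixP => i j; rewrite !mxE; move: (x i j) => [a b].
    by apply: complexP => /=; field.
  apply/matrixP => i j; rewrite !mxE; move: (x i j) => [a b].
  by apply: complexP => /=; field.
rewrite /liftC PhiS.
transitivity ((map_mx (real_complex R) ((reim x)^T *m S *m reim x)) 0 0); first by rewrite [RHS]mxE.
by rewrite !map_mxM -map_trmx e /bil trmx_mul !mulmxA.
Qed.

(** Mixed terms in $(x,\bar x)$ give [H]; the two pure blocks, one of them conjugated, give [G]. The
    last clause turns the determinant hypothesis into the invertibility of one constant matrix. *)
Lemma hermitian_part (Phi : 'cV[C]_n -> R) : real_quadratic_form Phi -> strictly_psh Phi ->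
  exists H G : 'M[C]_n, [/\ hermitian H, hpos H,
    forall x, Phi x = hsq H x + ReC (bil G x x) &
    forall (q : quad_poly R n) x,
      dz_dzbar (fun y => 2 * liftC Phi y - principal q y) x =
      (2%:C *: H - dlsubmx (coef2 q + (coef2 q)^T))^T].
Proof.
move=> /real_quadratic_form_xxbar [P PhiP] psh.
have fP : liftC Phi = (fun x => bil P (xxbar x) (xxbar x)) by apply/funext.
have pH : posdefmx (dlsubmx (P + P^T)).
  by have := psh 0; rewrite fP dzbar_dz_principal.
exists (dlsubmx (P + P^T)), (ulsubmx P + map_mx conjc (drsubmx P)); split.
- exact: posdefmx_hermitian.
- exact: posdefmx_hpos.
- move=> x; have -> : Phi x = ReC (liftC Phi x) by [].
  rewrite PhiP xxbar_split bil_col_mx bilDm.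
  have -> : bil (map_mx conjc (drsubmx P)) x x = (bil (drsubmx P) (cj x) (cj x))^*%C.
    by rewrite bil_conj -/(cj _) cjK.
  have -> : hsq (dlsubmx (P + P^T)) x = ReC (bil (dlsubmx P) (cj x) x + bil (ursubmx P) x (cj x)).
    rewrite /hsq /hdot -[bil (ursubmx P) x (cj x)]bil_tr -bilDm; congr (ReC (bil _ _ _)).
    by apply/matrixP => i j; rewrite !mxE.
  rewrite !ReD ReJ; move: (ReC _) (ReC _) (ReC _) (ReC _) => x1 x2 x3 x4; ring.
- move=> q x.
  have -> : (fun y => 2 * liftC Phi y - principal q y) =
     (fun y => bil (2%:C *: P - coef2 q) (xxbar y) (xxbar y)).
    by apply/funext => y; rewrite fP bilDm bilNm bilZm rmorph_nat.
  rewrite dz_dzbar_principal; congr (_^T).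
  by apply/matrixP => i j; rewrite !mxE; ring.
Qed.

(** Replacing $x$ by $ix$ changes the sign of the pure part and fixes the Hermitian part. *)
Lemma Phi_herm_hermitian (Phi : 'cV[C]_n -> R) H G x :
  (forall x, Phi x = hsq H x + ReC (bil G x x)) -> Phi_herm Phi x = hsq H x.
Proof.
move=> PhiE; rewrite /Phi_herm !PhiE /hsq /hdot cjZ !bilZl !bilZr.
by move: (bil H _ _) (bil G _ _) => [a1 a2] [b1 b2] /=; field.
Qed.

End hermitian_form.

(** * Real coordinates, polarisation and the kernel in complex variables *)

Section complex_coordinates.
Variables (R : realType) (n : nat).
Local Notation C := R[i].
Local Notation m := (n + n)%N.
Implicit Types (x y z w : 'cV[C]_n) (H : 'M[C]_n) (t s : m.-tuple R) (p : 'cV[C]_m).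

                                                                                
(** [Wmx] sends the real coordinates of $x$ to $(x,\bar x)$, and [Umx] is its inverse. *)
Definition Wmx : 'M[C]_m := block_mx 1%:M 'i%:M 1%:M (- 'i)%:M.
Definition Umx : 'M[C]_m :=
  block_mx (2^-1)%:M (2^-1)%:M (- (2^-1 * 'i))%:M (2^-1 * 'i)%:M.

Let ii : 'i * 'i = -1 :> C.
Proof. by apply: complexP => /=; ring. Qed.

Let half : 2^-1 + 2^-1 = 1 :> C.
Proof. by field. Qed.

Lemma xxbar_cvec t : xxbar (cvec t) = Wmx *m cv t.
Proof.
have -> : cv t = col_mx (\col_j (tnth t (lshift n j))%:C) (\col_j (tnth t (rshift n j))%:C).
  apply/matrixP => i j; rewrite (ord1 j) -(splitK i); case: (fintype.split i) => i' /=;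
    by rewrite ?col_mxEu ?col_mxEd !mxE.
rewrite /Wmx mul_block_col !mul_scalar_mx !scale1r /xxbar; congr col_mx.
  by apply/matrixP => i j; rewrite !mxE; apply: complexP => /=; ring.
by apply/matrixP => i j; rewrite !mxE; apply: complexP => /=; ring.
Qed.

Lemma UW : Umx *m Wmx = 1%:M.
Proof.
rewrite /Wmx /Umx mulmx_block -!scalar_mxM -!raddfD /= scalar_mx_block.
congr block_mx; rewrite ?mulr1 ?mulrN -?mulrA ?ii.
- by rewrite half.
- by rewrite subrr raddf0.
- by rewrite addNr raddf0.
- by rewrite mulNr -mulrA ii !mulrN1 !opprK half.
Qed.

Lemma WU : Wmx *m Umx = 1%:M.
Proof. exact: mulmx1C UW. Qed.

                                                                           
(** Polarisation: the point of the complexified space at which the coordinates $x$ and $\bar x$ take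
    the independent values $w$ and $\bar z$. Complex conjugation exchanges [w] and [z]. *)
Definition pt w z : 'cV[C]_m := Umx *m col_mx w (cj z).

Lemma W_pt w z : Wmx *m pt w z = col_mx w (cj z).
Proof. by rewrite /pt mulmxA WU mul1mx. Qed.

Lemma pt_cvec t : pt (cvec t) (cvec t) = cv t.
Proof. by rewrite /pt -xxbar_split xxbar_cvec mulmxA UW mul1mx. Qed.

Lemma pt_surj p : exists w z, p = pt w z.
Proof.
exists (usubmx (Wmx *m p)), (cj (dsubmx (Wmx *m p))).
by rewrite /pt cjK vsubmxK mulmxA UW mul1mx.
Qed.

Lemma ptD w z w' z' : pt (w + w') (z + z') = pt w z + pt w' z'.
Proof. by rewrite /pt cjD -add_col_mx mulmxDr. Qed.

Let swap : 'M[C]_m := block_mx 0 1%:M 1%:M 0.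

Lemma cj_pt w z : cj (pt w z) = pt z w.
Proof.
have -> : cj (pt w z) = map_mx conjc Umx *m col_mx (cj w) z.
  have e1 : cj (pt w z) = map_mx conjc Umx *m cj (col_mx w (cj z)) by exact: map_mxM.
  have e2 : cj (col_mx w (cj z)) = col_mx (cj w) (cj (cj z)) by exact: map_col_mx.
  by rewrite e1 e2 cjK.
have -> : map_mx conjc Umx = Umx *m swap.
  rewrite /Umx /swap mulmx_block !mulmx0 !mulmx1 !add0r !addr0 map_block_mx !map_scalar_mx.
  by congr block_mx; congr (_%:M); apply: complexP => /=; field.
by rewrite -mulmxA /swap mul_block_col !mul0mx !mul1mx add0r addr0.
Qed.

Section form.
Variables (H : 'M[C]_n) (q : quad_poly R n).
Hypotheses (hH : hermitian H) (pH : hpos H)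
  (hq : forall x, x != 0 -> ReC (principal q x) < hsq H x).

Let H2 : 'M[C]_m := block_mx 0 H^T H 0.
(** Real coordinates of $2h$; next, the symmetrised quadratic part of $q$ and half of its linear
    part, as [qc] expects them. *)
Definition Bmx : 'M[R]_m := remx (Wmx^T *m H2 *m Wmx).
Definition Qmx : 'M[C]_m := 2^-1 *: (Wmx^T *m (coef2 q + (coef2 q)^T) *m Wmx).
Definition lcv : 'cV[C]_m := 2^-1 *: (Defs.coef1 q *m Wmx)^T.

Let sH2 : H2^T = H2.
Proof. by rewrite /H2 tr_block_mx !trmx0 trmxK. Qed.

(** Taking entrywise real parts loses nothing: conjugating [Wmx] exchanges its two row blocks, and
    [H2] is invariant under that exchange combined with conjugation. *)
Let Bmx_complex : map_mx (real_complex R) Bmx = Wmx^T *m H2 *m Wmx.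
Proof.
suff h : map_mx conjc (Wmx^T *m H2 *m Wmx) = Wmx^T *m H2 *m Wmx.
  apply/matrixP => i j; have := congr1 (fun N : 'M[C]_m => ImC (N i j)) h.
  rewrite [(map_mx conjc _) i j]mxE [(map_mx (real_complex R) _) i j]mxE [Bmx _ _]mxE.
  move: (_ i j) => [a b] /= e; apply: complexP => //=; lra.
have -> : map_mx conjc (Wmx^T *m H2 *m Wmx) =
    (map_mx conjc Wmx)^T *m map_mx conjc H2 *m map_mx conjc Wmx.
  by rewrite !map_mxM map_trmx.
have -> : map_mx conjc Wmx = swap *m Wmx.
  rewrite /Wmx /swap mulmx_block !mul0mx !mul1mx !add0r !addr0 map_block_mx !map_scalar_mx.
  by congr block_mx; congr (_%:M); apply: complexP => /=; ring.
have -> : map_mx conjc H2 = block_mx 0 H H^T 0.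
  by rewrite /H2 map_block_mx !map_mx0 -map_trmx hH trmxK.
rewrite trmx_mul -!mulmxA; congr (_ *m _); rewrite !mulmxA; congr (_ *m _).
rewrite /swap tr_block_mx !trmx0 !trmx1 !mulmx_block.
by rewrite !mul0mx !mulmx0 !mul1mx !mulmx1 !add0r !addr0.
Qed.

Lemma Bmx_sym : Bmx^T = Bmx.
Proof.
by rewrite /Bmx /remx map_trmx !trmx_mul trmxK sH2 mulmxA.
Qed.

Lemma Qmx_sym : Qmx^T = Qmx.
Proof.
rewrite /Qmx linearZ /= !trmx_mul trmxK linearD /= trmxK mulmxA.
by rewrite [_^T + _]addrC.
Qed.

Lemma bil_W (N : 'M[C]_m) p p' : bil (Wmx^T *m N *m Wmx) p p' = bil N (Wmx *m p) (Wmx *m p').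
Proof. by rewrite /bil trmx_mul !mulmxA. Qed.

Lemma bil_Bmx w z w' z' :
  bil (map_mx (real_complex R) Bmx) (pt w z) (pt w' z') = hdot H z' w + hdot H z w'.
Proof.
rewrite Bmx_complex bil_W !W_pt bil_col_mx block_mxKul block_mxKur block_mxKdl block_mxKdr.
rewrite bil_tr /hdot; have b0 (y y' : 'cV[C]_n) : bil 0 y y' = 0.
  by rewrite /bil mulmx0 mul0mx mxE.
by rewrite !b0 add0r addr0.
Qed.

Lemma NN_pt w z : NN Bmx (pt w z) = hsq H w + hsq H z.
Proof. by rewrite /NN cj_pt bil_Bmx ReD addrC. Qed.

Lemma qf_Bmx t : qf Bmx t = 2 * hsq H (cvec t).
Proof.
have <- : remx (map_mx (real_complex R) Bmx) = Bmx by apply/matrixP => i j; rewrite !mxE.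
by rewrite -Re_bil_cv -pt_cvec bil_Bmx ReD mulr_natl mulr2n.
Qed.

Lemma cvec_neq0 t i : tnth t i != 0 -> cvec t != 0.
Proof.
apply: contraNneq => e; have h : cv t = 0.
  by rewrite -pt_cvec e /pt /cj map_mx0 col_mx0 mulmx0.
by have := congr1 (fun z : 'cV[C]_m => ReC (z i 0)) h; rewrite !mxE /= => ->.
Qed.

Lemma tpos_Bmx : tpos Bmx.
Proof. by move=> t [i /cvec_neq0 ti]; rewrite qf_Bmx mulr_gt0 // pH. Qed.

Lemma qeval_cvec t : qeval q (cvec t) = qc Qmx lcv (Defs.coef0 q) (cv t).
Proof.
rewrite /qeval /qc; congr (_ + _ + _).
  rewrite /principal xxbar_cvec -/(bil _ _ _) -bil_W /Qmx bilZm mulmxDr mulmxDl bilDm.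
  have -> : Wmx^T *m (coef2 q)^T *m Wmx = (Wmx^T *m coef2 q *m Wmx)^T.
    by rewrite !trmx_mul trmxK mulmxA.
  by rewrite bil_tr; field.
rewrite xxbar_cvec /lcv bilZl mulrA mulfV ?pnatr_eq0 // mul1r.
by rewrite /bil trmxK mulmx1 mulmxA.
Qed.

Lemma principal_cvec t : ReC (principal q (cvec t)) = qf (remx Qmx) t.
Proof.
rewrite -Re_bil_cv; congr ReC.
rewrite /principal xxbar_cvec -/(bil _ _ _) -bil_W /Qmx bilZm mulmxDr mulmxDl bilDm.
have -> : Wmx^T *m (coef2 q)^T *m Wmx = (Wmx^T *m coef2 q *m Wmx)^T.
  by rewrite !trmx_mul trmxK mulmxA.
by rewrite bil_tr; field.
Qed.

(** Here the assumption $\operatorname{Re}q_2<\Phi_{herm}$ enters, doubled. *)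
Lemma tpos_BQ : tpos (Bmx - 2 *: remx Qmx).
Proof.
move=> t [i /cvec_neq0 ti]; rewrite -scaleNr qfD qfZ qf_Bmx -principal_cvec.
have := hq ti; lra.
Qed.

                                                                       
(** The matrix element $\langle e^qk_z,k_w\rangle$ for the weight $e^{-2h}$; see [KcE]. *)
Definition Kc w z : C := cint (@leb R m) (fun t =>
  expC (qeval q (cvec t) - (2 * hsq H (cvec t))%:C + 2 * hdot H (cvec t) w + 2 * hdot H z (cvec t))).

Let Kc_exponent w z t (c : C) :
  c - (2 * hsq H (cvec t))%:C + 2 * hdot H (cvec t) w + 2 * hdot H z (cvec t) =
  c - bil (map_mx (real_complex R) Bmx) (cv t) (cv t) +
  2 * bil (map_mx (real_complex R) Bmx) (pt w z) (cv t).
Proof.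
rewrite -pt_cvec !bil_Bmx hdot_diag //.
have -> : (2 * hsq H (cvec t))%:C = 2 * (hsq H (cvec t))%:C by rewrite rmorphM rmorph_nat.
move: (_%:C) (hdot H (cvec t) w) (hdot H z (cvec t)) => x1 x2 x3; ring.
Qed.

Lemma Kc_Kf w z : Kc w z = Kf Bmx Qmx lcv (Defs.coef0 q) (pt w z).
Proof.
apply: eq_cint => t; rewrite qeval_cvec; congr expC.
exact: Kc_exponent.
Qed.

Lemma cintg_Kc w z : cintg (@leb R m) (fun t =>
  expC (qeval q (cvec t) - (2 * hsq H (cvec t))%:C + 2 * hdot H (cvec t) w + 2 * hdot H z (cvec t))).
Proof.
have := cintg_K lcv (Defs.coef0 q) Bmx_sym Qmx_sym tpos_Bmx tpos_BQ (pt w z).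
apply: eq_cintg => t; rewrite qeval_cvec; congr expC.
symmetry; exact: Kc_exponent.
Qed.

(** Projections onto the directions in which only [w], respectively only [z], moves. *)
Let V1 : 'M[C]_m := Umx *m block_mx 1%:M 0 0 0 *m Wmx.
Let V2 : 'M[C]_m := Umx *m block_mx 0 0 0 1%:M *m Wmx.

Let V1E t : V1 *m cv t = pt (cvec t) 0.
Proof.
rewrite /V1 -!mulmxA -xxbar_cvec xxbar_split mul_block_col !mul0mx mul1mx !addr0.
by rewrite /pt /cj map_mx0.
Qed.

Let V2E t : V2 *m cv t = pt 0 (cvec t).
Proof.
by rewrite /V2 -!mulmxA -xxbar_cvec xxbar_split mul_block_col !mul0mx mul1mx !add0r.
Qed.

Hypothesis dH : \det (2%:C *: H - dlsubmx (coef2 q + (coef2 q)^T)) != 0.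

Let MKW p p' : MK Bmx Qmx *m p = map_mx (real_complex R) Bmx *m p' ->
  (H2 - 2^-1 *: (coef2 q + (coef2 q)^T)) *m (Wmx *m p) = H2 *m (Wmx *m p').
Proof.
rewrite /MK Bmx_complex /Qmx.
have -> : Wmx^T *m H2 *m Wmx - 2^-1 *: (Wmx^T *m (coef2 q + (coef2 q)^T) *m Wmx) =
  Wmx^T *m ((H2 - 2^-1 *: (coef2 q + (coef2 q)^T)) *m Wmx).
  by rewrite mulmxBl mulmxBr -scalemxAl -scalemxAr !mulmxA.
rewrite -!mulmxA => /(congr1 (mulmx Umx^T)).
by rewrite !mulmxA -trmx_mul WU trmx1 !mul1mx.
Qed.

Let R2 := coef2 q + (coef2 q)^T.

Let R21 : ursubmx R2 = (dlsubmx R2)^T.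
Proof. by apply/matrixP => i j; rewrite !mxE addrC. Qed.

Let unit_H : 2%:C *: H - dlsubmx R2 \in unitmx.
Proof. by rewrite unitmxE unitfE. Qed.

Let halfH : H - 2^-1 *: dlsubmx R2 = 2^-1 *: (2%:C *: H - dlsubmx R2).
Proof. by rewrite scalerBr scalerA rmorph_nat mulVf ?scale1r // pnatr_eq0. Qed.

Let row_eq1 (A N N' : 'M[C]_n) x y : A *m 0 + N *m x = 0 *m y + N' *m 0 -> N *m x = 0.
Proof. by rewrite !mulmx0 mul0mx add0r addr0. Qed.

Let row_eq2 (A N N' : 'M[C]_n) x y : N *m x + A *m 0 = N' *m 0 + 0 *m y -> N *m x = 0.
Proof. by rewrite !mulmx0 mul0mx !addr0. Qed.

(** In the coordinates $(w,\bar z)$ the null-direction equation is a block system; its first row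
    says that the transpose of $2H-R_{21}$, with $R_{21}$ the lower left block of [R2], annihilates
    $\bar x$, and [dH] makes it invertible. The second row serves [V2_inj] in the same way. *)
Let V1_inj t : MK Bmx Qmx *m cj (V1 *m cv t) = map_mx (real_complex R) Bmx *m (V1 *m cv t) ->
  cv t = 0.
Proof.
rewrite V1E cj_pt => /MKW; rewrite !W_pt /cj map_mx0 -/(cj _) -/R2.
rewrite -[R2]submxK /H2 scale_block_mx opp_block_mx add_block_mx !mul_block_col.
move=> /eq_col_mx [+ _]; move=> /row_eq1; rewrite R21.
have -> : H^T - 2^-1 *: (dlsubmx R2)^T = (H - 2^-1 *: dlsubmx R2)^T.
  by apply/matrixP => i j; rewrite !mxE.
rewrite halfH linearZ /= -scalemxAl => /eqP; rewrite scaler_eq0 invr_eq0 pnatr_eq0 /= => /eqP h.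
have cx0 : cj (cvec t) = 0.
  by rewrite -[LHS](mulKmx (_ : (2%:C *: H - dlsubmx R2)^T \in unitmx)) ?unitmx_tr // h mulmx0.
have x0 : cvec t = 0 by rewrite -[LHS]cjK cx0 /cj map_mx0.
by rewrite -pt_cvec /pt cx0 x0 col_mx0 mulmx0.
Qed.

Let V2_inj t : MK Bmx Qmx *m cj (V2 *m cv t) = map_mx (real_complex R) Bmx *m (V2 *m cv t) ->
  cv t = 0.
Proof.
rewrite V2E cj_pt => /MKW; rewrite !W_pt /cj map_mx0 -/(cj _) -/R2.
rewrite -[R2]submxK /H2 scale_block_mx opp_block_mx add_block_mx !mul_block_col.
move=> /eq_col_mx [_ +]; move=> /row_eq2; rewrite halfH -scalemxAl => /eqP.
rewrite scaler_eq0 invr_eq0 pnatr_eq0 /= => /eqP h.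
have x0 : cvec t = 0 by rewrite -[LHS](mulKmx unit_H) h mulmx0.
by rewrite -pt_cvec /pt x0 /cj map_mx0 col_mx0 mulmx0.
Qed.

(** The condition to which both the boundedness of the operator and that of the symbol are
    reduced. *)
Definition kernel_bounded D := forall w z, normc (Kc w z) <= D * expR (hsq H w + hsq H z).

Lemma kernel_boundedE D : kernel_bounded D <->
  forall p, normc (Kf Bmx Qmx lcv (Defs.coef0 q) p) <= D * expR (NN Bmx p).
Proof.
split=> [h p|h w z]; first by have [w [z ->]] := pt_surj p; rewrite NN_pt -Kc_Kf.
by rewrite Kc_Kf -NN_pt.
Qed.

Lemma schur_second D : kernel_bounded D -> exists S, forall w,
  (\int[@leb R m]_t (normc (Kc w (cvec t)) * expR (- (hsq H w + hsq H (cvec t))))%:E <= S%:E)%E.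
Proof.
move=> /kernel_boundedE h.
have [S hS] := schur_bound Bmx_sym Qmx_sym tpos_Bmx tpos_BQ h V2_inj.
exists S => w; apply: le_trans (hS (pt w 0)); rewrite le_eqVlt; apply/orP; left; apply/eqP.
by apply: eq_integral => t _; rewrite V2E -ptD addr0 add0r NN_pt Kc_Kf.
Qed.

Lemma schur_first D : kernel_bounded D -> exists S, forall z,
  (\int[@leb R m]_t (normc (Kc (cvec t) z) * expR (- (hsq H (cvec t) + hsq H z)))%:E <= S%:E)%E.
Proof.
move=> /kernel_boundedE h.
have [S hS] := schur_bound Bmx_sym Qmx_sym tpos_Bmx tpos_BQ h V1_inj.
exists S => z; apply: le_trans (hS (pt 0 z)); rewrite le_eqVlt; apply/orP; left; apply/eqP.
by apply: eq_integral => t _; rewrite V1E -ptD addr0 add0r NN_pt Kc_Kf.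
Qed.

End form.
End complex_coordinates.

                                                 

(** * Entire functions and the reproducing formula *)

Section entire_functions.
Variables (R : realType) (n : nat).
Local Notation C := R[i].
Implicit Types (f g : 'cV[C]_n -> C) (x y : 'cV[C]_n).

Lemma entire_cst (k : C) : entire (fun _ : 'cV[C]_n => k).
Proof. by move=> x; exact: differentiable_cst. Qed.

Lemma entireD f g : entire f -> entire g -> entire (fun x => f x + g x).
Proof. by move=> hf hg x; exact: differentiableD (hf x) (hg x). Qed.

Lemma entireM f g : entire f -> entire g -> entire (fun x => f x * g x).
Proof. by move=> hf hg x; exact: differentiableM (hf x) (hg x). Qed.

Lemma entire_sum I (s : seq I) (F : I -> 'cV[C]_n -> C) :
  (forall i, entire (F i)) -> entire (fun x => \sum_(i <- s) F i x).
Proof.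
move=> hF; elim: s => [|i s IH].
  by under eq_fun do rewrite big_nil; exact: entire_cst.
by under eq_fun do rewrite big_cons; exact: entireD.
Qed.

Lemma entire_coord i : entire (fun x => x i 0).
Proof. by move=> x; exact: differentiable_coord. Qed.

Lemma entire_expC f : entire f -> entire (fun x => expC (f x)).
Proof.
move=> hf x; apply: (differentiable_comp (g := @expC R : C^o -> C^o)) => //.
exact: differentiable_expC.
Qed.

Lemma entire_bil (m : nat) (M : 'M[C]_m) (f g : 'cV[C]_n -> 'cV[C]_m) :
  (forall i, entire (fun x => f x i 0)) -> (forall i, entire (fun x => g x i 0)) ->
  entire (fun x => bil M (f x) (g x)).
Proof.
move=> hf hg; under eq_fun do rewrite bilE.
apply: entire_sum => i; apply: entire_sum => j; apply: entireM => //.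
by apply: entireM => //; exact: entire_cst.
Qed.

Lemma entire_mulmx (m k : nat) (M : 'M[C]_(k, m)) (f : 'cV[C]_n -> 'cV[C]_m) i :
  (forall i, entire (fun x => f x i 0)) -> entire (fun x => (M *m f x) i 0).
Proof.
move=> hf; under eq_fun do rewrite mxE.
by apply: entire_sum => j; apply: entireM => //; exact: entire_cst.
Qed.

Lemma entire_line f x y : entire f -> holo (fun c : C => f (x + c *: y)).
Proof.
move=> hf z; apply: diff_cder.
apply: (@differentiable_comp _ C^o ('cV[C]_n : normedModType C) C^o
  (fun c : C^o => x + c *: y) (f : _ -> C^o)); last exact: hf.
apply: differentiableD; first exact: differentiable_cst.
apply: (@differentiableZl _ _ _ (fun c : C^o => c)); exact: ex_diff.
Qed.

Lemma entire_translate f x : entire f -> entire (fun y => f (x + y)).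
Proof.
move=> hf z.
apply: (@differentiable_comp _ ('cV[C]_n : normedModType C) ('cV[C]_n : normedModType C) C^o
  (fun y => x + y) (f : _ -> C^o)); last exact: hf.
by apply: differentiableD; [exact: differentiable_cst|exact: ex_diff].
Qed.

End entire_functions.

Section fock_space.
Variables (R : realType) (n : nat).
Local Notation C := R[i].
Local Notation m := (n + n)%N.
Local Notation leb := (@leb R m).
Implicit Types (x y z w : 'cV[C]_n) (t s : m.-tuple R).

Lemma cvec_tadd s t : cvec (tadd s t) = cvec t + cvec s.
Proof. by apply/matrixP => i j; rewrite !mxE !tnth_mktuple. Qed.

Lemma cvec_surj x : exists t, x = cvec t.
Proof.
exists [tuple match fintype.split i with inl j => ReC (x j 0) | inr j => ImC (x j 0) end | i < m].
apply/matrixP => i j; rewrite (ord1 j) !mxE !tnth_mktuple.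
have -> : fintype.split (lshift n i) = inl i := unsplitK (inl i).
have -> : fintype.split (rshift n i) = inr i := unsplitK (inr i).
exact: complexP.
Qed.

Lemma cmeas_cvec (d : measure_display) (T : measurableType d) (f : T -> m.-tuple R) i :
  measurable_fun setT f -> cmeas (fun a => cvec (f a) i 0).
Proof.
move=> mf; split; under eq_fun do rewrite !mxE /=;
  exact: (measurableT_comp (measurable_tnth _) mf).
Qed.

Variable H : 'M[C]_n.
Hypotheses (hH : hermitian H) (pH : hpos H).

Lemma hdotDl x y z : hdot H (x + y) z = hdot H x z + hdot H y z.
Proof. by rewrite /hdot cjD bilDl. Qed.

Lemma hdotDr x y z : hdot H x (y + z) = hdot H x y + hdot H x z.
Proof. exact: bilDr. Qed.

Lemma hdotNl x y : hdot H (- x) y = - hdot H x y.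
Proof. by rewrite /hdot cjN bilNl. Qed.

Lemma hdotNr x y : hdot H x (- y) = - hdot H x y.
Proof. exact: bilNr. Qed.

Lemma hsqD x y : hsq H (x + y) = hsq H x + hsq H y + 2 * ReC (hdot H x y).
Proof.
rewrite /hsq hdotDl !hdotDr -(hdotC x y hH).
by move: (hdot H x x) (hdot H x y) (hdot H y y) => [a1 a2] [b1 b2] [c1 c2] /=; ring.
Qed.

Lemma hsqN x : hsq H (- x) = hsq H x.
Proof. by rewrite /hsq hdotNl hdotNr opprK. Qed.

Lemma hsq_unit (c s : R) x : c ^+ 2 + s ^+ 2 = 1 -> hsq H ((c +i* s) *: x) = hsq H x.
Proof.
move=> cs; rewrite /hsq /hdot cjZ bilZl bilZr.
move: (bil H (cj x) x) => [a1 a2] /=; rewrite -[RHS]mul1r -cs; ring.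
Qed.

Lemma cmeas_hdotr z (d : measure_display) (T : measurableType d) (f : T -> m.-tuple R) :
  measurable_fun setT f -> cmeas (fun a => hdot H z (cvec (f a))).
Proof.
by move=> mf; apply: cmeas_bil => i; [exact: cmeas_cst|exact: cmeas_cvec].
Qed.

Lemma cmeas_hdot (d : measure_display) (T : measurableType d) (f g : T -> m.-tuple R) :
  measurable_fun setT f -> measurable_fun setT g ->
  cmeas (fun a => hdot H (cvec (f a)) (cvec (g a))).
Proof.
move=> mf mg; apply: cmeas_bil => i; last exact: cmeas_cvec.
by under eq_fun do rewrite mxE; apply: cmeasJ; exact: cmeas_cvec.
Qed.

Lemma measurable_hsq (d : measure_display) (T : measurableType d) (f : T -> m.-tuple R) :
  measurable_fun setT f -> measurable_fun setT (fun a => hsq H (cvec (f a))).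
Proof. by move=> mf; exact: (cmeas_hdot mf mf).1. Qed.

Definition gH t : R := expR (- (2 * hsq H (cvec t))).

Lemma measurable_gH : measurable_fun setT gH.
Proof.
apply: (measurableT_comp (@measurable_expR R)); apply: measurable_funN.
apply: measurable_funM => //; exact: (measurable_hsq (@measurable_id _ _ _)).
Qed.

Definition kH : R := \int[leb]_t gH t.

Lemma gH_qf t : gH t = expR (- qf (Bmx H) t).
Proof. by rewrite /gH qf_Bmx. Qed.

Lemma integral_gH_lty : (\int[leb]_t (gH t)%:E < +oo)%E.
Proof.
have e2 : remx (map_mx (real_complex R) (Bmx H)) = Bmx H.
  by apply/matrixP => i j; rewrite !mxE.
have pc2 : tpos (remx (map_mx (real_complex R) (Bmx H))) by rewrite e2; exact: tpos_Bmx.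
have := (cintg_gauss pc2 0).2; congr (_ < _)%E; apply: eq_integral => s _.
by rewrite addr0 normc_expC ReN Re_bil_cv e2 gH_qf.
Qed.

Lemma kHE : (\int[leb]_t (gH t)%:E = kH%:E)%E.
Proof.
rewrite /kH /Rintegral fineK // ge0_fin_numE ?integral_gH_lty //.
by apply: integral_ge0 => t _; rewrite lee_fin expR_ge0.
Qed.

Lemma kH_gt0 : 0 < kH.
Proof.
rewrite -lte_fin -kHE; under eq_integral do rewrite gH_qf.
exact: qf_gauss_gt0.
Qed.

(** Translate by [w]: the exponent becomes $2h(w)-2h(t)$. *)
Lemma integral_gauss_translate w :
  (\int[leb]_t (expR (4 * ReC (hdot H w (cvec t)) - 2 * hsq H (cvec t)))%:E =
   (expR (2 * hsq H w) * kH)%:E)%E.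
Proof.
have [s ->] := cvec_surj w.
rewrite -((preserves_tshift (tnth s)).2
  (fun t => (expR (4 * ReC (hdot H (cvec s) (cvec t)) - 2 * hsq H (cvec t)))%:E)).
- rewrite EFinM -kHE -ge0_integralZl //.
  + apply: eq_integral => t _; rewrite -EFinM -expRD cvec_tadd hdotDr !hsqD.
    congr (expR _)%:E; rewrite -/(hsq H (cvec s)).
    have -> : ReC (hdot H (cvec t) (cvec s)) = ReC (hdot H (cvec s) (cvec t)).
      by rewrite -(hdotC (cvec t) (cvec s) hH) ReJ.
    by rewrite ReD /hsq; move: (ReC _) (ReC _) (ReC _) => x1 x2 x3; ring.
  + by apply/measurable_EFinP; exact: measurable_gH.
  + by move=> t _; rewrite lee_fin expR_ge0.
- apply/measurable_EFinP; apply: (measurableT_comp (@measurable_expR R)).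
  apply: measurable_funB; apply: measurable_funM => //.
    exact: (cmeas_hdotr _ (@measurable_id _ _ _)).1.
  exact: (measurable_hsq (@measurable_id _ _ _)).
- by move=> t; rewrite lee_fin expR_ge0.
Qed.

                                                                      
(** The weight and Lebesgue measure are invariant under $x\mapsto e^{i\theta}x$, so the integral may
    be averaged over $\theta$. By Fubini's theorem the average falls on $v$ along circles in complex
    lines, where [mean_value] replaces it by $v(0)$. *)
Lemma gaussian_mean_value (v : 'cV[C]_n -> C) :
  (forall x, holo (fun c : C => v (c *: x))) -> cmeas (fun t => v (cvec t)) ->
  cintg leb (fun t => v (cvec t) * (gH t)%:C) ->
  cint leb (fun t => v (cvec t) * (gH t)%:C) = v 0 * kH%:C.
Proof.
move=> hv mv iv; set I := cint _ _.
pose U := uniform_prob (@two_pi_gt0 R).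
pose rot (a : R) t := rotT (cos a) (sin a) t.
have mrot : measurable_fun setT (fun p : measurableTypeR R * m.-tuple R => rot p.1 p.2).
  apply/measurable_fun_tnthP => i /=.
  have mc : measurable_fun setT (fun p : measurableTypeR R * m.-tuple R => cos p.1).
    apply: (measurableT_comp (f := @cos R)) => //.
    by apply: continuous_measurable_fun; exact: continuous_cos.
  have ms : measurable_fun setT (fun p : measurableTypeR R * m.-tuple R => sin p.1).
    apply: (measurableT_comp (f := @sin R)) => //.
    by apply: continuous_measurable_fun; exact: continuous_sin.
  have mt j : measurable_fun setT (fun p : measurableTypeR R * m.-tuple R => tnth p.2 j).
    exact: (measurableT_comp (measurable_tnth j) measurable_snd).
  rewrite -(splitK i); case: (fintype.split i) => j /=.
    rewrite /comp; under eq_fun do rewrite tnth_rotl.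
    by apply: measurable_funB; apply: measurable_funM.
  rewrite /comp; under eq_fun do rewrite tnth_rotr.
  by apply: measurable_funD; apply: measurable_funM.
pose F (p : measurableTypeR R * m.-tuple R) := v (cvec (rot p.1 p.2)) * (gH p.2)%:C.
have gHrot a t : gH (rot a t) = gH t.
  by rewrite /gH /rot cvec_rotT hsq_unit // cos2Dsin2.
have mF : cmeas F.
  apply: cmeasM; first exact: (cmeas_comp mv mrot).
  by apply: cmeasR; exact: (measurableT_comp measurable_gH measurable_snd).
have prot (a : R) : preserves leb (rot a) := preserves_rotT n (cos2Dsin2 a).
have FI a : cint leb (fun t => F (a, t)) = I.
  rewrite /I -(preserves_cint (prot a) iv.1).
  by apply: eq_cint => t; rewrite -/(rot a t) gHrot.
pose k := (\int[leb]_t (normc (v (cvec t) * (gH t)%:C))%:E)%E.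
have Fk a : (\int[leb]_t (normc (F (a, t)))%:E = k)%E.
  rewrite /k -((prot a).2 (fun t => (normc (v (cvec t) * (gH t)%:C))%:E)).
  - by apply: eq_integral => t _; rewrite -/(rot a t) gHrot.
  - by apply/measurable_EFinP; exact: measurable_normc iv.1.
  - by move=> t; rewrite lee_fin normc_ge0.
have finF : (\int[U]_a \int[leb]_t (normc (F (a, t)))%:E < +oo)%E.
  under eq_integral do rewrite Fk.
  have k0 : (0 <= k)%E by apply: integral_ge0 => t _; rewrite lee_fin normc_ge0.
  have kE : k = (fine k)%:E by rewrite fineK // ge0_fin_numE //; exact: iv.2.
  rewrite kE; apply: le_lt_trans (ltry (fine k)).
  by apply: uniform_le => // r; rewrite ?fine_ge0.
have h := cfubini mF finF.
have E1 : cint U (fun a => cint leb (fun t => F (a, t))) = I.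
  by transitivity (cint U (fun=> I)); [exact: eq_cint FI|exact: cint_uniform_cst].
have E2 : cint leb (fun t => cint U (fun a => F (a, t))) = v 0 * kH%:C.
  rewrite /kH -cintR -cintZ; last first.
    split; first by apply: cmeasR; exact: measurable_gH.
    by under eq_integral do rewrite normcR ger0_norm ?expR_ge0 //; exact: integral_gH_lty.
  apply: eq_cint => t.
  have hF : holo (fun c : C => (gH t)%:C * v (c *: cvec t) + 0).
    move=> c; have [D hD] := hv (cvec t) c.
    exists ((gH t)%:C * D); apply: (@cder_comp R (fun c => (gH t)%:C * c + 0)) hD _.
    exact: cder_affine.
  have e := mean_value hF.
  transitivity ((gH t)%:C * v (0 *: cvec t) + 0); last by rewrite scale0r addr0 mulrC.
  apply: etrans e; apply: eq_cint => a.
  by rewrite /F /rot cvec_rotT addr0 mulrC.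
by rewrite -E2; symmetry; apply: etrans E1; symmetry.
Qed.

(** Translating by $w$ turns the exponent into $-2h(t)-2\langle w,t\rangle$, so the claim is the
    Gaussian mean value at the origin of the entire function $f(w+y)e^{-2\langle w,y\rangle}$. *)
Lemma reproducing (f : 'cV[C]_n -> C) w :
  entire f -> cmeas (fun t => f (cvec t)) ->
  cintg leb (fun t => f (cvec t) * expC (2 * hdot H (cvec t) w - (2 * hsq H (cvec t))%:C)) ->
  cint leb (fun t => f (cvec t) * expC (2 * hdot H (cvec t) w - (2 * hsq H (cvec t))%:C)) =
  f w * kH%:C.
Proof.
move=> hf mf; have [s ->] := cvec_surj w => jf.
pose v y := f (cvec s + y) * expC (- (2 * hdot H (cvec s) y)).
have vE t : v (cvec t) * (gH t)%:C = f (cvec (tadd s t)) *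
    expC (2 * hdot H (cvec (tadd s t)) (cvec s) - (2 * hsq H (cvec (tadd s t)))%:C).
  rewrite /v cvec_tadd [cvec s + _]addrC -mulrA; congr (_ * _).
  rewrite /gH -expC_real -expCD; congr expC.
  rewrite hdotDl hsqD (hdot_diag (cvec s) hH).
  rewrite -(hdotC (cvec t) (cvec s) hH).
  move: (hdot H (cvec t) (cvec s)) (hsq H (cvec t)) (hsq H (cvec s)) => [a1 a2] b c.
  by apply: complexP => /=; ring.
have pt := preserves_tshift (tnth s).
have v0 : v 0 = f (cvec s) by rewrite /v addr0 /hdot bil0r mulr0 oppr0 expC0 mulr1.
rewrite -v0 -gaussian_mean_value.
- rewrite -(preserves_cint pt jf.1); apply: eq_cint => t; rewrite vE //.
- have ev : entire v.
    apply: entireM; first exact: entire_translate.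
    apply: entire_expC; under eq_fun do rewrite -mulNr.
    apply: entireM; first exact: entire_cst.
    by apply: entire_bil => i; [exact: entire_cst|exact: entire_coord].
  by move=> x; under eq_fun do rewrite -[_ *: x]add0r; exact: entire_line.
- apply: cmeasM.
    under eq_fun do rewrite addrC -cvec_tadd.
    by apply: (cmeas_comp mf); exact: measurable_tshift.
  apply: cmeas_expC; apply: cmeasN; apply: cmeasM; first exact: cmeas_cst.
  exact: (cmeas_hdotr _ (@measurable_id _ _ _)).
- by apply: eq_cintg (preserves_cintg pt jf) => t; rewrite vE.
Qed.
End fock_space.

(** * Schur's test *)

Section schur_test.
Variables (R : realType).

(** Recovers Cauchy-Schwarz from its weighted arithmetic-geometric form; the cases $x=0$ and $a=0$
    are separate because the best weight $k=x/a$ degenerates there. *)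
Lemma sqr_le_of_amgm (x a b : R) : 0 <= a ->
  (forall k, 0 < k -> 2 * x <= k * a + b / k) -> 0 <= x -> x ^+ 2 <= b * a.
Proof.
move=> a0 h x0; have [xe|xn] := eqVneq x 0.
  rewrite xe expr0n /=; have [->|an] := eqVneq a 0; first by rewrite mulr0.
  have ap : 0 < a by rewrite lt_def an.
  rewrite pmulr_lge0 //; have [//|b0] := leP 0 b.
  have bp : 0 < - b by lra.
  have k0 : 0 < Num.sqrt (- b / (2 * a)) by rewrite sqrtr_gt0 divr_gt0 // mulr_gt0.
  have := h _ k0; rewrite xe mulr0; set k := Num.sqrt _ in k0 *.
  have kk : k ^+ 2 * (2 * a) = - b.
    by rewrite sqr_sqrtr ?divr_ge0 ?mulr_ge0 ?ltW // divfK // gt_eqF // mulr_gt0.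
  have : (k * a + b / k) * k = k ^+ 2 * a + b by field; rewrite gt_eqF.
  move=> e1 e2; have : 0 <= (k * a + b / k) * k by rewrite mulr_ge0 // ltW.
  by rewrite e1; nra.
have xp : 0 < x by rewrite lt_def xn.
have [ae|an] := eqVneq a 0.
  have kp : 0 < (`|b| + 1) / x by rewrite divr_gt0 // ltr_wpDl.
  have := h _ kp; rewrite ae mulr0 add0r invf_div => hk.
  have bb : b <= `|b| by exact: ler_norm.
  have b1 : 0 < `|b| + 1 by rewrite ltr_wpDl.
  have : b * (x / (`|b| + 1)) <= x.
    by rewrite mulrA ler_pdivrMr // mulrC ler_wpM2l // ?ltW //; lra.
  by move=> e; exfalso; lra.
have ap : 0 < a by rewrite lt_def an.
have := h (x / a) (divr_gt0 xp ap); rewrite divfK // invf_div => hk.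
have : x * x <= b * a.
  have : x <= b * (a / x) by lra.
  by rewrite mulrA ler_pdivlMr.
by rewrite expr2.
Qed.

Lemma amgm (x y k : R) : 0 < k -> 2 * (x * y) <= k * x ^+ 2 + y ^+ 2 / k.
Proof.
move=> k0; rewrite -subr_ge0.
have -> : k * x ^+ 2 + y ^+ 2 / k - 2 * (x * y) = (k * x - y) ^+ 2 / k.
  by field; rewrite gt_eqF.
by rewrite divr_ge0 ?sqr_ge0 // ltW.
Qed.

Context d (T : measurableType d) (mu : {sigma_finite_measure set T -> \bar R}).
Variables (ph : T -> R) (kp : T * T -> R) (S : R).
Hypotheses (mph : measurable_fun setT ph) (mkp : measurable_fun setT kp).
Hypotheses (ph0 : forall x, 0 <= ph x) (kp0 : forall p, 0 <= kp p) (S0 : 0 < S).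
Hypothesis kp_snd : forall x, (\int[mu]_y (kp (x, y))%:E <= S%:E)%E.
Hypothesis kp_fst : forall y, (\int[mu]_x (kp (x, y))%:E <= S%:E)%E.

Let mkx x : measurable_fun setT (fun y => kp (x, y)).
Proof. exact: (measurableT_comp mkp (measurable_pair1 x)). Qed.

Let mky y : measurable_fun setT (fun x => kp (x, y)).
Proof. exact: (measurableT_comp mkp (measurable_pair2 y)). Qed.

(** Cauchy-Schwarz for the measure with density [kp (x, .)], of mass at most [S]. Going through
    [amgm] keeps all integrals nonnegative and extended-valued. *)
Lemma weighted_cauchy_schwarz (g : R) x : 0 <= g ->
  (g%:E <= \int[mu]_y (ph y * kp (x, y))%:E)%E ->
  ((g ^+ 2)%:E <= S%:E * \int[mu]_y (ph y ^+ 2 * kp (x, y))%:E)%E.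
Proof.
move=> g0 hg; set A := (\int[mu]_y (ph y ^+ 2 * kp (x, y))%:E)%E.
have A0 : (0 <= A)%E by apply: integral_ge0 => y _; rewrite lee_fin mulr_ge0 ?sqr_ge0.
have [Aoo|Afin] := eqVneq A +oo%E; first by rewrite Aoo gt0_muley ?lte_fin // leey.
have AE : A = (fine A)%:E by rewrite fineK // ge0_fin_numE // lt_neqAle Afin leey.
rewrite AE -EFinM lee_fin; apply: sqr_le_of_amgm => //; first exact: fine_ge0.
move=> k k0; rewrite -lee_fin EFinD [(k * _)%:E]EFinM -AE.
have mp2 : measurable_fun setT (fun y => ph y ^+ 2 * kp (x, y)).
  by apply: measurable_funM => //; exact: measurable_funX.
apply: (@le_trans _ _ (\int[mu]_y ((k%:E * (ph y ^+ 2 * kp (x, y))%:E) +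
    (k^-1%:E * (kp (x, y))%:E)))%E).
  apply: (@le_trans _ _ (2%:E * \int[mu]_y (ph y * kp (x, y))%:E)%E).
    by rewrite EFinM lee_pmul2l.
  rewrite -ge0_integralZl //; last 2 first.
  - by apply/measurable_EFinP; apply: measurable_funM.
  - by move=> y _; rewrite lee_fin mulr_ge0.
  apply: ge0_le_integral => //.
  - by move=> y _; rewrite -EFinM lee_fin !mulr_ge0.
  - by apply/measurable_EFinP; apply: measurable_funM => //; apply: measurable_funM.
  - under eq_fun do rewrite -!EFinM -EFinD; apply/measurable_EFinP.
    by apply: measurable_funD; apply: measurable_funM.
  move=> y _; rewrite -!EFinM -EFinD lee_fin.
  have := ler_wpM2r (kp0 (x, y)) (amgm (ph y) 1 k0).
  by move: (ph y) (kp (x, y)) => x1 x2; rewrite mulr1 expr1n mul1r; lra.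
rewrite ge0_integralD //; first last.
- by apply: emeasurable_funM; [exact: measurable_cst|exact/measurable_EFinP].
- by move=> y _; rewrite -EFinM lee_fin mulr_ge0 // invr_ge0 ltW.
- by apply: emeasurable_funM; [exact: measurable_cst|exact/measurable_EFinP].
- by move=> y _; rewrite -EFinM lee_fin !mulr_ge0 ?sqr_ge0 // ltW.
rewrite !ge0_integralZl //.
- apply: leeD => //; rewrite [S / k]mulrC EFinM; apply: lee_wpmul2l => //.
  by rewrite lee_fin invr_ge0 ltW.
- exact/measurable_EFinP/mkx.
- by move=> y _; rewrite lee_fin.
- by rewrite lee_fin invr_ge0 ltW.
- exact/measurable_EFinP.
- by move=> y _; rewrite lee_fin mulr_ge0 ?sqr_ge0.
- by rewrite lee_fin ltW.
Qed.

(** Integrate [weighted_cauchy_schwarz] over [x] and exchange the integrals; the row bound gives one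
    factor [S] and the column bound the other. *)
Lemma schur_test (g : T -> R) : measurable_fun setT g -> (forall x, 0 <= g x) ->
  (forall x, ((g x)%:E <= \int[mu]_y (ph y * kp (x, y))%:E)%E) ->
  (\int[mu]_x (g x ^+ 2)%:E <= (S ^+ 2)%:E * \int[mu]_y (ph y ^+ 2)%:E)%E.
Proof.
move=> mg g0 hg.
have mF : measurable_fun setT (fun p : T * T => (ph p.2 ^+ 2 * kp p)%:E).
  apply/measurable_EFinP; apply: measurable_funM => //; apply: measurable_funX.
  exact: (measurableT_comp mph measurable_snd).
have F0 p : (0 <= (ph p.2 ^+ 2 * kp p)%:E)%E by rewrite lee_fin mulr_ge0 ?sqr_ge0.
have mA : measurable_fun setT (fun x => \int[mu]_y (ph y ^+ 2 * kp (x, y))%:E)%E.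
  by apply: (@measurable_fun_fubini_tonelli_F _ _ _ _ _ mu (fun p => (ph p.2 ^+ 2 * kp p)%:E)).
have mG : measurable_fun setT (fun y => \int[mu]_x (ph y ^+ 2 * kp (x, y))%:E)%E.
  by apply: (@measurable_fun_fubini_tonelli_G _ _ _ _ _ mu (fun p => (ph p.2 ^+ 2 * kp p)%:E)).
apply: (@le_trans _ _ (\int[mu]_x (S%:E * \int[mu]_y (ph y ^+ 2 * kp (x, y))%:E))%E).
  apply: ge0_le_integral => //.
  - by move=> x _; rewrite lee_fin sqr_ge0.
  - by apply/measurable_EFinP; exact: measurable_funX.
  - apply: emeasurable_funM; first exact: measurable_cst.
    exact: mA.
  - by move=> x _; apply: weighted_cauchy_schwarz.
rewrite ge0_integralZl //; first last.
- by rewrite lee_fin ltW.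
- by move=> x _; apply: integral_ge0 => y _; exact: (F0 (x, y)).
have -> : (\int[mu]_x \int[mu]_y (ph y ^+ 2 * kp (x, y))%:E =
    \int[mu]_y \int[mu]_x (ph y ^+ 2 * kp (x, y))%:E)%E.
  by apply: (@fubini_tonelli _ _ _ _ _ mu mu (fun p => (ph p.2 ^+ 2 * kp p)%:E)).
rewrite expr2 EFinM -muleA lee_pmul2l //.
apply: (@le_trans _ _ (\int[mu]_y (S%:E * (ph y ^+ 2)%:E))%E).
  apply: ge0_le_integral => //.
  - by move=> y _; apply: integral_ge0 => x _; exact: (F0 (x, y)).
  - apply: emeasurable_funM; first exact: measurable_cst.
    by apply/measurable_EFinP; exact: measurable_funX.
  move=> y _; under eq_integral do rewrite EFinM.
  rewrite ge0_integralZl //; first last.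
  - by rewrite lee_fin sqr_ge0.
  - by move=> x _; rewrite lee_fin.
  - exact/measurable_EFinP/mky.
  by rewrite muleC; apply: lee_wpmul2r; rewrite ?lee_fin ?sqr_ge0.
rewrite ge0_integralZl //; first last.
- by rewrite lee_fin ltW.
- by move=> y _; rewrite lee_fin sqr_ge0.
- by apply/measurable_EFinP; exact: measurable_funX.
Qed.

End schur_test.

(** * The space with weight $e^{-2h}$ and its coherent states *)

Section fock_l2.
Variables (R : realType) (n : nat).
Local Notation C := R[i].
Local Notation m := (n + n)%N.
Local Notation leb := (@leb R m).
Implicit Types (x y z w : 'cV[C]_n) (t s : m.-tuple R) (f g : 'cV[C]_n -> C).
Variable H : 'M[C]_n.
Hypotheses (hH : hermitian H) (pH : hpos H).

Definition l2 f := cmeas (fun t => f (cvec t)) /\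
  (\int[leb]_t (normc (f (cvec t)) ^+ 2 * gH H t)%:E < +oo)%E.
Definition l2sq f : R := \int[leb]_t (normc (f (cvec t)) ^+ 2 * gH H t).

Lemma realc_neq0 (r : R) : 0 < r -> r%:C != 0 :> C.
Proof. by move=> r0; apply/eqP => /(congr1 (@ReC R)) /= e; rewrite e ltxx in r0. Qed.

Lemma gH_ge0 t : 0 <= gH H t. Proof. exact: expR_ge0. Qed.

Lemma l2_ge0 f t : 0 <= normc (f (cvec t)) ^+ 2 * gH H t.
Proof. by rewrite mulr_ge0 ?sqr_ge0 ?gH_ge0. Qed.

Lemma measurable_l2 f : cmeas (fun t => f (cvec t)) ->
  measurable_fun setT (fun t => (normc (f (cvec t)) ^+ 2 * gH H t)%:E).
Proof.
move=> mf; apply/measurable_EFinP; apply: measurable_funM; last exact: measurable_gH.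
by apply: measurable_funX; exact: measurable_normc.
Qed.

Lemma l2sqE f : l2 f -> (\int[leb]_t (normc (f (cvec t)) ^+ 2 * gH H t)%:E = (l2sq f)%:E)%E.
Proof.
move=> [mf ff]; rewrite /l2sq /Rintegral fineK // ge0_fin_numE //.
by apply: integral_ge0 => t _; rewrite lee_fin l2_ge0.
Qed.

Lemma l2sq_ge0 f : 0 <= l2sq f.
Proof. by rewrite /l2sq /Rintegral fine_ge0 // integral_ge0 // => t _; rewrite lee_fin l2_ge0. Qed.

(** The weight [k] is left free, to be balanced according to the sizes of [f] and [g]. *)
Lemma l2_dot f g (k : R) : 0 < k -> l2 f -> l2 g ->
  cintg leb (fun t => f (cvec t) * (g (cvec t))^*%C * (gH H t)%:C) /\
  (\int[leb]_t (normc (f (cvec t) * (g (cvec t))^*%C * (gH H t)%:C))%:E <=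
   ((k * l2sq f + l2sq g / k) / 2)%:E)%E.
Proof.
move=> k0 lf lg; have [mf _] := lf; have [mg _] := lg.
have mfg : cmeas (fun t => f (cvec t) * (g (cvec t))^*%C * (gH H t)%:C).
  apply: cmeasM; first by apply: cmeasM => //; exact: cmeasJ.
  by apply: cmeasR; exact: measurable_gH.
suff b : (\int[leb]_t (normc (f (cvec t) * (g (cvec t))^*%C * (gH H t)%:C))%:E <=
   ((k * l2sq f + l2sq g / k) / 2)%:E)%E.
  by split => //; split => //; exact: le_lt_trans b (ltry _).
have -> : ((k * l2sq f + l2sq g / k) / 2)%:E =
  (\int[leb]_t ((k / 2)%:E * (normc (f (cvec t)) ^+ 2 * gH H t)%:E +
     (k^-1 / 2)%:E * (normc (g (cvec t)) ^+ 2 * gH H t)%:E))%E.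
  rewrite ge0_integralD //.
  - rewrite !ge0_integralZl //.
    + rewrite !l2sqE // -!EFinM -EFinD; congr EFin; lra.
    + exact: measurable_l2.
    + by move=> t _; rewrite lee_fin l2_ge0.
    + by rewrite lee_fin divr_ge0 ?invr_ge0 // ltW.
    + exact: measurable_l2.
    + by move=> t _; rewrite lee_fin l2_ge0.
    + by rewrite lee_fin divr_ge0 // ltW.
  - by move=> t _; rewrite -EFinM lee_fin mulr_ge0 ?l2_ge0 // divr_ge0 // ltW.
  - by apply: emeasurable_funM; [exact: measurable_cst|exact: measurable_l2].
  - by move=> t _; rewrite -EFinM lee_fin mulr_ge0 ?l2_ge0 // divr_ge0 ?invr_ge0 // ltW.
  - by apply: emeasurable_funM; [exact: measurable_cst|exact: measurable_l2].
apply: ge0_le_integral => //.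
- by move=> t _; rewrite lee_fin normc_ge0.
- by apply/measurable_EFinP; exact: measurable_normc.
- by apply: emeasurable_funD; apply: emeasurable_funM; (exact: measurable_cst || exact: measurable_l2).
move=> t _; rewrite -!EFinM -EFinD lee_fin !normcM normcJ normcR (ger0_norm (gH_ge0 t)).
have := ler_wpM2r (gH_ge0 t) (amgm (normc (f (cvec t))) (normc (g (cvec t))) k0).
move: (normc _) (normc _) (gH H t) => x1 x2 x3; lra.
Qed.

Definition kz z y : C := expC (2 * hdot H z y).

Lemma entire_kz z : entire (kz z).
Proof.
apply: entire_expC; apply: entireM; first exact: entire_cst.
by apply: entire_bil => i; [exact: entire_cst|exact: entire_coord].
Qed.

Lemma cmeas_kz z : cmeas (fun t => kz z (cvec t)).
Proof.
apply: cmeas_expC; apply: cmeasM; first exact: cmeas_cst.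
exact: (cmeas_hdotr H _ (@measurable_id _ _ _)).
Qed.

Lemma kz_integral z : (\int[leb]_t (normc (kz z (cvec t)) ^+ 2 * gH H t)%:E =
  (expR (2 * hsq H z) * kH H)%:E)%E.
Proof.
rewrite -integral_gauss_translate //; apply: eq_integral => t _; congr EFin.
rewrite /kz normc_expC /gH expr2 -!expRD; congr expR.
by move: (hdot H z (cvec t)) (hsq H (cvec t)) => [a b] c /=; ring.
Qed.

Lemma l2_kz z : l2 (kz z).
Proof. by split; [exact: cmeas_kz|rewrite kz_integral ltry]. Qed.

Lemma l2sq_kz z : l2sq (kz z) = expR (2 * hsq H z) * kH H.
Proof. by have := l2sqE (l2_kz z); rewrite kz_integral => -[]. Qed.

Lemma kz_conj z t : (kz z (cvec t))^*%C = expC (2 * hdot H (cvec t) z).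
Proof.
rewrite /kz expCJ; congr expC; rewrite -(hdotC z (cvec t) hH).
by move: (hdot H z (cvec t)) => [a b]; apply: complexP => /=; ring.
Qed.

Let dotE f w t : f (cvec t) * expC (2 * hdot H (cvec t) w - (2 * hsq H (cvec t))%:C) =
  f (cvec t) * (kz w (cvec t))^*%C * (gH H t)%:C.
Proof.
by rewrite kz_conj -mulrA; congr (_ * _); rewrite expCD /gH -expC_real rmorphN.
Qed.

Lemma reproducing_l2 f w : entire f -> l2 f ->
  cint leb (fun t => f (cvec t) * (kz w (cvec t))^*%C * (gH H t)%:C) = f w * (kH H)%:C.
Proof.
move=> ef lf; rewrite -reproducing //.
- by apply: eq_cint => t; rewrite dotE.
- exact: lf.1.
- by apply: eq_cintg (l2_dot ltr01 lf (l2_kz w)).1 => t; rewrite dotE.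
Qed.

                                                                         
(** Expands $f(s)$ by the reproducing formula under $\int\varphi(s)f(s)\,ds$ and exchanges the
    integrals. With the weight $e^{h(s)}$ in [l2_dot] the inner integral is at most a constant times
    $e^{h(s)}$, which matches the integrability assumed of [ph]. *)
Lemma reproducing_fubini (ph : m.-tuple R -> C) f : entire f -> l2 f -> cmeas ph ->
  (\int[leb]_s (normc (ph s) * expR (hsq H (cvec s)))%:E < +oo)%E ->
  (forall t, cintg leb (fun s => ph s * (kz (cvec s) (cvec t))^*%C)) ->
  cint leb (fun s => ph s * f (cvec s)) * (kH H)%:C =
  cint leb (fun t => f (cvec t) * (gH H t)%:C *
    cint leb (fun s => ph s * (kz (cvec s) (cvec t))^*%C)).
Proof.
move=> ef lf mph fin ik.
pose F (st : m.-tuple R * m.-tuple R) :=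
  ph st.1 * (f (cvec st.2) * (kz (cvec st.1) (cvec st.2))^*%C * (gH H st.2)%:C).
have mF : cmeas F.
  apply: cmeasM; first exact: (cmeas_comp mph measurable_fst).
  apply: cmeasM; last by apply: cmeasR; exact: (measurableT_comp (measurable_gH H) measurable_snd).
  apply: cmeasM; first exact: (cmeas_comp lf.1 measurable_snd).
  apply: cmeasJ; apply: cmeas_expC; apply: cmeasM; first exact: cmeas_cst.
  by apply: cmeas_hdot; [exact: measurable_fst|exact: measurable_snd].
have me : measurable_fun setT (fun s => expR (hsq H (cvec s))).
  apply: (measurableT_comp (@measurable_expR R)).
  exact: (measurable_hsq H (@measurable_id _ _ _)).
pose c := (l2sq f + kH H) / 2.
have c0 : 0 <= c by rewrite divr_ge0 // addr_ge0 ?l2sq_ge0 // ltW // kH_gt0.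
have finF : (\int[leb]_s \int[leb]_t (normc (F (s, t)))%:E < +oo)%E.
  apply: (@le_lt_trans _ _ (\int[leb]_s (c%:E * (normc (ph s) * expR (hsq H (cvec s)))%:E))%E).
    apply: ge0_le_integral => //.
    - by move=> s _; apply: integral_ge0 => t _; rewrite lee_fin normc_ge0.
    - apply: (@measurable_fun_fubini_tonelli_F _ _ _ _ _ leb (fun p => (normc (F p))%:E)).
        by apply/measurable_EFinP; exact: measurable_normc.
      by move=> p; rewrite lee_fin normc_ge0.
    - apply: emeasurable_funM; first exact: measurable_cst.
      by apply/measurable_EFinP; apply: measurable_funM => //; exact: measurable_normc.
    move=> s _; have [cd bd] := l2_dot (expR_gt0 (hsq H (cvec s))) lf (l2_kz (cvec s)).
    under eq_integral do rewrite /F /= normcM EFinM.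
    rewrite ge0_integralZl //; first last.
    - by rewrite lee_fin normc_ge0.
    - by move=> t _; rewrite lee_fin normc_ge0.
    - by apply/measurable_EFinP; exact: measurable_normc cd.1.
    rewrite muleC [(_ * expR _)%:E]EFinM muleCA muleC.
    apply: lee_wpmul2l; first by rewrite lee_fin normc_ge0.
    apply: le_trans bd _; rewrite -EFinM lee_fin l2sq_kz.
    have -> : expR (2 * hsq H (cvec s)) = expR (hsq H (cvec s)) * expR (hsq H (cvec s)).
      by rewrite -expRD; congr expR; ring.
    rewrite /c le_eqVlt; apply/orP; left; apply/eqP; field.
    by rewrite gt_eqF // expR_gt0.
  rewrite ge0_integralZl //; first last.
  - by move=> s _; rewrite lee_fin mulr_ge0 ?normc_ge0 ?expR_ge0.
  - by apply/measurable_EFinP; apply: measurable_funM => //; exact: measurable_normc.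
  apply: lte_mul_pinfty => //.
have h := cfubini mF finF.
have Fin s : cint leb (fun t => F (s, t)) = ph s * f (cvec s) * (kH H)%:C.
  have ci := (l2_dot ltr01 lf (l2_kz (cvec s))).1.
  apply: etrans (cintZ (ph s) ci) _.
  apply: etrans (congr1 (fun a => ph s * a) (reproducing_l2 (cvec s) ef lf)) _.
  exact: mulrA.
have kn0 : (kH H)%:C != 0 :> C.
  exact/realc_neq0/kH_gt0.
have ipf : cintg leb (fun s => ph s * f (cvec s)).
  apply: eq_cintg (cintgMr (kH H)%:C^-1 (cintg_iterated mF finF)) => s.
  by apply: etrans (congr1 (fun a => a / (kH H)%:C) (Fin s)) _; rewrite mulfK.
have E1 : cint leb (fun s => ph s * f (cvec s)) * (kH H)%:C =
    cint leb (fun s => cint leb (fun t => F (s, t))).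
  apply: etrans (esym (cintZr (kH H)%:C ipf)) _.
  by apply: eq_cint => s; exact: esym (Fin s).
have E2 : cint leb (fun t => cint leb (fun s => F (s, t))) =
  cint leb (fun t => f (cvec t) * (gH H t)%:C *
    cint leb (fun s => ph s * (kz (cvec s) (cvec t))^*%C)).
  apply: eq_cint => t; apply: etrans (cintZ (f (cvec t) * (gH H t)%:C) (ik t)).
  by apply: eq_cint => s; rewrite /F /=; ring.
exact: etrans E1 (etrans h E2).
Qed.
End fock_l2.

                         

Lemma eq_integral_lty d (T : measurableType d) (R : realType) (mu : {measure set T -> \bar R})
    (f g : T -> R) : f =1 g ->
  (\int[mu]_x (f x)%:E < +oo)%E -> (\int[mu]_x (g x)%:E < +oo)%E.
Proof. by move=> /funext ->. Qed.

Lemma integralZr_EFin d (T : measurableType d) (R : realType) (mu : {measure set T -> \bar R})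
    (f : T -> R) (k : R) : measurable_fun setT f -> (forall x, 0 <= f x) -> 0 <= k ->
  ((\int[mu]_x (f x)%:E) * k%:E = \int[mu]_x (f x * k)%:E)%E.
Proof.
move=> mf f0 k0; rewrite -ge0_integralZr //.
- exact/measurable_EFinP.
- by move=> x _; rewrite lee_fin.
Qed.

(** * The integral kernel of the Toeplitz operator *)

Section toeplitz_kernel.
Variables (R : realType) (n : nat).
Local Notation C := R[i].
Local Notation m := (n + n)%N.
Local Notation leb := (@leb R m).
Implicit Types (x y z w : 'cV[C]_n) (t s : m.-tuple R) (f g : 'cV[C]_n -> C).
Variables (H : 'M[C]_n) (q : quad_poly R n).
Hypotheses (hH : hermitian H) (pH : hpos H)
  (hq : forall x, x != 0 -> ReC (principal q x) < hsq H x).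
Local Notation B := (Bmx H).
Local Notation Q := (Qmx q).
Local Notation kz := (kz H).
Local Notation gH := (gH H).
Local Notation Kc := (Kc H q).

Definition eq_ x : C := expC (qeval q x).

Lemma cmeas_qeval : cmeas (fun t => qeval q (cvec t)).
Proof.
under eq_fun do rewrite qeval_cvec.
have cx i : cmeas (fun t : m.-tuple R => cv t i 0).
  by apply: (@cmeas_cv R m _ _ id); exact: measurable_id.
apply: cmeasD; last exact: cmeas_cst.
apply: cmeasD; first exact: cmeas_bil.
apply: cmeasM; first exact: cmeas_cst.
by apply: cmeas_bil => // i; exact: cmeas_cst.
Qed.

(** The case $k=1$ provides the integrability required by [reproducing_fubini], and $k=2$ the square
    integrability of $e^qk_z$. *)
Lemma cintg_quadratic (k : R) z : 0 < k -> cintg leb (fun t =>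
  expC (k%:C * (qeval q (cvec t) - (hsq H (cvec t))%:C + 2 * hdot H z (cvec t)))).
Proof.
move=> k0; pose Bc : 'M[C]_m := map_mx (real_complex R) B.
pose M : 'M[C]_m := k%:C *: (2^-1%:C *: Bc - Q).
have sBc : Bc^T = Bc by rewrite /Bc map_trmx Bmx_sym.
have sM : M^T = M.
  have tr (A A' : 'M[C]_m) (a b : C) : (b *: (a *: A - A'))^T = b *: (a *: A^T - A'^T).
    by apply/matrixP => i j; rewrite !mxE.
  by rewrite /M tr sBc Qmx_sym.
have pM : tpos (remx M).
  have -> : remx M = (k / 2) *: (B - 2 *: remx Q).
    have e : remx Bc = B by apply/matrixP => i j; rewrite mxE [Bc _ _]mxE.
    by rewrite /M remxZ remxD remxN remxZ e !scalerBr !scalerA divfK // pnatr_eq0.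
  apply: tposZ; first by rewrite divr_gt0.
  exact: tpos_BQ.
pose v := k%:C *: (lcv q + Bc *m pt 0 z).
have Mu := tpos_unitmx sM pM.
have := cintgM (expC (k%:C * Defs.coef0 q)) (cintg_formula (invmx M *m v) sM pM).
apply: eq_cintg => t; rewrite -expCD; congr expC.
have -> : bil M (invmx M *m v) (cv t) =
    k%:C * (bil 1%:M (lcv q) (cv t) + hdot H z (cvec t)).
  rewrite (bil_mull _ _ sM) mulKVmx // /v bilZl bilDl; congr (_ * (_ + _)).
  rewrite -(bil_mull _ _ sBc) -pt_cvec bil_Bmx // /hdot bil0r add0r.
  by [].
have -> : bil M (cv t) (cv t) = k%:C * ((hsq H (cvec t))%:C - bil Q (cv t) (cv t)).
  rewrite /M bilZm bilDm bilNm bilZm -{1 2}pt_cvec bil_Bmx // hdot_diag //.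
  congr (_ * (_ - _)); have -> : (2^-1%:C : C) = 2^-1 by rewrite fmorphV rmorph_nat.
  by move: (_%:C) => a; field.
rewrite qeval_cvec /qc.
move: (bil Q _ _) (bil 1%:M _ _) (hdot H z _) (hsq H _)%:C (Defs.coef0 q) (k%:C) => x1 x2 x3 x4 x5 x6.
by ring.
Qed.

Lemma integral_expq_lty z :
  (\int[leb]_t (normc (eq_ (cvec t) * kz z (cvec t) * (gH t)%:C) * expR (hsq H (cvec t)))%:E < +oo)%E.
Proof.
apply: eq_integral_lty (cintg_quadratic z ltr01).2 => t.
rewrite /eq_ /kz /gH -expC_real -!expCD !normc_expC -expRD; congr expR.
by move: (qeval _ _) (hdot H z _) (hsq H _) => [a1 a2] [b1 b2] c /=; ring.
Qed.

Lemma l2_expq_kz z : l2 H (fun y => eq_ y * kz z y).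
Proof.
split; first by apply: cmeasM; [exact: cmeas_expC cmeas_qeval|exact: cmeas_kz].
apply: eq_integral_lty (cintg_quadratic z (ltr0n _ 2)).2 => t.
rewrite /eq_ /kz /gH -!expCD !normc_expC expr2 -!expRD; congr expR.
by move: (qeval _ _) (hdot H z _) (hsq H _) => [a1 a2] [b1 b2] c /=; ring.
Qed.

Let KcF w z t : expC (qeval q (cvec t) - (2 * hsq H (cvec t))%:C + 2 * hdot H (cvec t) w + 2 * hdot H z (cvec t)) =
  eq_ (cvec t) * kz z (cvec t) * (kz w (cvec t))^*%C * (gH t)%:C.
Proof.
rewrite kz_conj // /eq_ /kz /gH -expC_real -!expCD; congr expC.
rewrite (_ : (- (2 * hsq H (cvec t)))%:C = - (2 * hsq H (cvec t))%:C); last first.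
  by apply: complexP => /=; rewrite ?oppr0.
by move: (qeval _ _) (hdot H z _) (hdot H _ w) (_%:C) => a b c d; ring.
Qed.

Lemma KcE w z : Kc w z =
  cint leb (fun t => eq_ (cvec t) * kz z (cvec t) * (kz w (cvec t))^*%C * (gH t)%:C).
Proof. by apply: eq_cint => t; exact: KcF. Qed.

Lemma cintg_KcE w z :
  cintg leb (fun t => eq_ (cvec t) * kz z (cvec t) * (kz w (cvec t))^*%C * (gH t)%:C).
Proof. by apply: eq_cintg (cintg_Kc hH pH hq w z) => t; exact: KcF. Qed.

Lemma kz_sym w t : kz w (cvec t) = (kz (cvec t) w)^*%C.
Proof. by have [s ->] := cvec_surj w; rewrite kz_conj. Qed.

Let kn0 : (kH H)%:C != 0 :> C.
Proof. exact/realc_neq0/kH_gt0. Qed.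

Let conjM (a b : C) : conjc (a * b) = conjc a * conjc b.
Proof. by move: a b => [a1 a2] [b1 b2]; apply: complexP => /=; ring. Qed.

(** Orthogonality against $k_w$ and the reproducing formula give $c\,g(w)=\langle e^qf,k_w\rangle$;
    expanding $f$ in turn by [reproducing_fubini] produces the kernel, as
    $\overline{k_s(t)}=k_t(s)$. *)
Lemma projection_formula f g : entire f -> l2 H f -> l2 H (fun y => eq_ y * f y) ->
  entire g -> l2 H g ->
  (forall w, cint leb (fun t => (eq_ (cvec t) * f (cvec t) - g (cvec t)) *
     (kz w (cvec t))^*%C * (gH t)%:C) = 0) ->
  forall w, g w * (kH H)%:C * (kH H)%:C =
    cint leb (fun t => f (cvec t) * (gH t)%:C * Kc w (cvec t)).
Proof.
move=> ef lf lqf eg lg orth w.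
have i1 := (l2_dot ltr01 lqf (l2_kz hH pH w)).1.
have i2 := (l2_dot ltr01 lg (l2_kz hH pH w)).1.
have e1 : cint leb (fun t => eq_ (cvec t) * f (cvec t) * (kz w (cvec t))^*%C * (gH t)%:C) =
    g w * (kH H)%:C.
  rewrite -(reproducing_l2 hH pH w eg lg); apply/eqP; rewrite -subr_eq0; apply/eqP.
  rewrite -(orth w) -cintB //; apply: eq_cint => t.
  by rewrite !mulrBl.
rewrite -e1; pose ph s := eq_ (cvec s) * (kz w (cvec s))^*%C * (gH s)%:C.
have mph : cmeas ph.
  apply: cmeasM; last by apply: cmeasR; exact: measurable_gH.
  by apply: cmeasM; [exact: cmeas_expC cmeas_qeval|exact: cmeasJ (cmeas_kz H w)].
have fin : (\int[leb]_s (normc (ph s) * expR (hsq H (cvec s)))%:E < +oo)%E.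
  apply: eq_integral_lty (integral_expq_lty w) => s.
  by rewrite [in RHS]/ph 2![in LHS]normcM 2![in RHS]normcM normcJ.
have ik t : cintg leb (fun s => ph s * (kz (cvec s) (cvec t))^*%C).
  apply: eq_cintg (cintg_KcE w (cvec t)) => s; rewrite /ph -kz_sym.
  by move: (eq_ _) (kz _ _) (_^*)%C (_%:C) => a b c d; ring.
have := reproducing_fubini hH pH ef lf mph fin ik.
have -> : cint leb (fun s => ph s * f (cvec s)) =
   cint leb (fun t => eq_ (cvec t) * f (cvec t) * (kz w (cvec t))^*%C * (gH t)%:C).
  apply: eq_cint => t; rewrite /ph.
  by move: (eq_ _) (f _) (_^*)%C (_%:C) => a b c d; ring.
move=> ->; apply: eq_cint => t; congr (_ * _); rewrite KcE; apply: eq_cint => s.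
rewrite /ph -kz_sym.
by move: (eq_ _) (kz _ _) (_^*)%C (_%:C) => a b c d; ring.
Qed.

(** The candidate for the projection of $e^qk_z$: its value at $w$ must be $\langle
    e^qk_z,k_w\rangle/c$. *)
Definition galt (z w : 'cV[C]_n) : C := Kc w z / (kH H)%:C.

(** By [Kf_formula] it is the exponential of a polynomial in the coordinates of [w], on which
    [pt w z] depends affinely. *)
Lemma entire_galt z : entire (galt z).
Proof.
rewrite /galt; apply: entireM; last exact: entire_cst.
under eq_fun do rewrite Kc_Kf // (Kf_formula _ _ (Bmx_sym H) (Qmx_sym q)
  (tpos_Bmx hH pH) (tpos_BQ hH hq)).
apply: entireM; first exact: entire_cst.
have ept i : entire (fun w => pt w z i 0).
  apply: entire_mulmx => j; rewrite -(splitK j); case: (fintype.split j) => k /=.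
    by under eq_fun do rewrite col_mxEu; exact: entire_coord.
  by under eq_fun do rewrite col_mxEd; exact: entire_cst.
have exi i : entire (fun w => xiK B Q (lcv q) (pt w z) i 0).
  apply: entire_mulmx => j; under eq_fun do rewrite mxE.
  by apply: entireD; [exact: entire_mulmx|exact: entire_cst].
by apply: entire_expC; apply: entireD; [exact: entire_bil|exact: entire_cst].
Qed.

Lemma cmeas_Kc (d : measure_display) (T : measurableType d) (a b : T -> m.-tuple R) :
  measurable_fun setT a -> measurable_fun setT b ->
  cmeas (fun u => Kc (cvec (a u)) (cvec (b u))).
Proof.
move=> ma mb; under eq_fun do rewrite Kc_Kf //.
apply: (cmeas_Kf (lcv q) (Defs.coef0 q) (Bmx_sym H) (Qmx_sym q) (tpos_Bmx hH pH) (tpos_BQ hH hq)) => i.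
apply: cmeas_mulmx => j; rewrite -(splitK j); case: (fintype.split j) => k /=.
  by under eq_fun do rewrite col_mxEu; exact: cmeas_cvec.
by under eq_fun do rewrite col_mxEd mxE; apply: cmeasJ; exact: cmeas_cvec.
Qed.

                                                                                  
(** Since $2\operatorname{Re}\langle s,t\rangle-h(s)-h(t)=-h(t-s)$, pairing with a normalised
    coherent state acts on moduli as a Gaussian convolution. *)
Let convolution z t s :
  normc (eq_ (cvec s) * kz z (cvec s) * (kz (cvec t) (cvec s))^*%C * (gH s)%:C) *
    expR (- hsq H (cvec t)) =
  normc (eq_ (cvec s) * kz z (cvec s)) * expR (- hsq H (cvec s)) *
    expR (- hsq H (cvec t - cvec s)).
Proof.
rewrite normcM [X in X * _ * _]normcM -2!mulrA -[RHS]mulrA; congr (_ * _).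
rewrite kz_conj // normcR (ger0_norm (gH_ge0 H s)) normc_expC /gH -!expRD; congr expR.
have -> : hsq H (cvec t - cvec s) = hsq H (cvec s) + hsq H (cvec t) - 2 * ReC (hdot H (cvec s) (cvec t)).
  by rewrite -hsqN // opprB hsqD // hsqN // hdotNr ReN mulrN.
by move: (hdot H _ _) (hsq H _) (hsq H _) => [a1 a2] b c /=; ring.
Qed.

(** By [convolution], $|K(\cdot,z)|e^{-h}$ is at most the convolution of the square integrable
    $|e^qk_z|e^{-h}$ with the integrable $e^{-h}$, so [schur_test] applies. *)
Lemma l2_galt z : l2 H (galt z).
Proof.
have mh : measurable_fun setT (fun t => hsq H (cvec t)).
  exact: (measurable_hsq H (@measurable_id _ _ _)).
have me : measurable_fun setT (fun t => expR (- hsq H (cvec t))).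
  by apply: (measurableT_comp (@measurable_expR R)); exact: measurable_funN.
have Ifin : (\int[leb]_t (expR (- hsq H (cvec t)))%:E < +oo)%E.
  have e2 : remx (map_mx (real_complex R) (2^-1 *: B)) = 2^-1 *: B.
    by apply/matrixP => i j; rewrite !mxE.
  have pc2 : tpos (remx (map_mx (real_complex R) (2^-1 *: B))).
    by rewrite e2; apply: tposZ => //; exact: tpos_Bmx.
  apply: eq_integral_lty (cintg_gauss pc2 0).2 => t.
  by rewrite addr0 normc_expC ReN Re_bil_cv e2 qfZ qf_Bmx // mulKf // pnatr_eq0.
pose I := fine (\int[leb]_t (expR (- hsq H (cvec t)))%:E).
have IE : (\int[leb]_t (expR (- hsq H (cvec t)))%:E = I%:E)%E.
  by rewrite fineK // ge0_fin_numE // integral_ge0 // => t _; rewrite lee_fin expR_ge0.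
have I0 : 0 <= I by apply: fine_ge0; apply: integral_ge0 => t _; rewrite lee_fin expR_ge0.
have shift s : (\int[leb]_t (expR (- hsq H (cvec t - cvec s)))%:E = I%:E)%E.
  rewrite -IE; apply: etrans ((preserves_tshift (tnth (tscale (-1) s))).2
    (fun t => (expR (- hsq H (cvec t)))%:E) _ _).
  - apply: eq_integral => t _; congr (expR (- hsq H _))%:E.
    rewrite -[tshift _ t]/(tadd (tscale (-1) s) t) cvec_tadd; congr (_ + _).
    by apply/matrixP => i j; rewrite !mxE !tnth_mktuple; apply: complexP => /=; ring.
  - exact/measurable_EFinP.
  - by move=> t; rewrite lee_fin expR_ge0.
pose ph t := normc (eq_ (cvec t) * kz z (cvec t)) * expR (- hsq H (cvec t)).
pose kp (p : m.-tuple R * m.-tuple R) := expR (- hsq H (cvec p.1 - cvec p.2)).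
have mph : measurable_fun setT ph.
  by apply: measurable_funM => //; apply: measurable_normc; exact: (l2_expq_kz z).1.
have mkp : measurable_fun setT kp.
  apply: (measurableT_comp (@measurable_expR R)); apply: measurable_funN.
  suff [] : cmeas (fun p : m.-tuple R * m.-tuple R =>
    bil H (cj (cvec p.1 - cvec p.2)) (cvec p.1 - cvec p.2)) by [].
  have c12 i : cmeas (fun p : m.-tuple R * m.-tuple R => (cvec p.1 - cvec p.2) i 0).
    have vB x y : (x - y) i 0 = x i 0 - y i 0 by rewrite !mxE.
    under eq_fun do rewrite vB.
    by apply: cmeasB; apply: cmeas_cvec; [exact: measurable_fst|exact: measurable_snd].
  by apply: cmeas_bil => // i; under eq_fun do rewrite mxE; exact: cmeasJ.
have ph2 t : ph t ^+ 2 = normc (eq_ (cvec t) * kz z (cvec t)) ^+ 2 * gH t.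
  rewrite /ph exprMn; congr (_ * _); rewrite expr2 -expRD /gH; congr expR; ring.
have hs x y : hsq H (x - y) = hsq H (y - x) by rewrite -hsqN // opprB.
have kp1 t : (\int[leb]_s (kp (t, s))%:E = I%:E)%E.
  by apply: etrans (shift t); apply: eq_integral => s _; rewrite /kp hs.
have [] : l2 H (fun w => Kc w z).
  have mK : cmeas (fun t => Kc (cvec t) z).
    have [s ->] := cvec_surj z.
    by apply: (cmeas_Kc (@measurable_id _ _ _)); exact: measurable_cst.
  split => //.
  pose g t := normc (Kc (cvec t) z) * expR (- hsq H (cvec t)).
  have g2 t : g t ^+ 2 = normc (Kc (cvec t) z) ^+ 2 * gH t.
    rewrite /g exprMn; congr (_ * _); rewrite expr2 -expRD /gH; congr expR; ring.
  have mg : measurable_fun setT g by exact: (measurable_funM (measurable_normc mK) me).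
  have gK t : ((g t)%:E <= \int[leb]_s (ph s * kp (t, s))%:E)%E.
    have cK := cintg_KcE (cvec t) z.
    have KK := le_normc_cintE cK; rewrite -KcE in KK.
    apply: (@le_trans _ _ ((\int[leb]_s (normc (eq_ (cvec s) * kz z (cvec s) *
        (kz (cvec t) (cvec s))^*%C * (gH s)%:C))%:E) * (expR (- hsq H (cvec t)))%:E)%E).
      have -> : (g t)%:E = ((normc (Kc (cvec t) z))%:E * (expR (- hsq H (cvec t)))%:E)%E.
        by rewrite -EFinM.
      by apply: lee_wpmul2r KK; rewrite lee_fin expR_ge0.
    have mF : measurable_fun setT (fun s => normc (eq_ (cvec s) * kz z (cvec s) *
        (kz (cvec t) (cvec s))^*%C * (gH s)%:C)) by exact: measurable_normc cK.1.
    rewrite le_eqVlt; apply/orP; left; apply/eqP.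
    apply: etrans (integralZr_EFin _ mF (fun _ => normc_ge0 _) (expR_ge0 _)) _.
    apply: eq_integral => s _.
    have e : ph s * kp (t, s) = normc (eq_ (cvec s) * kz z (cvec s) *
      (kz (cvec t) (cvec s))^*%C * (gH s)%:C) * expR (- hsq H (cvec t)) by exact/esym/convolution.
    by rewrite e.
  apply: (@le_lt_trans _ _ (((I + 1) ^+ 2)%:E * \int[leb]_t (ph t ^+ 2)%:E)%E).
    under eq_integral do rewrite -g2.
    apply: (schur_test (kp := kp)) => //.
    - by move=> t; rewrite mulr_ge0 ?normc_ge0 ?expR_ge0.
    - by move=> p; exact: expR_ge0.
    - by rewrite ltr_wpDl.
    - move=> t; apply: (@le_trans _ _ I%:E); last by rewrite lee_fin lerDl.
      by rewrite le_eqVlt; apply/orP; left; apply/eqP; exact: kp1.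
    - move=> t; apply: (@le_trans _ _ I%:E); last by rewrite lee_fin lerDl.
      by rewrite le_eqVlt; apply/orP; left; apply/eqP; exact: shift.
    - by move=> t; rewrite mulr_ge0 ?normc_ge0 ?expR_ge0.
  under eq_integral do rewrite ph2.
  by apply: lte_mul_pinfty => //; [rewrite lee_fin sqr_ge0|exact: (l2_expq_kz z).2].
move=> mK fK; split; first by apply: cmeasM => //; exact: cmeas_cst.
pose c := normc (kH H)%:C^-1 ^+ 2.
apply: (@le_lt_trans _ _ (c%:E * \int[leb]_t (normc (Kc (cvec t) z) ^+ 2 * gH t)%:E)%E).
  rewrite -ge0_integralZl //; first last.
  - by rewrite lee_fin sqr_ge0.
  - by move=> t _; rewrite lee_fin mulr_ge0 ?sqr_ge0 ?gH_ge0.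
  - exact: (@measurable_l2 _ _ H (fun w => Kc w z)).
  rewrite le_eqVlt; apply/orP; left; apply/eqP; apply: eq_integral => t _.
  rewrite -EFinM; congr EFin; rewrite /galt normcM exprMn /c.
  by move: (_ ^+ 2) (_ ^+ 2) (gH t) => x1 x2 x3; ring.
by apply: lte_mul_pinfty => //; rewrite lee_fin sqr_ge0.
Qed.

(** Reproducing $f$ inside $\int\overline{e^qk_z}\,f\,e^{-2h}$ and exchanging the integrals turns
    the inner one into $\overline{K(\cdot,z)}$, which is $c$ times the conjugate of [galt z]. *)
Lemma galt_orthogonal z f : entire f -> l2 H f ->
  cint leb (fun t => (eq_ (cvec t) * kz z (cvec t) - galt z (cvec t)) *
     (f (cvec t))^*%C * (gH t)%:C) = 0.
Proof.
move=> ef lf.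
have i1 := (l2_dot ltr01 (l2_expq_kz z) lf).1.
have i2 := (l2_dot ltr01 (l2_galt z) lf).1.
pose ph s := (eq_ (cvec s) * kz z (cvec s) * (gH s)%:C)^*%C.
have mph : cmeas ph.
  apply: cmeasJ; apply: cmeasM; last by apply: cmeasR; exact: measurable_gH.
  by apply: cmeasM; [exact: cmeas_expC cmeas_qeval|exact: cmeas_kz].
have fin : (\int[leb]_s (normc (ph s) * expR (hsq H (cvec s)))%:E < +oo)%E.
  by apply: eq_integral_lty (integral_expq_lty z) => s; rewrite [in RHS]/ph normcJ.
have KJ t s : (eq_ (cvec s) * kz z (cvec s) * (kz (cvec t) (cvec s))^*%C * (gH s)%:C)^*%C =
    ph s * (kz (cvec s) (cvec t))^*%C.
  rewrite (kz_sym (cvec s) t) /ph; apply: etrans (conjM _ _); congr conjc.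
  by move: (eq_ _) (kz z _) (conjc _) (_%:C) => b c d e; ring.
have ik t : cintg leb (fun s => ph s * (kz (cvec s) (cvec t))^*%C).
  by apply: eq_cintg (cintgJ (cintg_KcE (cvec t) z)) => s; exact: KJ.
have e := reproducing_fubini hH pH ef lf mph fin ik.
have E (t : m.-tuple R) : cint leb (fun s => ph s * (kz (cvec s) (cvec t))^*%C) =
    (Kc (cvec t) z)^*%C.
  rewrite KcE -cintJ; last exact: cintg_KcE.
  by apply: eq_cint => s; rewrite KJ.
have phJ s : ph s * f (cvec s) =
    (eq_ (cvec s) * kz z (cvec s) * (f (cvec s))^*%C * (gH s)%:C)^*%C.
  transitivity (conjc (eq_ (cvec s) * kz z (cvec s) * (gH s)%:C) * conjc (conjc (f (cvec s)))).
    by rewrite conjcK.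
  rewrite -conjM; congr conjc.
  by move: (eq_ _) (kz z _) (conjc _) (_%:C) => b c d a; ring.
have ip : cint leb (fun t => eq_ (cvec t) * kz z (cvec t) * (f (cvec t))^*%C * (gH t)%:C) =
    (cint leb (fun s => ph s * f (cvec s)))^*%C.
  rewrite -cintJ; last by apply: eq_cintg (cintgJ i1) => s; rewrite phJ.
  by apply: eq_cint => s; rewrite phJ conjcK.
have gJ t : conjc (galt z (cvec t) * conjc (f (cvec t)) * (gH t)%:C * (kH H)%:C) =
    f (cvec t) * (gH t)%:C * conjc (Kc (cvec t) z).
  have gK : galt z (cvec t) * (kH H)%:C = Kc (cvec t) z by rewrite /galt divfK.
  rewrite -gK !conjM conjcK.
  have cR (r : R) : conjc r%:C = r%:C :> C by apply: complexP => //=; rewrite oppr0.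
  rewrite !cR; move: (conjc _) (f _) (_%:C) (_%:C) => a b c d; ring.
have e2 : cint leb (fun t => galt z (cvec t) * (f (cvec t))^*%C * (gH t)%:C) * (kH H)%:C =
    (cint leb (fun s => ph s * f (cvec s)) * (kH H)%:C)^*%C.
  rewrite e -cintJ; last first.
    apply: eq_cintg (cintgJ (cintgMr (kH H)%:C i2)) => t.
    by rewrite E gJ.
  rewrite -cintZr //; apply: eq_cint => t; rewrite E.
  by rewrite -[LHS]conjcK gJ.
transitivity (cint leb (fun t => eq_ (cvec t) * kz z (cvec t) * (f (cvec t))^*%C * (gH t)%:C) -
   cint leb (fun t => galt z (cvec t) * (f (cvec t))^*%C * (gH t)%:C)).
  by rewrite -cintB //; apply: eq_cint => t; rewrite !mulrBl.
apply/eqP; rewrite subr_eq0; apply/eqP; apply: (mulIf kn0); rewrite e2 ip [RHS]conjM.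
by congr (_ * _); apply: complexP => //=; rewrite oppr0.
Qed.

End toeplitz_kernel.

(** * Boundedness of the operator and the kernel bound *)

Section toeplitz_boundedness.
Variables (R : realType) (n : nat).
Local Notation C := R[i].
Local Notation m := (n + n)%N.
Local Notation leb := (@leb R m).
Implicit Types (x y z w : 'cV[C]_n) (t s : m.-tuple R) (f g u v : 'cV[C]_n -> C).
Variables (H G : 'M[C]_n) (q : quad_poly R n) (Phi : 'cV[C]_n -> R).
Hypotheses (hH : hermitian H) (pH : hpos H)
  (hq : forall x, x != 0 -> ReC (principal q x) < hsq H x)
  (PhiE : forall x, Phi x = hsq H x + ReC (bil G x x)).
Local Notation kz := (kz H).
Local Notation gH := (gH H).
Local Notation Kc := (Kc H q).
Local Notation l2 := (l2 H).
Local Notation l2sq := (l2sq H).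
Local Notation eq_ := (eq_ q).

                                                                            
                                 
(** Multiplication by $e^{-G(x,x)}$, whose modulus compensates the pure part of $\Phi_0$: it carries
    the weight $e^{-2\Phi_0}$ to $e^{-2h}$ and preserves entire functions. *)
Definition twist u x : C := u x * expC (- bil G x x).
Definition untwist f x : C := f x * expC (bil G x x).

Lemma twistK f : twist (untwist f) = f.
Proof. by apply/funext => x; rewrite /twist /untwist -mulrA -expCD subrr expC0 mulr1. Qed.

Lemma entire_bilG : entire (fun x => bil G x x).
Proof. by apply: entire_bil => i; exact: entire_coord. Qed.

Lemma entire_twist u : entire u -> entire (twist u).
Proof.
move=> eu; apply: (entireM eu); apply: entire_expC.
under eq_fun do rewrite -mulN1r; apply: entireM; first exact: entire_cst.
exact: entire_bilG.
Qed.

Lemma entire_untwist f : entire f -> entire (untwist f).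
Proof. by move=> ef; apply: (entireM ef); apply: entire_expC; exact: entire_bilG. Qed.

Let cmeas_bilG : cmeas (fun t => bil G (cvec t) (cvec t)).
Proof. by apply: cmeas_bil => i; exact: (cmeas_cvec i (@measurable_id _ _ _)). Qed.

Lemma weight_twist u x : normc (u x) ^+ 2 * weight Phi x =
  normc (twist u x) ^+ 2 * expR (- (2 * hsq H x)).
Proof.
rewrite /twist /weight normcM exprMn -[RHS]mulrA; congr (_ * _).
rewrite normc_expC expr2 -!expRD PhiE; congr expR.
by move: (bil G x x) (hsq H x) => [a b] c /=; ring.
Qed.

Lemma L2Phi_twist u : L2Phi Phi u <-> l2 (twist u).
Proof.
split=> -[mu fu].
  split; first by apply: cmeasM => //; apply: cmeas_expC; exact: cmeasN.
  by apply: eq_integral_lty fu => t; rewrite weight_twist.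
split; last by apply: eq_integral_lty fu => t; rewrite weight_twist.
have : cmeas (fun t => twist u (cvec t) * expC (bil G (cvec t) (cvec t))).
  by apply: cmeasM => //; exact: cmeas_expC.
suff -> : (fun t => twist u (cvec t) * expC (bil G (cvec t) (cvec t))) = (fun t => u (cvec t)) by [].
by apply/funext => t; rewrite /twist -mulrA -expCD addNr expC0 mulr1.
Qed.

Lemma HPhi_twist u : HPhi Phi u -> l2 (twist u) /\ entire (twist u).
Proof. by move=> [/L2Phi_twist lu eu]; split => //; exact: entire_twist. Qed.

Lemma HPhi_untwist f : l2 f -> entire f -> HPhi Phi (untwist f).
Proof.
move=> lf ef; split; last exact: entire_untwist.
by apply/L2Phi_twist; rewrite twistK.
Qed.

Lemma normPhi_twist u : normPhi Phi u = Num.sqrt (l2sq (twist u)).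
Proof.
rewrite /normPhi /integralR /l2sq; congr (Num.sqrt _).
by apply: eq_Rintegral => t _; rewrite weight_twist.
Qed.

Lemma dotPhi_twist u v : dotPhi Phi u v =
  cint leb (fun t => twist u (cvec t) * conjc (twist v (cvec t)) * (gH t)%:C).
Proof.
apply: eq_cint => t; rewrite /twist /weight PhiE /gH.
have conjM (a b : C) : conjc (a * b) = conjc a * conjc b.
  by move: a b => [a1 a2] [b1 b2]; apply: complexP => /=; ring.
rewrite conjM expCJ.
have -> : (expR (-2 * (hsq H (cvec t) + ReC (bil G (cvec t) (cvec t)))))%:C =
    expC (- bil G (cvec t) (cvec t)) * expC (conjc (- bil G (cvec t) (cvec t))) *
    (expR (- (2 * hsq H (cvec t))))%:C.
  rewrite -!expC_real -!expCD; congr expC.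
  by move: (bil _ _ _) (hsq _ _) => [a b] c; apply: complexP => /=; ring.
have cE (a : C) : Num.conj a = conjc a by [].
rewrite ?cE; set a := u _; set b := conjc _; set c := expC _; set d := expC _; set e := _%:C.
by ring.
Qed.

Lemma twist_expq u x : twist (expq_mul q u) x = eq_ x * twist u x.
Proof. by rewrite /twist /expq_mul mulrA. Qed.

Let realC_norm (r : R) : 0 <= r -> normc r%:C = r.
Proof. by move=> r0; rewrite normcR ger0_norm. Qed.

Section schur.
Hypothesis dH : \det (2%:C *: H - dlsubmx (coef2 q + (coef2 q)^T)) != 0.

(** Schur's test for the weighted kernel $|K(w,z)|e^{-h(w)-h(z)}$, applied to $|f|e^{-h}$ and
    $c^2|g|e^{-h}$; the constant is $S/c^2$ because [projection_formula] carries the factor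
    $c^2$. *)
Lemma projection_bounded D : kernel_bounded H q D -> exists2 M, 0 <= M &
  forall f g, entire f -> l2 f -> l2 (fun y => eq_ y * f y) -> entire g -> l2 g ->
  (forall w, cint leb (fun t => (eq_ (cvec t) * f (cvec t) - g (cvec t)) *
     (kz w (cvec t))^*%C * (gH t)%:C) = 0) ->
  l2sq g <= M ^+ 2 * l2sq f.
Proof.
move=> KD; have [S1 hS1] := schur_first hH pH hq dH KD.
have [S2 hS2] := schur_second hH pH hq dH KD.
pose S := `|S1| + `|S2| + 1.
have S0 : 0 < S by rewrite ltr_wpDl // addr_ge0.
have S1S : S1 <= S by apply: le_trans (ler_norm _) _; rewrite /S -addrA lerDl addr_ge0.
have S2S : S2 <= S.
  by apply: le_trans (ler_norm _) _; rewrite /S addrAC [_ + `|S2|]addrC lerDl addr_ge0.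
have k0 := kH_gt0 hH pH.
exists (S / kH H ^+ 2); first by rewrite divr_ge0 ?sqr_ge0 // ltW.
move=> f g ef lf lqf eg lg orth.
have PF := projection_formula hH pH hq ef lf lqf eg lg orth.
pose kp (p : m.-tuple R * m.-tuple R) :=
  normc (Kc (cvec p.1) (cvec p.2)) * expR (- (hsq H (cvec p.1) + hsq H (cvec p.2))).
pose ph t := normc (f (cvec t)) * expR (- hsq H (cvec t)).
pose h t := normc (g (cvec t)) * kH H ^+ 2 * expR (- hsq H (cvec t)).
have mid : measurable_fun setT (fun t : m.-tuple R => t) by exact: measurable_id.
have me : measurable_fun setT (fun t => expR (- hsq H (cvec t))).
  apply: (measurableT_comp (@measurable_expR R)); apply: measurable_funN.
  exact: (measurable_hsq H mid).
have mkp : measurable_fun setT kp.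
  apply: measurable_funM.
    apply: measurable_normc.
    by apply: (cmeas_Kc hH pH hq); [exact: measurable_fst|exact: measurable_snd].
  apply: (measurableT_comp (@measurable_expR R)); apply: measurable_funN.
  by apply: measurable_funD; apply: measurable_hsq; [exact: measurable_fst|exact: measurable_snd].
have mph : measurable_fun setT ph by exact: (measurable_funM (measurable_normc lf.1) me).
have mh : measurable_fun setT h.
  apply: measurable_funM me; apply: measurable_funM; last exact: measurable_cst.
  exact: measurable_normc lg.1.
have ph0 t : 0 <= ph t by rewrite mulr_ge0 ?normc_ge0 ?expR_ge0.
have h0 t : 0 <= h t.
  by apply: mulr_ge0; [apply: mulr_ge0; [exact: normc_ge0|exact: sqr_ge0]|exact: expR_ge0].
have kp0 p : 0 <= kp p by rewrite mulr_ge0 ?normc_ge0 ?expR_ge0.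
have kp1 t : (\int[leb]_s (kp (t, s))%:E <= S%:E)%E.
  by apply: le_trans (hS2 (cvec t)) _; rewrite lee_fin.
have kp2 t : (\int[leb]_s (kp (s, t))%:E <= S%:E)%E.
  by apply: le_trans (hS1 (cvec t)) _; rewrite lee_fin.
have hle t : ((h t)%:E <= \int[leb]_s (ph s * kp (t, s))%:E)%E.
  have KM : cmeas (fun s => f (cvec s) * (gH s)%:C * Kc (cvec t) (cvec s)).
    apply: cmeasM; last exact: (cmeas_Kc hH pH hq (measurable_cst t) mid).
    by apply: cmeasM; [exact: lf.1|apply: cmeasR; exact: measurable_gH].
  have e1 : h t = normc (cint leb (fun s => f (cvec s) * (gH s)%:C * Kc (cvec t) (cvec s))) *
      expR (- hsq H (cvec t)).
    rewrite -PF /h 2!normcM realC_norm ?ltW //; congr (_ * _).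
    by rewrite expr2 mulrA.
  have e2 s : normc (f (cvec s) * (gH s)%:C * Kc (cvec t) (cvec s)) * expR (- hsq H (cvec t)) =
      ph s * kp (t, s).
    rewrite -[kp (t, s)]/(normc (Kc (cvec t) (cvec s)) * expR (- (hsq H (cvec t) + hsq H (cvec s)))).
    move: (Kc (cvec t) (cvec s)) => K; rewrite 2!normcM realC_norm ?gH_ge0 // /ph /gH.
    have -> : expR (- (2 * hsq H (cvec s))) = expR (- hsq H (cvec s)) * expR (- hsq H (cvec s)).
      by rewrite -expRD; congr expR; ring.
    rewrite opprD expRD.
    move: (normc (f _)) (normc K) (expR (- hsq H (cvec s))) (expR _) => a b c d; ring.
  rewrite e1; have mF := measurable_normc KM.
  (* An infinite right-hand side is trivial; a finite one makes the integrand of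
     [projection_formula] integrable, so the modulus may be taken inside. *)
  have [ioo|ifin] := eqVneq (\int[leb]_s (ph s * kp (t, s))%:E)%E +oo%E.
    by rewrite ioo leey.
  have EI := integralZr_EFin leb mF (fun _ => normc_ge0 _) (expR_ge0 (- hsq H (cvec t))).
  have EI' : (\int[leb]_s (normc (f (cvec s) * (gH s)%:C * Kc (cvec t) (cvec s)))%:E *
      (expR (- hsq H (cvec t)))%:E = \int[leb]_s (ph s * kp (t, s))%:E)%E.
    by rewrite EI; apply: eq_integral => s _; rewrite e2.
  have [noo|nfin] := eqVneq (\int[leb]_s (normc (f (cvec s) * (gH s)%:C * Kc (cvec t) (cvec s)))%:E)%E +oo%E.
    by move: ifin; rewrite -EI' noo gt0_mulye ?lte_fin ?expR_gt0.
  have ci : cintg leb (fun s => f (cvec s) * (gH s)%:C * Kc (cvec t) (cvec s)).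
    by split => //; rewrite lt_neqAle nfin leey.
  rewrite -EI' EFinM; apply: lee_wpmul2r; first by rewrite lee_fin expR_ge0.
  exact: le_normc_cintE.
have ST := schur_test mph mkp ph0 kp0 S0 kp1 kp2 mh h0 hle.
have gE s : gH s = expR (- hsq H (cvec s)) ^+ 2.
  by rewrite expr2 -expRD /gH; congr expR; ring.
have eph : (\int[leb]_t (ph t ^+ 2)%:E = (l2sq f)%:E)%E.
  by rewrite -l2sqE //; apply: eq_integral => t _; rewrite /ph exprMn gE.
have eh : (\int[leb]_t (h t ^+ 2)%:E = (l2sq g * kH H ^+ 4)%:E)%E.
  have m2 : measurable_fun setT (fun t => normc (g (cvec t)) ^+ 2 * gH t).
    by apply/measurable_EFinP; apply: measurable_l2; exact: lg.1.
  have k4 : 0 <= kH H ^+ 4 by rewrite exprn_ge0 // ltW.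
  have E4 := integralZr_EFin leb m2 (l2_ge0 H g) k4.
  rewrite EFinM -(l2sqE lg); apply: etrans (esym _); last exact: E4.
  apply: eq_integral => t _; congr EFin; rewrite gE /h.
  by move: (normc _) (expR _) (kH H) => a b c; ring.
rewrite eph eh -EFinM lee_fin in ST.
rewrite expr_div_n mulrAC ler_pdivlMr ?exprn_gt0 // -exprM.
exact: ST.
Qed.

Lemma Top_bounded_of_kernel D : kernel_bounded H q D -> Top_bounded Phi q.
Proof.
move=> /projection_bounded [M M0 hM]; exists M => u [Hu Lu].
have [lu eu] := HPhi_twist Hu.
rewrite /Top /PiPhi; set A := (A in xget _ A).
(* If no projection exists, [PiPhi] returns its default value zero and the bound is trivial. *)
have [[g Ag]|nA] := pselect (exists g, A g); last first.
  rewrite xgetPN; last by move=> g Ag; apply: nA; exists g.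
  rewrite normPhi_twist [l2sq _](_ : _ = 0) ?sqrtr0 ?mulr_ge0 ?sqrtr_ge0 //.
  rewrite /l2sq /Rintegral /twist.
  by under eq_integral do rewrite mul0r normc0 expr0n mul0r; rewrite integral0.
have [Hg orth] := xgetPex (fun=> 0) (ex_intro _ g Ag).
set g' := xget _ _ in Hg orth *.
have [lg eg] := HPhi_twist Hg.
rewrite !normPhi_twist -(ger0_norm M0) -sqrtr_sqr -sqrtrM ?sqr_ge0 //.
rewrite ler_sqrt ?mulr_ge0 ?sqr_ge0 ?l2sq_ge0 //.
apply: (hM (twist u)) => //.
  have /L2Phi_twist := Lu; congr (l2 _); apply/funext => x; exact: twist_expq.
move=> w; have Hk : HPhi Phi (untwist (kz w)).
  by apply: HPhi_untwist; [exact: l2_kz|exact: entire_kz].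
have := orth _ Hk; rewrite dotPhi_twist twistK => <-; apply: eq_cint => t.
congr (_ * _ * _); rewrite -twist_expq /twist mulrBl; exact: erefl.
Qed.
End schur.

Lemma twist_res u g x : twist (fun x => expq_mul q u x - g x) x =
  eq_ x * twist u x - twist g x.
Proof. by rewrite -twist_expq /twist mulrBl. Qed.

(** Test the operator on $k_z$: $|K(w,z)|=|\langle\mathrm{Top}\,k_z,k_w\rangle|\le
    M\|k_z\|\,\|k_w\|$, up to the twist. *)
Lemma kernel_of_Top_bounded : Top_bounded Phi q -> exists D, kernel_bounded H q D.
Proof.
move=> [M hM]; pose M' := `|M| + 1.
have M'0 : 0 < M' by rewrite ltr_wpDl.
have M'M : M <= M' by apply: le_trans (ler_norm _) _; rewrite lerDl.
have k0 := kH_gt0 hH pH.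
exists (M' * kH H) => w z.
pose u := untwist (kz z).
have twu : twist u = kz z by exact: twistK.
have Du : Top_dom Phi q u.
  split; first by apply: HPhi_untwist; [exact: l2_kz|exact: entire_kz].
  apply/L2Phi_twist; have -> : twist (expq_mul q u) = fun y => eq_ y * kz z y.
    by apply/funext => x; rewrite twist_expq twu.
  exact: l2_expq_kz.
have := hM _ Du; rewrite /Top /PiPhi.
set A := (A in xget _ A).
(* A projection exists, so [xget] selects a genuine one; from here on only its defining properties
   are used. *)
have exA : A (untwist (galt H q z)).
  split; first by apply: HPhi_untwist; [exact: l2_galt|exact: entire_galt].
  move=> h /HPhi_twist [lh eh]; rewrite dotPhi_twist.
  rewrite -[RHS](galt_orthogonal hH pH hq z eh lh); apply: eq_cint => t.
  by rewrite twist_res twu twistK.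
have [Hg orth] := xgetPex (fun=> 0) (ex_intro _ _ exA).
set g := xget _ _ in Hg orth * => bnd.
have [lg eg] := HPhi_twist Hg.
have Hw : HPhi Phi (untwist (kz w)).
  by apply: HPhi_untwist; [exact: l2_kz|exact: entire_kz].
have lw := l2_kz hH pH w.
(* This weight balances the two terms of [l2_dot], each becoming $M'c\,e^{h(w)+h(z)}$ before
   halving. *)
pose k := expR (hsq H w) / (M' * expR (hsq H z)).
have kp : 0 < k by rewrite divr_gt0 ?mulr_gt0 ?expR_gt0.
have [ci hi] := l2_dot kp lg lw.
have Ew := orth _ Hw; rewrite dotPhi_twist twistK in Ew.
have Kg : Kc w z = cint leb (fun t => twist g (cvec t) * (kz w (cvec t))^*%C * (gH t)%:C).
  rewrite (KcE q hH w z); apply/eqP; rewrite -subr_eq0; apply/eqP.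
  rewrite -(cintB (cintg_KcE hH pH hq w z) ci) -[RHS]Ew; apply: eq_cint => t.
  by rewrite twist_res twu !mulrBl.
have lgz : l2sq (twist g) <= M' ^+ 2 * l2sq (kz z).
  rewrite !normPhi_twist twu in bnd.
  rewrite -(@ler_sqrt _ (l2sq (twist g))) ?(mulr_ge0 (sqr_ge0 M')) ?l2sq_ge0 //.
  rewrite sqrtrM ?sqr_ge0 // sqrtr_sqr (ger0_norm (ltW M'0)).
  by apply: le_trans bnd _; apply: ler_wpM2r => //; exact: sqrtr_ge0.
rewrite Kg -lee_fin; apply: le_trans (le_normc_cintE ci) _.
apply: le_trans hi _; rewrite lee_fin ler_pdivrMr //.
have kn : 0 <= k by exact: ltW.
apply: le_trans (lerD (ler_wpM2l kn lgz) (lexx _)) _.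
rewrite !l2sq_kz // /k expRD.
have e2 x : expR (2 * hsq H x) = expR (hsq H x) ^+ 2 by rewrite expr2 -expRD; congr expR; ring.
rewrite !e2; have a0 := expR_gt0 (hsq H w); have b0 := expR_gt0 (hsq H z).
move: (expR (hsq H w)) (expR (hsq H z)) a0 b0 => a b a0 b0.
rewrite le_eqVlt; apply/orP; left; apply/eqP; field.
by rewrite !gt_eqF.
Qed.

End toeplitz_boundedness.

                                  

(** * The Weyl symbol in real coordinates *)

Section weyl_symbol_kernel.
Variables (R : realType) (n : nat).
Local Notation C := R[i].
Local Notation m := (n + n)%N.
Local Notation leb := (@leb R m).
Variables (H G : 'M[C]_n) (q : quad_poly R n) (Phi : 'cV[C]_n -> R).
Hypotheses (hH : hermitian H) (pH : hpos H)
  (hq : forall x, x != 0 -> ReC (principal q x) < hsq H x)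
  (PhiE : forall x, Phi x = hsq H x + ReC (bil G x x)).
Local Notation af := (af (Bmx H) (Qmx q) (lcv q) (Defs.coef0 q)).

Definition gauss_const : R := integralR (fun y => expR (- 4 * Phi_herm Phi y)).

(** The constant is [kH] for the form $2H$, as $4h$ is twice the form of $2H$. *)
Lemma gauss_const_gt0 : 0 < gauss_const.
Proof.
have e2 y : hsq (2%:C *: H) y = 2 * hsq H y.
  rewrite /hsq /hdot /bil -scalemxAr -scalemxAl mxE.
  by move: (fun_of_matrix _ _ _) => [a b] /=; ring.
have hH2 : hermitian (2%:C *: H).
  rewrite /hermitian linearZ /= -hH; apply/matrixP => i j; rewrite !mxE.
  by move: (H i j) => [a b]; apply: complexP => /=; ring.
have pH2 : hpos (2%:C *: H) by move=> y y0; rewrite e2 mulr_gt0 ?pH.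
suff -> : gauss_const = kH (2%:C *: H) by exact: kH_gt0.
apply: eq_Rintegral => t _; rewrite (Phi_herm_hermitian _ PhiE) /gH e2.
by congr expR; ring.
Qed.

(** Positive total mass selects the essential supremum in the definition of the norm with exponent
    [+oo]. *)
Lemma leb_setT_gt0 : (0 < leb setT)%E.
Proof.
apply: (@lt_le_trans _ _ (leb (tbox `[0, 1]))); first by rewrite leb_tbox_unit lte01.
by apply: le_measure; rewrite ?inE //; exact: measurable_tbox.
Qed.

Lemma weyl_symbolE t : weyl_symbol q (Lambda_param Phi (cvec t)) =
  (gauss_const^-1)%:C * af (cv t).
Proof.
rewrite /weyl_symbol /af -/gauss_const; congr (_ * _).
apply: eq_cint => s; congr expC.
have cvB : cv s - cv t = cv (tadd (tscale (-1) t) s).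
  by rewrite cvD cvZ rmorphN1 scaleN1r.
have cvecB : cvec (tadd (tscale (-1) t) s) = cvec s - cvec t.
  rewrite cvec_tadd; congr (_ + _); apply/matrixP => i j; rewrite !mxE !tnth_mktuple.
  by apply: complexP => /=; rewrite mulN1r.
rewrite cvB -(pt_cvec (tadd _ _)) bil_Bmx // hdot_diag // cvecB qeval_cvec addrC; congr (_ + _).
rewrite (Phi_herm_hermitian _ PhiE) /= -(hsqN H (cvec t - cvec s)) opprB.
by move: (hsq H _) => a; apply: complexP => /=; ring.
Qed.

Lemma cmeas_weyl_symbol : measurable_cplx (weyl_symbol q \o Lambda_param Phi).
Proof.
have : cmeas (fun t => weyl_symbol q (Lambda_param Phi (cvec t))); last by [].
under eq_fun do rewrite weyl_symbolE.
apply: cmeasM; first exact: cmeas_cst.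
exact: (cmeas_weyl _ _ (Bmx_sym H) (Qmx_sym q) (tpos_Bmx hH pH) (tpos_BQ hH hq)).
Qed.

Lemma normc_weyl_symbol t : normc (weyl_symbol q (Lambda_param Phi (cvec t))) =
  gauss_const^-1 * normc (af (cv t)).
Proof.
by rewrite weyl_symbolE normcM normcR ger0_norm // invr_ge0 ltW // gauss_const_gt0.
Qed.

Let abse_weyl t :
  (abse \o (EFin \o fun t => normc (weyl_symbol q (Lambda_param Phi (cvec t))))) t =
  (gauss_const^-1 * normc (af (cv t)))%:E.
Proof. by rewrite -normc_weyl_symbol; congr EFin; exact: ger0_norm (normc_ge0 _). Qed.

Lemma Linfty_weyl_ae : Linfty_Lambda (weyl_symbol (Phi := Phi) q) ->
  exists S, \forall s \ae leb, normc (af (cv s)) <= S.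
Proof.
move=> [_]; rewrite /finite_norm unlock leb_setT_gt0.
set M := ess_sup _ _ => Moo.
have [r Mr] : exists r : R, (M <= r%:E)%E.
  by case: M Moo => [r _| //|_]; [exists r|exists 0; rewrite leNye].
move: Mr => /ess_supP aeM; exists (gauss_const * r).
apply: filterS aeM => t; rewrite abse_weyl lee_fin mulrC.
by rewrite ler_pdivrMr ?gauss_const_gt0 // mulrC.
Qed.

Lemma weyl_bounded_Linfty S : (forall s, normc (af (cv s)) <= S) ->
  Linfty_Lambda (weyl_symbol (Phi := Phi) q).
Proof.
move=> hS; split; first exact: cmeas_weyl_symbol.
rewrite /finite_norm unlock leb_setT_gt0.
apply: (@le_lt_trans _ _ (gauss_const^-1 * S)%:E); last exact: ltry.
apply/ess_supP; apply: nearW => t; rewrite abse_weyl lee_fin ler_wpM2l //.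
by rewrite invr_ge0 ltW // gauss_const_gt0.
Qed.

End weyl_symbol_kernel.

Theorem theorem1p1 (R : realType) (n : nat)
    (Phi0 : 'cV[R[i]]_n -> R) (q : quad_poly R n) :
  real_quadratic_form Phi0 ->
  strictly_psh Phi0 ->
  (forall x : 'cV[R[i]]_n, x != 0 ->
     complex.Re (principal q x) < Phi_herm Phi0 x) ->
  (forall x : 'cV[R[i]]_n,
     \det (dz_dzbar (fun y => 2 * liftC Phi0 y - principal q y) x) != 0) ->
  Top_bounded Phi0 q <-> Linfty_Lambda (weyl_symbol (Phi := Phi0) q).
Proof.
move=> quadPhi pshPhi hRe hdet.
have [H [G [hH pH PhiE dzE]]] := hermitian_part quadPhi pshPhi.
have hq x : x != 0 -> ReC (principal q x) < hsq H x.
  by move=> /hRe; rewrite (Phi_herm_hermitian _ PhiE).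
have dH : \det (2%:C *: H - dlsubmx (coef2 q + (coef2 q)^T)) != 0.
  (* The matrix of second derivatives is constant, so evaluation at the origin suffices. *)
  by have := hdet 0; rewrite dzE det_tr.
have pB := tpos_Bmx hH pH; have pBQ := tpos_BQ hH hq.
have sB := Bmx_sym H; have sQ := Qmx_sym q.
split.
  move=> /(kernel_of_Top_bounded hH pH hq PhiE) [D /(kernel_boundedE q hH) KD].
  have [S hS] := weyl_bounded_of_kernel sB sQ pB pBQ KD.
  exact: (weyl_bounded_Linfty hH pH hq PhiE hS).
move=> /(Linfty_weyl_ae hH pH PhiE) [S hS].
have [D KD] := kernel_bound_of_weyl sB sQ pB pBQ hS.
by apply: (Top_bounded_of_kernel hH pH hq PhiE dH (D := D)); apply/kernel_boundedE.
Qed.
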